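(* Assume that $\mathbb{F}$ is perfect. Let $G$ be a finite index subgroup of $\Gamma=\mathcal{G}(A)$. Let $\{\xi_\sigma\}_{\sigma\in\Sigma_0}$ be a set of representatives of the $G$-orbits in $\partial_\infty(X)$. For each $\sigma\in\Sigma_0$ let $(u,v)=f^{-1}(\xi_\sigma)\in H(\ell,k)\cup\{\infty\}$, let $G_\sigma$ be the stabilizer of $\xi_\sigma$ in $G$, that is, $$G_\sigma=\mathrm{Stab}_{\mathcal{G}(k)}(\xi_\sigma)\cap G=g_{u,v}^{-1}\mathcal{B}(k)g_{u,v}\cap G,$$ and let $\mathcal{U}(G_\sigma):=g_{u,v}^{-1}\mathcal{U}_a(k)g_{u,v}\cap G$. Then: (1) $\mathcal{U}(G_\sigma)$ is the subgroup consisting of all the unipotent elements of $G_\sigma$, and $G_\sigma/\mathcal{U}(G_\sigma)$ is isomorphic to a subgroup of $\mathbb{F}^*$; (2) $\mathfrak{U}=\{\mathcal{U}(G_\sigma):\sigma\in\Sigma_0\}$ is a set of representatives of the $G$-conjugacy classes of maximal unipotent subgroups of $G$ (and $\mathcal{U}(G_{\sigma_1})$, $\mathcal{U}(G_{\sigma_2})$ are not $G$-conjugate for $\sigma_1\ne\sigma_2$); (3) if $\mathbb{F}=\mathbb{F}_{p^r}$ and $G$ is without $p'$-torsion, then $\mathcal{U}(G_\sigma)=G_\sigma$ for all $\sigma\in\Sigma_0$.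
   Context: Setting. $\mathbb{F}$ is a field of characteristic $\neq 2$; $\mathcal{C}$ is a smooth, projective, geometrically integral curve over $\mathbb{F}$ with function field $k$; $\ell/k$ is a quadratic field extension such that $\mathbb{F}$ is algebraically closed in $\ell$ ($\ell$ is the function field of a geometrically integral curve $\mathcal{D}$ with a $2:1$ morphism $\mathcal{D}\to\mathcal{C}$); $x\mapsto\overline{x}$ is the nontrivial element of $\mathrm{Gal}(\ell/k)$, $N(x)=x\overline{x}$, $T(x)=x+\overline{x}$. $P$ is a closed point of $\mathcal{C}$ with a unique point $Q$ of $\mathcal{D}$ above it; $A\subset k$ is the ring of functions regular outside $P$; $B$ is the integral closure of $A$ in $\ell$. On $\ell^3$ consider the hermitian form $h(x,y)=x_{-1}\overline{y_1}+x_0\overline{y_0}+x_1\overline{y_{-1}}$, coordinates ordered $(x_{-1},x_0,x_1)$. $\mathcal{G}=\mathrm{SU}(h)$, so $\mathcal{G}(k)=\{g\in\mathrm{SL}_3(\ell): h(gx,gy)=h(x,y)\}$ and $\Gamma=\mathcal{G}(A)=\mathcal{G}(k)\cap\mathrm{SL}_3(B)$. $H(\ell,k)=\{(u,v)\in\ell^2: N(u)+T(v)=0\}$; for $(u,v)\in H(\ell,k)$, $\mathrm{u}_a(u,v)=\begin{pmatrix}1&-\overline{u}&v\\0&1&u\\0&0&1\end{pmatrix}$, and $\mathcal{U}_a(k)=\mathrm{u}_a(H(\ell,k))$. $\mathcal{B}(k)$ is the group of upper triangular matrices in $\mathcal{G}(k)$; $\mathcal{U}_a$ is the unipotent radical of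 the Borel subgroup $\mathcal{B}$. $\mathrm{s}$ is the $3\times3$ matrix with $-1$ on the antidiagonal and $0$ elsewhere. $g_{u,v}=\mathrm{s}\,\mathrm{u}_a(u,v)=\begin{pmatrix}0&0&-1\\0&-1&-u\\-1&\overline{u}&-v\end{pmatrix}$ and $g_\infty=\mathrm{id}$ (when $(u,v)$ stands for $\infty$). Tree. $\nu$ is the normalized discrete valuation of $k$ at $P$ and also its unique extension to $\ell$. The standard apartment is the line $\mathbb{A}_0=\mathbb{R}a^\vee$, with the linear form $a(ra^\vee)=2r$; its vertices are the $x$ with $a(x)\in\frac12\nu(\ell^* )$. $\mathcal{S}$ is the torus of matrices $\mathrm{diag}(s,1,s^{-1})$; the group $\mathcal{N}(k)$ of $k$-points of its normalizer in $\mathcal{G}$ is generated by $\mathrm{s}$ and the $\tilde a(t)=\mathrm{diag}(t,\overline{t}t^{-1},\overline{t}^{-1})$, $t\in\ell^*$, and acts on $\mathbb{A}_0$ by $\tilde a(t)\cdot x=x-\frac12\nu(t)a^\vee$, $\mathrm{s}\cdot x=-x$. Put $\mathrm{u}_{-a}=\mathrm{s}\,\mathrm{u}_a\,\mathrm{s}$, $\mathcal{U}_{b,x}(k)=\{\mathrm{u}_b(u,v):(u,v)\in H(\ell,k),\ \nu(v)\ge-2b(x)\}$ for $b=\pm a$, and $\mathcal{U}_x(k)=\langle\mathcal{U}_{a,x}(k),\mathcal{U}_{-a,x}(k)\rangle$. The Bruhat-Tits tree is $X=\mathcal{G}(k)\times\mathbb{A}_0/\sim$, where $(g,x)\sim(h,y)$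 iff there is $n\in\mathcal{N}(k)$ with $y=n\cdot x$ and $g^{-1}hn\in\mathcal{U}_x(k)$; $\mathcal{G}(k)$ acts on it by left multiplication. Visual limits. Two rays (one-sided infinite paths without repeated vertices) have the same visual limit if, up to a shift of indices, their vertices eventually coincide. $\partial_\infty(X)$ is the set of visual limits of rays of $X$ contained in an apartment $g\cdot\mathbb{A}_0$, $g\in\mathcal{G}(k)$; $\mathcal{G}(k)$ acts on it. $\xi_\infty$ is the visual limit of the ray $\{x\in\mathbb{A}_0:a(x)\ge0\}$; its stabilizer in $\mathcal{G}(k)$ is $\mathcal{B}(k)$. The map $f:H(\ell,k)\cup\{\infty\}\to\partial_\infty(X)$, $f(z)=\xi_z:=g_z^{-1}\cdot\xi_\infty$, is a bijection. A subgroup of $\mathcal{G}(k)\subset\mathrm{SL}_3(\ell)$ is unipotent if all its elements are unipotent matrices; maximal unipotent subgroups of $G$ are unipotent subgroups of $G$ maximal for inclusion. A group is without $p'$-torsion if every element of finite order has $p$-power order. *)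

(* Defs.v *)
From HB Require Import structures.
From mathcomp Require Import all_boot all_order all_algebra all_field.
From mathcomp Require Import all_classical reals.

Set Implicit Arguments.
Unset Strict Implicit.
Unset Printing Implicit Defensive.

Import Order.TTheory GRing.Theory Num.Theory.
Local Open Scope classical_set_scope.
Local Open Scope ring_scope.

Definition perfect_field (F : fieldType) : Prop :=
  forall p : {poly F}, irreducible_poly p -> separable_poly p.

(* Curves are given by their function fields.  Over a perfect field F, smooth  *)
(* projective geometrically integral curves correspond to the extensions K/F   *)
(* below, closed points to normalized discrete valuations of K trivial on F,   *)
(* and finite morphisms to finite extensions of function fields.               *)
Section FunctionFields.
Variables (F K : fieldType) (j : {rmorphism F -> K}).

Definition algebraically_closed_in : Prop :=
  forall x : K, algebraicOver j x -> exists a : F, x = j a.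

(* K is finite over F(t): every x in K is a combination of the entries of s    *)
(* with coefficients c_i(t) / q(t).                                            *)
Definition finite_over_adjoin (t : K) : Prop :=
  exists s : seq K, forall x : K,
    exists (q : {poly F}) (c : 'I_(size s) -> {poly F}),
      q != 0 /\
      (map_poly j q).[t] * x = \sum_i (map_poly j (c i)).[t] * s`_i.

Definition is_function_field : Prop :=
  algebraically_closed_in /\
  exists t : K, ~ algebraicOver j t /\ finite_over_adjoin t.

(* The value ord 0 is irrelevant; it stands for +oo and is never used.         *)
Record place := Place {
  ord :> K -> int;
  ordM : forall x y, x != 0 -> y != 0 -> ord (x * y) = ord x + ord y;
  ordD : forall x y, x != 0 -> y != 0 -> x + y != 0 ->
    Num.min (ord x) (ord y) <= ord (x + y);
  ord_const : forall a : F, a != 0 -> ord (j a) = 0;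
  ord_surj : exists2 x, x != 0 & ord x = 1 }.

Definition same_place (P Q : place) : Prop := forall x, x != 0 -> P x = Q x.

Definition regular_outside (P : place) : set K :=
  [set x | forall P' : place, ~ same_place P' P -> x = 0 \/ 0 <= P' x].

End FunctionFields.

Definition lies_over (F k : fieldType) (L : fieldExtType k)
    (j : {rmorphism F -> k}) (j' : {rmorphism F -> L})
    (Q : place j') (P : place j) (e : nat) : Prop :=
  (0 < e)%N /\ forall x : k, x != 0 -> Q (x%:A) = e%:Z * P x.

Definition integral_closure (k : fieldType) (L : fieldExtType k) (A : set k) :
    set L :=
  [set x | exists p : {poly k}, [/\ p \is monic, forall i, A p`_i &
                                    root (map_poly (in_alg L) p) x]].

(* Subgroups of the unit group of a ring; used for GL_3(l) and for F^*.        *)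
Section Groups.
Variable M : unitRingType.

Definition is_subgroup (H : set M) : Prop :=
  [/\ H 1, forall x, H x -> x \is a GRing.unit,
      forall x y, H x -> H y -> H (x * y) & forall x, H x -> H x^-1].

Definition generated (S : set M) : set M :=
  [set x | forall H, is_subgroup H -> S `<=` H -> H x].

Definition lcoset (g : M) (H : set M) : set M := [set g * h | h in H].

Definition cosets (G H : set M) : set (set M) := [set lcoset g H | g in G].

Definition finite_index (G H : set M) : Prop :=
  [/\ is_subgroup H, H `<=` G & finite_set (cosets G H)].

Definition normal_in (H G : set M) : Prop :=
  [/\ is_subgroup H, H `<=` G &
      forall g h, G g -> H h -> H (g * h * g^-1)].

Definition setmul (C D : set M) : set M :=
  [set z | exists x y, [/\ C x, D y & z = x * y]].

Definition conj_set (g : M) (S : set M) : set M := [set g * x * g^-1 | x in S].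

Definition conjugate_in (G S T : set M) : Prop :=
  exists2 g, G g & T = conj_set g S.

Definition unipotent : set M := [set g | exists n, (g - 1) ^+ n = 0].

Definition unipotent_subgroup (G U : set M) : Prop :=
  [/\ is_subgroup U, U `<=` G & U `<=` unipotent].

Definition maximal_unipotent_subgroup (G U : set M) : Prop :=
  unipotent_subgroup G U /\
  forall V, unipotent_subgroup G V -> U `<=` V -> V = U.

Definition has_order (g : M) (n : nat) : Prop :=
  [/\ (0 < n)%N, g ^+ n = 1 &
      forall m, (0 < m)%N -> g ^+ m = 1 -> (n <= m)%N].

Definition without_p'_torsion (p : nat) (G : set M) : Prop :=
  forall g n, G g -> has_order g n -> exists m, n = (p ^ m)%N.

End Groups.

(* G / H is isomorphic to a subgroup of N; H is required to be normal in G.    *)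
Definition quotient_embeds (M N : unitRingType) (G H : set M) : Prop :=
  normal_in H G /\
  exists (S : set N) (phi : set M -> N),
    [/\ is_subgroup S, set_bij (cosets G H) S phi &
        forall C D, cosets G H C -> cosets G H D ->
          phi (setmul C D) = phi C * phi D].

(* The coordinates -1, 0, 1 are indexed by 0, 1, 2 in 'I_3, so that rev_ord    *)
(* is i |-> -i.                                                                *)
Section UnitaryGroup.
Variables (L : fieldType) (conj : L -> L).
Implicit Types (u v t : L) (g : 'M[L]_3).

Definition mx3 (rows : seq (seq L)) : 'M[L]_3 :=
  \matrix_(i, j) (nth [::] rows i)`_j.

Definition nrm (x : L) : L := x * conj x.
Definition trc (x : L) : L := x + conj x.

Definition herm (x y : 'cV[L]_3) : L :=
  \sum_(i < 3) x i 0 * conj (y (rev_ord i) 0).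

Definition SU : set 'M[L]_3 :=
  [set g | \det g = 1 /\ forall x y, herm (g *m x) (g *m y) = herm x y].

Definition SU_over (B : set L) : set 'M[L]_3 :=
  [set g | SU g /\ forall i j, B (g i j)].

Definition borel : set 'M[L]_3 :=
  [set g | SU g /\ forall i j : 'I_3, (j < i)%N -> g i j = 0].

Definition Hset : set (L * L) := [set z | nrm z.1 + trc z.2 = 0].

Definition u_a (z : L * L) : 'M[L]_3 :=
  mx3 [:: [:: 1; - conj z.1; z.2]; [:: 0; 1; z.1]; [:: 0; 0; 1]].

Definition s_mx : 'M[L]_3 :=
  mx3 [:: [:: 0; 0; -1]; [:: 0; -1; 0]; [:: -1; 0; 0]].

Definition u_ma (z : L * L) : 'M[L]_3 := s_mx * u_a z * s_mx.

Definition U_a : set 'M[L]_3 := [set u_a z | z in Hset].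

Definition a_tilde (t : L) : 'M[L]_3 :=
  mx3 [:: [:: t; 0; 0]; [:: 0; conj t / t; 0]; [:: 0; 0; (conj t)^-1]].

(* H(l,k) with the extra element infinity, encoded as None.                    *)
Definition Hinf : set (option (L * L)) :=
  [set z | if z is Some uv then Hset uv else True].

Definition g_of (z : option (L * L)) : 'M[L]_3 :=
  if z is Some uv then s_mx * u_a uv else 1.

End UnitaryGroup.

(* The point r a^vee of the standard apartment is represented by r : R.  The   *)
(* valuation nu : L -> R is only meaningful on nonzero elements.               *)
Section Tree.
Variables (R : realType) (L : fieldType) (conj : L -> L) (nu : L -> R).
Implicit Types (x y r : R) (g : 'M[L]_3).

Definition a_form (r : R) : R := 2 * r.

Definition apt_vertex (x : R) : Prop :=
  exists2 t : L, t != 0 & a_form x = nu t / 2.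

(* The graph of the action of N(k) on the apartment, given on generators;      *)
(* both families of generators are closed under inversion.                     *)
Inductive N_acts : 'M[L]_3 -> R -> R -> Prop :=
| N_acts_s x : N_acts (s_mx L) x (- x)
| N_acts_a t x : t != 0 -> N_acts (a_tilde conj t) x (x - nu t / 2)
| N_acts_mul n m x y z : N_acts n x y -> N_acts m y z -> N_acts (m * n) x z.

Definition U_a_at (x : R) : set 'M[L]_3 :=
  [set u_a conj z | z in [set z | Hset conj z /\
     (z.2 = 0 \/ - 2 * a_form x <= nu z.2)]].

Definition U_ma_at (x : R) : set 'M[L]_3 :=
  [set u_ma conj z | z in [set z | Hset conj z /\
     (z.2 = 0 \/ - 2 * - a_form x <= nu z.2)]].

Definition U_at (x : R) : set 'M[L]_3 := generated (U_a_at x `|` U_ma_at x).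

Definition tree_equiv (p q : 'M[L]_3 * R) : Prop :=
  exists2 n, N_acts n p.2 q.2 & U_at p.2 (p.1^-1 * q.1 * n).

(* Points of the tree are equivalence classes in SU x R.                       *)
Definition point : Type := set ('M[L]_3 * R).

Definition pt (g : 'M[L]_3) (x : R) : point :=
  [set q | SU conj q.1 /\ tree_equiv (g, x) q].

Definition act_pt (g : 'M[L]_3) (P : point) : point :=
  [set (g * q.1, q.2) | q in P].

Definition consecutive (x y : R) : Prop :=
  [/\ apt_vertex x, apt_vertex y, x < y &
      forall z, apt_vertex z -> ~ (x < z < y)].

Definition tree_vertex (P : point) : Prop :=
  exists g x, [/\ SU conj g, apt_vertex x & P = pt g x].

Definition adjacent (P Q : point) : Prop :=
  exists g x y, [/\ SU conj g, consecutive x y &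
    (P = pt g x /\ Q = pt g y) \/ (P = pt g y /\ Q = pt g x)].

Definition ray (rho : nat -> point) : Prop :=
  [/\ forall i, tree_vertex (rho i), forall i, adjacent (rho i) (rho i.+1) &
      injective rho].

Definition same_limit (rho rho' : nat -> point) : Prop :=
  exists m n, forall i, rho (m + i)%N = rho' (n + i)%N.

Definition tree_end : Type := set (nat -> point).

Definition visual_limit (rho : nat -> point) : tree_end :=
  [set rho' | ray rho' /\ same_limit rho rho'].

Definition in_apartment (g : 'M[L]_3) (rho : nat -> point) : Prop :=
  forall i, exists x, rho i = pt g x.

Definition boundary : set tree_end :=
  [set visual_limit rho | rho in [set rho | ray rho /\
     exists2 g, SU conj g & in_apartment g rho]].

Definition act_end (g : 'M[L]_3) (xi : tree_end) : tree_end :=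
  [set (fun i => act_pt g (rho i)) | rho in xi].

(* The vertices of the standard apartment with a(x) >= 0 have a unique         *)
(* increasing enumeration x; xi_infty is the visual limit of the ray it forms. *)
Definition xi_infty : tree_end :=
  [set rho | exists x : nat -> R,
    [/\ x 0%N = 0, forall i, consecutive (x i) (x i.+1) &
        visual_limit (fun i => pt 1 (x i)) rho]].

Definition xi_of (z : option (L * L)) : tree_end :=
  act_end (g_of conj z)^-1 xi_infty.

Definition end_stabilizer (xi : tree_end) : set 'M[L]_3 :=
  [set g | SU conj g /\ act_end g xi = xi].

Definition orbit_representatives (G : set 'M[L]_3) (Sigma : Type)
    (xi : Sigma -> tree_end) : Prop :=
  (forall sigma, boundary (xi sigma)) /\
  forall eta, boundary eta ->
    exists! sigma, exists2 g, G g & act_end g (xi sigma) = eta.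

Definition stab_in (G : set 'M[L]_3) (xi : tree_end) : set 'M[L]_3 :=
  end_stabilizer xi `&` G.

Definition U_of (G : set 'M[L]_3) (z : option (L * L)) : set 'M[L]_3 :=
  conj_set (g_of conj z)^-1 (U_a conj) `&` G.

End Tree.

(* Main.v *)
Require Import Defs.
From HB Require Import structures.
From mathcomp Require Import all_boot all_order all_algebra all_field.
From mathcomp Require Import all_classical reals.
From mathcomp Require Import zify ring lra.

(* A nontrivial unipotent element g of SU(h) fixes a unique isotropic line,    *)
(* spanned by any nonzero x in the kernel and in the image of g - 1; the       *)
(* isotropic lines are the g_z^-1 e_(-1), so they correspond to the ends xi_z. *)
(* If g and g' belong to a unipotent group and fix different lines, these can  *)
(* be moved to the standard opposite pair, and then tr(g g') = 3 and           *)
(* tr(g g'^-1) = 3 are incompatible; hence a nontrivial unipotent group fixes  *)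
(* exactly one line.  The stabiliser of xi_infty in SU(h) is the Borel group,  *)
(* because U_x stabilises the norm on l^3 with weights (2x, 0, -2x): if g maps *)
(* the standard ray to an asymptotic one, then nu of the lower left entry of g *)
(* exceeds every bound.                                                        *)
(*   Two arithmetic facts remain.  The diagonal entry of an element of G_sigma *)
(* is a unit of B, and such a unit is constant: its norm has a divisor         *)
(* supported at P, and functions without poles are constant, since a maximal   *)
(* subring containing x but not 1/x is a discrete valuation ring with x in its *)
(* maximal ideal.  And every cusp has nontrivial unipotents in G, which        *)
(* follows from the existence of a function whose only pole is P.              *)

Set Implicit Arguments.
Unset Strict Implicit.
Unset Printing Implicit Defensive.

Import Order.TTheory GRing.Theory Num.Theory.
Local Open Scope classical_set_scope.
Local Open Scope card_scope.
Local Open Scope ring_scope.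

(** * Places of a function field *)

(** Ends of the tree are handled through matrices: by [xi_of_transport], which rests on
    [xi_infty_stabilizer], an element g carries the end of the cusp z to that of z' exactly when
    g_z' g g_z^-1 is upper triangular. The cusps parametrise the isotropic lines of h by
    [isotropic_in_cusp].

    A nontrivial unipotent element lies in the unipotent group of some cusp ([unipotent_in_cusp]),
    and since all elements of a unipotent group have trace 3, its nontrivial elements share their
    cusp ([same_cusp]). Once every cusp is known to have a nontrivial unipotent element in G, the
    maximal unipotent subgroups of G are the groups [U_of] of the cusps, distinct cusps give
    distinct groups, and conjugation by G follows the action on ends. This gives (2).

    For (1), the last diagonal entry of g_z g g_z^-1 is an eigenvalue of g, so for g in the
    stabiliser it is a unit of B, hence a constant by [integer_units_constant]. It is a character of
    the stabiliser whose kernel is the unipotent part. For (3), this character has values of finite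
    order when F is finite, so every element of the stabiliser is torsion; its order is then a power
    of p, and a field of characteristic p has no root of unity of p-power order except 1.

    The input on function fields comes from valuations alone. A maximal subring argument gives a
    zero of any nonconstant function ([exists_place_pos]), whence [no_pole_constant]. A function
    with P as its only pole ([pole_only_at]) is built by counting linear conditions; it yields
    infinitely many trace zero elements of l with prescribed denominators cleared
    ([infinitely_many_trace_zero]), and finite index turns these into nontrivial unipotents of G at
    each cusp. *)

Section PlaceTheory.
Variables (F K : fieldType) (j : {rmorphism F -> K}).
Implicit Types (P : place j) (x y : K) (n m : int).

(** A place has no meaningful value at 0; this encodes the convention that the order of 0 is
    infinite. *)
Definition vge P n x : Prop := x = 0 \/ n <= P x.

Definition pev x : {poly F} -> K := horner_eval x \o map_poly j.
HB.instance Definition _ x := GRing.RMorphism.on (pev x).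

Lemma pevE x (p : {poly F}) : pev x p = (map_poly j p).[x].
Proof. by []. Qed.

Lemma pevC x (a : F) : pev x a%:P = j a.
Proof. by rewrite pevE map_polyC hornerC. Qed.

Lemma pevX x : pev x 'X = x.
Proof. by rewrite pevE map_polyX hornerX. Qed.

Lemma pev_transcendental x (p : {poly F}) :
  ~ algebraicOver j x -> p != 0 -> pev x p != 0.
Proof. by move=> tx p0; apply/eqP => px; apply: tx; exists p => //; apply/rootP. Qed.

Lemma ord1 P : P 1 = 0.
Proof. by rewrite -(rmorph1 j) ord_const ?oner_eq0. Qed.

Lemma ordN P x : P (- x) = P x.
Proof.
have [->|x0] := eqVneq x 0; first by rewrite oppr0.
rewrite -mulN1r -(rmorph1 j) -rmorphN ordM ?fmorph_eq0 ?oppr_eq0 ?oner_eq0 //.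
by rewrite ord_const ?oppr_eq0 ?oner_eq0 // add0r.
Qed.

Lemma ordX P x k : x != 0 -> P (x ^+ k) = P x *+ k.
Proof.
move=> x0; elim: k => [|k IH]; first by rewrite expr0 mulr0n ord1.
by rewrite exprS ordM ?expf_neq0 // IH mulrS.
Qed.

Lemma ordV P x : x != 0 -> P x^-1 = - P x.
Proof.
move=> x0; apply/eqP; rewrite -addr_eq0 -ordM ?invr_eq0 //.
by rewrite mulVf // ord1.
Qed.

Lemma vge0 P n : vge P n 0. Proof. by left. Qed.

Lemma vge_neq0 P n x : vge P n x -> x != 0 -> n <= P x.
Proof. by case=> [->|//]; rewrite eqxx. Qed.

Lemma vgeW P n m x : m <= n -> vge P n x -> vge P m x.
Proof. by move=> mn [->|h]; [left|right; exact: le_trans h]. Qed.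

Lemma vgeD P n x y : vge P n x -> vge P n y -> vge P n (x + y).
Proof.
move=> [->|hx]; first by rewrite add0r.
move=> [->|hy]; first by rewrite addr0; right.
have [->|x0] := eqVneq x 0; first by rewrite add0r; right.
have [->|y0] := eqVneq y 0; first by rewrite addr0; right.
have [xy0|xy0] := eqVneq (x + y) 0; first by left.
right; apply: le_trans (ordD P x0 y0 xy0).
by rewrite le_min hx.
Qed.

Lemma vgeN P n x : vge P n x -> vge P n (- x).
Proof. by move=> [->|h]; [left; rewrite oppr0|right; rewrite ordN]. Qed.

Lemma vgeB P n x y : vge P n x -> vge P n y -> vge P n (x - y).
Proof. by move=> hx hy; apply: vgeD => //; exact: vgeN. Qed.

Lemma vgeM P n m x y : vge P n x -> vge P m y -> vge P (n + m) (x * y).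
Proof.
move=> [->|hx]; first by rewrite mul0r; left.
move=> [->|hy]; first by rewrite mulr0; left.
have [->|x0] := eqVneq x 0; first by rewrite mul0r; left.
have [->|y0] := eqVneq y 0; first by rewrite mulr0; left.
by right; rewrite ordM // lerD.
Qed.

Lemma vge0M P x y : vge P 0 x -> vge P 0 y -> vge P 0 (x * y).
Proof. by move=> hx hy; rewrite -[0]addr0; exact: vgeM. Qed.

Lemma vge01 P : vge P 0 1. Proof. by right; rewrite ord1. Qed.

Lemma vge0X P x k : vge P 0 x -> vge P 0 (x ^+ k).
Proof.
move=> hx; elim: k => [|k IH]; first by rewrite expr0; exact: vge01.
by rewrite exprS; exact: vge0M.
Qed.

Lemma vge_sum P n (I : Type) (r : seq I) (p : pred I) (f : I -> K) :
  (forall i, p i -> vge P n (f i)) -> vge P n (\sum_(i <- r | p i) f i).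
Proof.
move=> h; elim/big_ind: _ => //; first exact: vge0.
by move=> x y; exact: vgeD.
Qed.

Lemma vge_const P (a : F) : vge P 0 (j a).
Proof.
have [->|a0] := eqVneq a 0; first by rewrite rmorph0; left.
by right; rewrite ord_const.
Qed.

Lemma vge_pev P x (p : {poly F}) : vge P 0 x -> vge P 0 (pev x p).
Proof.
move=> hx; rewrite pevE horner_coef; apply: vge_sum => i _.
by rewrite coef_map; apply: vge0M; [exact: vge_const|exact: vge0X].
Qed.

(** If x + y had larger order than x, then x = (x + y) - y would be a sum of two terms of order
    larger than its own. *)
Lemma ord_dominant P x y : x != 0 -> vge P (P x + 1) y ->
  x + y != 0 /\ P (x + y) = P x.
Proof.
move=> x0 [->|hy]; first by rewrite addr0.
have [->|y0] := eqVneq y 0; first by rewrite addr0.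
have lt_xy : P x < P y by rewrite -lezD1.
have xy0 : x + y != 0.
  apply: contraTneq lt_xy => /eqP; rewrite addr_eq0 => /eqP ->.
  by rewrite ordN ltxx.
split=> //; apply/eqP; rewrite eq_le; apply/andP; split; last first.
  by apply: le_trans (ordD P x0 y0 xy0); rewrite le_min lexx ltW.
rewrite leNgt; apply/negP => lt_x.
have := @ordD _ _ _ P (x + y) (- y) xy0; rewrite oppr_eq0 y0 addrK x0 => /(_ isT isT).
rewrite ordN ge_min; case/orP; first by rewrite leNgt lt_x.
by rewrite leNgt lt_xy.
Qed.

(* If ord x < 0, the leading term would strictly dominate all others.         *)
Lemma place_integral P (p : {poly K}) x :
  P (lead_coef p) = 0 -> p != 0 -> (forall i, vge P 0 p`_i) -> root p x ->
  vge P 0 x.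
Proof.
move=> lp p0 hp /rootP px; have [->|x0] := eqVneq x 0; first exact: vge0.
right; rewrite leNgt; apply/negP => Px.
move: px; rewrite horner_coef.
have sp : size p = (size p).-1.+1 by rewrite prednK // size_poly_gt0.
rewrite sp big_ord_recr /= -/(lead_coef p) addrC => px.
set n := (size p).-1 in px sp.
have lp0 : lead_coef p != 0 by rewrite lead_coef_eq0.
have xn0 : lead_coef p * x ^+ n != 0 by rewrite mulf_neq0 ?expf_neq0.
have [] := @ord_dominant P _ (\sum_(i < n) p`_i * x ^+ i) xn0.
  apply: vge_sum => i _; rewrite ordM ?expf_neq0 // lp add0r ordX //.
  apply: (@vgeW _ (0 + P x *+ i)).
    rewrite add0r; have lin := ltn_ord i.
    have -> : P x *+ n = P x *+ i + P x *+ (n - i.+1).+1.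
      by rewrite -mulrnDr; congr (_ *+ _); lia.
    by rewrite mulrSr; have := mulrn_wle0 (n - i.+1) (ltW Px); lia.
  by apply: vgeM; [exact: hp|right; rewrite ordX].
by rewrite px eqxx.
Qed.
End PlaceTheory.

(** * Finite rank of a function field over F(x) *)

Lemma linear_dependence (F : fieldType) (I J : finType) (M : I -> J -> F) :
  (#|J| < #|I|)%N ->
  exists a : I -> F, (exists i, a i != 0) /\ forall l, \sum_i a i * M i l = 0.
Proof.
move=> ltJI.
pose A : 'M[F]_(#|I|, #|J|) := \matrix_(i, l) M (enum_val i) (enum_val l).
have : kermx A != 0.
  rewrite kermx_eq0 /row_free neq_ltn (leq_ltn_trans _ ltJI) //.
  exact: rank_leq_col.
case/rowV0Pn => v /sub_kermxP vA v0.
exists (fun i => v 0 (enum_rank i)); split.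
  apply: contrapT => h; move/eqP: v0; apply; apply/rowP => i; rewrite mxE.
  apply: contrapT => vi; apply: h; exists (enum_val i).
  by rewrite enum_valK; apply/eqP.
move=> l; have := congr1 (fun m : 'M_(_, _) => m 0 (enum_rank l)) vA.
rewrite !mxE => {2}<-; rewrite (reindex_onto (@enum_val I predT) enum_rank) /=; last first.
  by move=> i _; rewrite enum_rankK.
rewrite (eq_bigl predT) => [|i]; last by rewrite enum_valK eqxx.
by apply: eq_bigr => i _; rewrite mxE enum_valK enum_rankK.
Qed.

Section Dependence.
Variables (F K : fieldType) (j : {rmorphism F -> K}).

(** For transcendental x this bounds the degree of K over F(x) below d. Denominators are cleared, so
    that the coefficients are polynomials and no field F(x) has to be formed. *)
Definition dependent_over (x : K) (d : nat) : Prop :=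
  forall w : nat -> K, exists c : nat -> {poly F},
    (exists2 i, (i < d)%N & c i != 0) /\ \sum_(i < d) pev j x (c i) * w i = 0.

Section Count.
Variables (t : K) (s : seq K).
Hypothesis t_tr : ~ algebraicOver j t.
Hypothesis gen_s : forall x : K,
  exists (q : {poly F}) (c : 'I_(size s) -> {poly F}),
    q != 0 /\ (map_poly j q).[t] * x = \sum_i (map_poly j (c i)).[t] * s`_i.

Let N := size s.

(** The F-span of the t^i s_l with i < b, of dimension at most N b; counting in these spaces
    replaces degrees of extensions. *)
Let bounded (b : nat) (v : K) : Prop :=
  exists2 p : 'I_N -> {poly F}, (forall l, (size (p l) <= b)%N) &
    v = \sum_l pev j t (p l) * s`_l.

Lemma common_denominator (n : nat) (v : nat -> K) :
  exists2 q : {poly F}, q != 0 &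
    exists b, forall i, (i < n)%N -> bounded b (pev j t q * v i).
Proof.
elim: n => [|n [q q0 [b hb]]]; first by exists 1; [exact: oner_neq0|exists 0%N].
have [r [c [r0 hc]]] := gen_s (v n).
exists (q * r); first by rewrite mulf_neq0.
exists (maxn (b + size r) (\max_l size (c l) + size q)) => i.
rewrite ltnS leq_eqVlt => /orP[/eqP ->|/hb[p hp e]].
  exists (fun l => q * c l) => [l|].
    apply: leq_trans (size_polyMleq _ _) _; rewrite leq_max; apply/orP; right.
    rewrite addnC; apply: leq_trans (leq_pred _) _; rewrite leq_add2r.
    by rewrite (leq_bigmax_cond (F := fun l => size (c l))).
  rewrite rmorphM -mulrA -!pevE in hc *; rewrite hc mulr_sumr.
  by apply: eq_bigr => l _; rewrite rmorphM mulrA.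
exists (fun l => r * p l) => [l|].
  apply: leq_trans (size_polyMleq _ _) _; rewrite leq_max; apply/orP; left.
  rewrite addnC; apply: leq_trans (leq_pred _) _; rewrite leq_add2r.
  exact: hp.
have -> : pev j t (q * r) * v i = pev j t r * (pev j t q * v i).
  by rewrite rmorphM /=; ring.
rewrite e mulr_sumr.
by apply: eq_bigr => l _; rewrite rmorphM mulrA.
Qed.

Lemma bounded_sum b (I : Type) (r : seq I) (p : pred I) (f : I -> K) :
  (forall i, p i -> bounded b (f i)) -> bounded b (\sum_(i <- r | p i) f i).
Proof.
move=> h; elim/big_ind: _ => //.
  exists (fun=> 0) => [l|]; first by rewrite size_poly0.
  by rewrite big1 // => l _; rewrite rmorph0 mul0r.
move=> _ _ [p1 h1 ->] [p2 h2 ->]; exists (fun l => p1 l + p2 l) => [l|].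
  by rewrite (leq_trans (size_polyD _ _)) // geq_max h1 h2.
by rewrite -big_split; apply: eq_bigr => l _; rewrite rmorphD mulrDl.
Qed.

Lemma boundedM a b (q : {poly F}) v :
  (size q <= a)%N -> bounded b v -> bounded (a + b) (pev j t q * v).
Proof.
move=> sq [p hp ->]; exists (fun l => q * p l) => [l|].
  by rewrite (leq_trans (size_polyMleq _ _)) // (leq_trans (leq_pred _)) // leq_add.
by rewrite mulr_sumr; apply: eq_bigr => l _; rewrite rmorphM mulrA.
Qed.

(* After clearing denominators, the products x^i w_l (i <= m, l < d) lie in an *)
(* F-space of dimension N (alpha m + beta), which is less than d (m + 1) for  *)
(* large m as soon as d > N alpha.                                             *)
Lemma finite_rank (x : K) : exists d, dependent_over x d.
Proof.
have [Q Q0 [a0 ha0]] := common_denominator N (fun l => x * s`_l).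
pose a := maxn a0 (size Q).
(* Q clears the denominators of the x s_l, so multiplication by Q x raises the degree bound by a.
   Multiplication by Q alone does so too, which serves to bring all x^i with i <= m to the common
   factor Q^m. *)
have mulx b v : bounded b v -> bounded (a + b) (pev j t Q * x * v).
  move=> [p hp ->]; rewrite mulr_sumr; apply: bounded_sum => l _.
  have -> : pev j t Q * x * (pev j t (p l) * s`_l) =
            pev j t (p l) * (pev j t Q * (x * s`_l)) by ring.
  rewrite addnC; apply: boundedM => //.
  have [p' hp' ->] := ha0 _ (ltn_ord l); exists p' => // l'.
  by rewrite (leq_trans (hp' _)) // leq_maxl.
have mulQ b v : bounded b v -> bounded (a + b) (pev j t Q * v).
  by apply: boundedM; rewrite leq_maxr.
exists (N * a).+1 => w; pose d := (N * a).+1.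
have [R R0 [b hb]] := common_denominator d w.
(* For this m the (N a + 1)(m + 1) products exceed the N (m a + b) coordinates by N a + 1. *)
pose m := (N * b)%N; pose D := pev j t (Q ^+ m * R).
have D0 : D != 0 by apply: pev_transcendental; rewrite // mulf_neq0 ?expf_neq0.
have bnd (il : 'I_m.+1 * 'I_d) : bounded (m * a + b) (D * (x ^+ il.1 * w il.2)).
  case: il => i l /=; have {}hb := hb _ (ltn_ord l).
  have h1 n : bounded (n * a + b)
      ((pev j t Q * x) ^+ n * (pev j t R * w l)).
    elim: n => [|n IH]; first by rewrite expr0 mul1r.
    by rewrite exprS -mulrA mulSn -addnA; exact: mulx.
  have h2 n n' : bounded (n' * a + (n * a + b)) (pev j t Q ^+ n' *
      ((pev j t Q * x) ^+ n * (pev j t R * w l))).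
    elim: n' => [|n' IH]; first by rewrite expr0 mul1r; exact: h1.
    by rewrite exprS -mulrA mulSn -addnA; exact: mulQ.
  have := h2 i (m - i)%N; rewrite addnA -mulnDl subnK; last by rewrite -ltnS.
  have lim : (i <= m)%N by rewrite -ltnS.
  have eQ : pev j t Q ^+ m = pev j t Q ^+ (m - i) * pev j t Q ^+ i.
    by rewrite -exprD subnK.
  by congr bounded; rewrite /D rmorphM rmorphXn /= eQ exprMn; ring.
have /choice[p hp] : forall il : 'I_m.+1 * 'I_d, exists p : 'I_N -> {poly F},
    (forall l, (size (p l) <= m * a + b)%N) /\
    D * (x ^+ il.1 * w il.2) = \sum_l pev j t (p l) * s`_l.
  by move=> il; have [p h1 h2] := bnd il; exists p.
have [|c [[[i0 l0] c0] hc]] := @linear_dependence F _ _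
    (fun (il : 'I_m.+1 * 'I_d) (lk : 'I_N * 'I_(m * a + b)) => (p il lk.1)`_lk.2).
  by rewrite !card_prod !card_ord /d /m; nia.
pose f (l : nat) : {poly F} :=
  if insub l is Some l' then \poly_(i < m.+1) (if insub i is Some i' then c (i', l') else 0) else 0.
have fE (l : 'I_d) : f l = \sum_(i < m.+1) c (i, l) *: 'X^i.
  by rewrite /f valK poly_def; apply: eq_bigr => i _; rewrite valK.
exists f; split.
  exists (val l0); first exact: ltn_ord.
  apply/eqP => f0.
  have := congr1 (fun q : {poly F} => q`_i0) f0.
  rewrite /f valK coef_poly ltn_ord valK coef0 => /eqP.
  by apply/negP.
apply: (mulfI D0); rewrite mulr0 mulr_sumr.
transitivity (\sum_(l < d) \sum_(i < m.+1) j (c (i, l)) * (D * (x ^+ i * w l))).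
  apply: eq_bigr => l _; rewrite fE rmorph_sum mulr_suml mulr_sumr.
  apply: eq_bigr => i _.
  by rewrite -mul_polyC rmorphM rmorphXn /= pevC pevX; ring.
rewrite exchange_big pair_big /=.
under eq_bigr => il _ do rewrite (hp (il.1, il.2)).2 mulr_sumr.
rewrite exchange_big big1 // => l _.
transitivity (pev j t (\sum_il c il *: p il l) * s`_l).
  rewrite rmorph_sum mulr_suml; apply: eq_bigr => -[i l'] _.
  by rewrite -mul_polyC rmorphM /= pevC mulrA.
have -> : \sum_il c il *: p il l = 0.
  apply/polyP => k; rewrite coef_sum coef0.
  have [lt_k|ge_k] := ltnP k (m * a + b).
    rewrite -[RHS](hc (l, Ordinal lt_k)); apply: eq_bigr => il _.
    by rewrite coefZ.
  rewrite big1 // => il _; rewrite coefZ nth_default ?mulr0 //.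
  by rewrite (leq_trans _ ge_k) // (hp il).1.
by rewrite rmorph0 mul0r.
Qed.
End Count.

(** If all coefficients vanish at 0, the relation can be divided by x, which lowers the maximal size
    of the coefficients. *)
Lemma dependent_normalized x d : x != 0 -> dependent_over x d ->
  forall w : nat -> K, exists c : nat -> {poly F},
    (exists2 i, (i < d)%N & (c i).[0] != 0) /\
    \sum_(i < d) pev j x (c i) * w i = 0.
Proof.
move=> x0 dep w; have [c [cn0 ce]] := dep w.
have [n] := ubnP (\max_(i < d) size (c i)); elim: n c cn0 ce => // n IH c.
move=> [i0 i0d c0] ce; rewrite ltnS => hn.
have sc i : (i < d)%N -> (size (c i) <= n)%N.
  by move=> id; apply: leq_trans hn; apply: (leq_bigmax_cond (Ordinal id)).
have [h|h] := pselect (exists2 i, (i < d)%N & (c i).[0] != 0).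
  by exists c.
have cX i : (i < d)%N -> c i = drop_poly 1 (c i) * 'X.
  move=> id; rewrite -{1}[c i](poly_take_drop 1) expr1; apply/eqP.
  rewrite -subr_eq0 addrK; apply/eqP/polyP => k; rewrite coef_take_poly coef0.
  case: k => //=; rewrite -horner_coef0; apply/eqP/negPn/negP => ?.
  by apply: h; exists i.
apply: (IH (fun i => drop_poly 1 (c i))).
- exists i0 => //; move: c0; rewrite {1}cX //; apply: contraNneq => ->.
  by rewrite mul0r.
- apply: (mulfI x0); rewrite mulr0 -[RHS]ce mulr_sumr.
  apply: eq_bigr => i _; rewrite {2}cX ?ltn_ord // rmorphM /= pevX; ring.
- have n0 : (0 < n)%N.
    by apply: leq_trans (sc _ i0d); rewrite size_poly_gt0.
  apply: (@leq_ltn_trans n.-1); last by rewrite prednK.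
  apply/bigmax_leqP => i _; rewrite size_drop_poly subn1.
  by rewrite -!subn1 leq_sub2r // sc.
Qed.
End Dependence.

(** * Existence of a zero of a transcendental function *)

Section PlaceExistence.
Variables (F K : fieldType) (j : {rmorphism F -> K}) (x : K).
Hypothesis x_tr : ~ algebraicOver j x.

Let subring_with (V : set K) : Prop :=
  [/\ forall a, V (j a), V x, forall a b, V a -> V b -> V (a - b) &
      forall a b, V a -> V b -> V (a * b)].

Let good (V : set K) : Prop := subring_with V /\ ~ V x^-1.

Let x_neq0 : x != 0.
Proof. by apply/eqP => x0; apply: x_tr; rewrite x0; exact: algebraic0. Qed.

Lemma maximal_subring_without_inverse :
  exists V, good V /\ forall W, good W -> V `<=` W -> W `<=` V.
Proof.
have [|A [PA maxA]] := @Zorn_bigcup K (fun V => V = set0 \/ good V).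
  move=> C CP Ctot.
  have [[V0 [CV0 gV0]]|none] := pselect (exists V, C V /\ good V); last first.
    left; apply/seteqP; split => // y [V CV Vy]; case: (CP V CV) => [V0|gV].
      by rewrite V0 in Vy.
    by exfalso; apply: none; exists V.
  have gd V y : C V -> V y -> good V.
    by move=> CV Vy; case: (CP V CV) => // V0'; rewrite V0' in Vy.
  have pair a b : (\bigcup_(X in C) X) a -> (\bigcup_(X in C) X) b ->
      exists V, [/\ C V, good V, V a & V b].
    move=> [V CV Va] [W CW Wb]; case: (Ctot V W CV CW) => h.
      by exists W; split => //; [exact: gd Wb|exact: h].
    by exists V; split => //; [exact: gd Va|exact: h].
  right; split; last by move=> [V CV Vx]; case: (gd _ _ CV Vx).
  have [[h1 h2 _ _] _] := gV0.
  split; [by move=> a; exists V0|by exists V0| |].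
    by move=> a b Ua Ub; have [V [CV [[_ _ hB _] _] Va Vb]] := pair a b Ua Ub; exists V => //; exact: hB.
  by move=> a b Ua Ub; have [V [CV [[_ _ _ hM] _] Va Vb]] := pair a b Ua Ub; exists V => //; exact: hM.
exists A; have gA : good A.
  case: PA => // A0; exfalso.
  apply: (maxA [set y | exists p, y = pev j x p]).
    split; first by rewrite A0.
    by move=> /(_ x); rewrite A0; apply; exists 'X; rewrite pevX.
  right; split; [split|].
  - by move=> a; exists a%:P; rewrite pevC.
  - by exists 'X; rewrite pevX.
  - by move=> a b [p ->] [q ->]; exists (p - q); rewrite rmorphB.
  - by move=> a b [p ->] [q ->]; exists (p * q); rewrite rmorphM.
  case=> p /(congr1 ( *%R x)); rewrite mulfV // => /eqP.
  rewrite -{1}(pevX j x) -rmorphM -(rmorph1 (pev j x)) -subr_eq0 -rmorphB.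
  apply/negP/pev_transcendental => //; apply/eqP => /(congr1 (coefp 0)) /=.
  rewrite coefB coefXM coef1 coef0 subr0 => /eqP.
  by rewrite oner_eq0.
split=> // W gW AW y Wy; apply: contrapT => Ay.
by apply: (maxA W); [split=> // /(_ y Wy)|right].
Qed.

Section ValuationRing.
Variable V : set K.
Hypothesis V_good : good V.
Hypothesis V_max : forall W, good W -> V `<=` W -> W `<=` V.

Let Vj a : V (j a). Proof. by have [[]] := V_good. Qed.
Let Vx : V x. Proof. by have [[]] := V_good. Qed.
Let VB a b : V a -> V b -> V (a - b). Proof. by have [[_ _ h _] _] := V_good; auto. Qed.
Let VM a b : V a -> V b -> V (a * b). Proof. by have [[_ _ _ h] _] := V_good; auto. Qed.
Let Vxi : ~ V x^-1. Proof. by have [] := V_good. Qed.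
Let V0 : V 0. Proof. by rewrite -(rmorph0 j). Qed.
Let V1 : V 1. Proof. by rewrite -(rmorph1 j). Qed.
Let VN a : V a -> V (- a). Proof. by rewrite -sub0r; exact: VB. Qed.
Let VD a b : V a -> V b -> V (a + b).
Proof. by move=> Va Vb; rewrite -(opprK b); apply: VB => //; exact: VN. Qed.
Let VX a n : V a -> V (a ^+ n).
Proof. by move=> Va; elim: n => [|n IH]; rewrite ?expr0 // exprS; exact: VM. Qed.
Let Vsum (I : Type) (r : seq I) (p : pred I) (f : I -> K) :
  (forall i, p i -> V (f i)) -> V (\sum_(i <- r | p i) f i).
Proof. by move=> h; elim/big_ind: _. Qed.

(** If V[u] did not contain 1/x, maximality would force u into V. *)
Let adjoin_inverse u :
  V u \/ exists2 p : {poly K}, (forall i, V p`_i) & p.[u] = x^-1.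
Proof.
have [|nVu] := pselect (V u); first by left.
right; apply: contrapT => np.
pose W := [set y | exists2 p : {poly K}, (forall i, V p`_i) & p.[u] = y].
have VW : V `<=` W.
  move=> a Va; exists a%:P => [i|]; last by rewrite hornerC.
  by rewrite coefC; case: ifP.
suff gW : good W.
  apply: nVu; apply: (V_max gW VW); exists 'X => [i|]; last by rewrite hornerX.
  by rewrite coefX; case: eqP.
split=> //; split.
- by move=> a; apply: VW.
- exact: VW.
- move=> _ _ [p hp <-] [q hq <-]; exists (p - q); last by rewrite hornerD hornerN.
  by move=> i; rewrite coefB; exact: VB.
- move=> _ _ [p hp <-] [q hq <-]; exists (p * q); last by rewrite hornerM.
  by move=> i; rewrite coefM; apply: Vsum => k _; exact: VM.
Qed.

(** Put y = 1 - x b. If 1/y is not in V, then 1/x is a polynomial in 1/y over V, so y^n / x is in V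
    for large n; as y^n is 1 modulo x V, this puts 1/x in V. *)
Let unit_1xb b : V b -> 1 - x * b != 0 /\ V (1 - x * b)^-1.
Proof.
move=> Vb; have ne : 1 - x * b != 0.
  apply/eqP => /eqP; rewrite subr_eq0 => /eqP e; apply: Vxi.
  by rewrite -[x^-1]mulr1 e mulKf.
split=> //; have [//|[p hp]] := adjoin_inverse (1 - x * b)^-1.
set y := 1 - x * b in ne *; rewrite horner_coef => e; exfalso; apply: Vxi.
have pow n : exists2 c, V c & y ^+ n = 1 + x * c.
  elim: n => [|n [c Vc IH]]; first by exists 0; rewrite // expr0 mulr0 addr0.
  exists (c - b - b * (x * c)); last by rewrite exprS IH /y; ring.
  by repeat (apply: VB || apply: VM).
have [c Vc yn] := pow (size p).
have -> : x^-1 = x^-1 * y ^+ size p - c by rewrite yn; field.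
apply: VB => //; rewrite -e mulr_suml; apply: Vsum => i _.
rewrite -mulrA; apply: VM => //.
have -> : y ^+ size p = y ^+ (size p - i) * y ^+ i.
  by rewrite -exprD subnK // ltnW.
rewrite exprVn mulrCA mulVf ?expf_neq0 // mulr1.
apply: VX; apply: VB => //; exact: VM.
Qed.

Let dichotomy u : u != 0 -> V u \/ V u^-1.
Proof.
move=> u0; have [|[p hp pu]] := adjoin_inverse u; first by left.
have [|[q hq qu]] := adjoin_inverse u^-1; first by right.
exfalso.
have [n] := ubnP (size p + size q)%N.
elim: n u u0 p hp pu q hq qu => // n IH u u0 p hp pu q hq qu; rewrite ltnS => hn.
wlog le_qp : u u0 p hp pu q hq qu hn / (size q <= size p)%N.
  move=> W; case: (leqP (size q) (size p)) => [|/ltnW]; first exact: (W u u0 p hp pu q hq qu hn).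
  by apply: (W u^-1 _ q hq qu p hp); rewrite ?invr_eq0 // ?invrK // addnC.
have [ne Vinv] := unit_1xb (hq 0%N).
set e := (1 - x * q`_0)^-1 in Vinv.
have p0 : p != 0.
  by apply: contra_notN Vxi => /eqP p0; rewrite -pu p0 horner0.
pose m := (size p).-1; have sp : size p = m.+1 by rewrite prednK // size_poly_gt0.
(* The expression q for 1/x gives 1 = e x (1/x - q_0), which is e x times the sum of the q_i u^-i
   with i > 0. Multiplied by p_m u^m it replaces the leading term of p by terms of lower degree, and
   the total size decreases. *)
pose r := \poly_(i < m) (p`_i + p`_m * (e * x * q`_(m - i))).
have Vr i : V r`_i.
  rewrite coef_poly; case: ifP => // _; apply: VD => //.
  by repeat apply: VM => //.
have sum_q : \sum_(i < m) q`_(m - i) * u ^+ i = u ^+ m * (q.[u^-1] - q`_0).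
  have -> : q.[u^-1] = \sum_(i < m.+1) q`_i * u^-1 ^+ i.
    by apply: horner_coef_wide; rewrite -sp.
  rewrite big_ord_recl expr0 mulr1 addrC addKr mulr_sumr (reindex_inj rev_ord_inj) /=.
  apply: eq_bigr => i _; rewrite subKn // mulrCA; congr (_ * _).
  have -> : u ^+ m = u ^+ (m - i.+1) * u ^+ i.+1 by rewrite -exprD subnK.
  by rewrite exprVn /bump /= add1n mulfK ?expf_neq0.
have ru : r.[u] = x^-1.
  rewrite horner_poly; under eq_bigr do rewrite mulrDl -!mulrA.
  rewrite big_split -mulr_sumr -mulr_sumr -mulr_sumr /= sum_q qu.
  rewrite -[RHS]pu horner_coef sp big_ord_recr /=; congr (_ + _).
  have ex : e * (x * (x^-1 - q`_0)) = 1 by rewrite mulrBr mulfV // mulVf.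
  by rewrite -[RHS]mulr1 -ex; ring.
apply: (IH u u0 r Vr ru q hq qu).
apply: leq_trans hn; rewrite sp addSn ltnS leq_add2r.
exact: size_poly.
Qed.


(** The maximal ideal of V, described as the non-units; membership in V itself comes from
    [dichotomy]. *)
Let idl b : Prop := b = 0 \/ ~ V b^-1.

Let idlV b : idl b -> V b.
Proof.
move=> [->//|nV]; have [->//|b0] := eqVneq b 0.
by case: (dichotomy b0).
Qed.

Let idlM a b : idl a -> V b -> idl (a * b).
Proof.
move=> [->|na] Vb; first by left; rewrite mul0r.
have [->|b0] := eqVneq b 0; first by left; rewrite mulr0.
by right=> Vab; apply: na; rewrite -(mulfK b0 a) invfM invrK mulrC; exact: VM.
Qed.

Let idlD a b : idl a -> idl b -> idl (a + b).
Proof.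
move=> ia ib; have [->|a0] := eqVneq a 0; first by rewrite add0r.
have [->|b0] := eqVneq b 0; first by rewrite addr0.
have ab0 : a / b != 0 by rewrite mulf_neq0 ?invr_eq0.
have [Vab|] := dichotomy ab0.
  have -> : a + b = b * (1 + a / b) by field.
  by apply: idlM => //; exact: VD.
rewrite invf_div => Vba; have -> : a + b = a * (1 + b / a) by field.
by apply: idlM => //; exact: VD.
Qed.

Let idlN a : idl a -> idl (- a).
Proof. by move=> ia; rewrite -mulrN1; apply: idlM => //; exact: VN. Qed.

Let idlx : idl x. Proof. by right. Qed.

Let Vpev (c : {poly F}) : V (pev j x c).
Proof.
rewrite pevE horner_coef; apply: Vsum => i _; rewrite coef_map.
exact: VM (Vj _) (VX _ Vx).
Qed.

Let pev_split (c : {poly F}) :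
  exists2 b, V b & pev j x c = j c.[0] + x * b.
Proof.
exists (pev j x (drop_poly 1 c)); first exact: Vpev.
rewrite -{1}[c](poly_take_drop 1) rmorphD rmorphM rmorphXn /= pevX expr1.
rewrite [x * _]mulrC; congr (_ + _).
rewrite -(pevC j x); congr (pev _ _ _); apply/polyP => -[|k]; rewrite coef_take_poly coefC //=.
by rewrite horner_coef0.
Qed.

(** Modulo x, which lies in the maximal ideal, c(x) is the nonzero constant c(0). *)
Let pev_unit (c : {poly F}) : c.[0] != 0 -> ~ idl (pev j x c).
Proof.
move=> c0; have [b Vb ->] := pev_split c.
have j0 : j c.[0] != 0 by rewrite fmorph_eq0.
have -> : j c.[0] + x * b = j c.[0] * (1 - x * (- b / j c.[0])) by field.
have Vb' : V (- b / j c.[0]) by rewrite -fmorphV; apply: VM => //; exact: VN.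
have [ne Vi] := unit_1xb Vb'.
case=> [/eqP|]; first by rewrite mulf_eq0 (negPf j0) (negPf ne).
by apply; rewrite invfM; apply: VM => //; rewrite -fmorphV.
Qed.

Variable d : nat.
Hypothesis dep : dependent_over j x d.

(* Elements of pairwise distinct values below the value of x are linearly     *)
(* independent over F(x).                                                      *)
Let chain_bound (w : nat -> K) :
  (forall i, (i < d)%N -> [/\ w i != 0, V (w i) & idl (x / w i)]) ->
  (forall i i', (i < i' < d)%N -> idl (w i' / w i)) -> False.
Proof.
move=> hw hlt; have [c [[i1 i1d c1] cw]] := dependent_normalized x_neq0 dep w.
have ex : exists i, (i < d)%N && ((c i).[0] != 0) by exists i1; rewrite i1d.
(* Divide the relation by w_i0, where i0 is the first index with c_i(0) nonzero. Earlier terms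
   contain x / w_i0 and later ones w_i / w_i0, all in the maximal ideal, while c_i0(x) is a unit. *)
case: (ex_minnP ex) => i0 /andP[i0d c0] min_i0.
have [w0 _ idl0] := hw _ i0d.
apply: (pev_unit c0).
have -> : pev j x (c i0) =
    - \sum_(i < d | i != Ordinal i0d) pev j x (c i) * (w i / w i0).
  apply: (mulIf w0); rewrite mulNr mulr_suml; apply/eqP; rewrite -addr_eq0.
  apply/eqP; rewrite -[RHS]cw [RHS](bigD1 (Ordinal i0d)) //=; congr (_ + _).
  by apply: eq_bigr => i _; rewrite mulrA mulfVK.
apply: idlN; elim/big_ind: _ => [|a b|i ne]; [by left|exact: idlD|].
have [lt_i|gt_i|e] := ltngtP i i0.
- have [w1 Vw1 _] := hw _ (ltn_ord i).
  have ci0 : (c i).[0] = 0.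
    by apply: contraTeq lt_i => ci; rewrite -leqNgt min_i0 // ltn_ord.
  have [b Vb ->] := pev_split (c i); rewrite ci0 rmorph0 add0r.
  have -> : x * b * (w i / w i0) = x / w i0 * (b * w i) by ring.
  by apply: idlM => //; exact: VM.
- by rewrite mulrC; apply: idlM => //; apply: hlt; rewrite gt_i ltn_ord.
- by case/eqP: ne; apply: val_inj.
Qed.

(** Otherwise each element of the maximal ideal has another one of strictly smaller value. Iterating
    from x and reading the sequence backwards contradicts [chain_bound]. *)
Let uniformizer : exists p, [/\ p != 0, idl p & forall b, idl b -> V (b / p)].
Proof.
apply: contrapT => none.
have /choice[f hf] : forall p, exists b, p != 0 -> idl p -> idl b /\ ~ V (b / p).
  move=> p; have [p0|p0] := eqVneq p 0; first by exists 0.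
  have [ip|] := pselect (idl p); last by exists 0.
  apply: contrapT => nb; apply: none; exists p; split=> // b ib.
  by apply: contrapT => nV; apply: nb; exists b.
pose w n := iter n f x.
have wP n : w n != 0 /\ idl (w n).
  elim: n => [//|n [n0 ni]]; have [h1 h2] := hf _ n0 ni; split=> //=.
  by apply/eqP => e; apply: h2; rewrite e mul0r.
have wS n : idl (w n / w n.+1).
  have [n0 ni] := wP n; have [_ h] := hf _ n0 ni.
  by right; rewrite invf_div.
have wlt n m : (n < m)%N -> idl (w n / w m).
  elim: m => // m IH; rewrite ltnS leq_eqVlt => /orP[/eqP ->//|/IH h].
  have [m0 _] := wP m; have [m1 _] := wP m.+1.
  have -> : w n / w m.+1 = w n / w m * (w m / w m.+1) by field; rewrite m0 m1.
  by apply: idlM => //; exact: idlV.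
apply: (@chain_bound (fun i => w (d - i)%N)).
  move=> i id; have [h1 h2] := wP (d - i)%N; split => //; first exact: idlV.
  by rewrite -[x]/(w 0%N); apply: wlt; rewrite subn_gt0.
by move=> i i' h; apply: wlt; lia.
Qed.

Let infinitely_divisible p b : Prop := forall n, V (b / p ^+ n).

(** Elements divisible by all powers of p form a prime ideal. It does not contain x, by
    [chain_bound], hence no nonzero element of F[x]. A relation for b over F[x], divided by its
    lowest power of b, would make a nonzero element of F[x] a multiple of b. *)
Let not_infinitely_divisible p b :
  p != 0 -> idl p -> b != 0 -> ~ infinitely_divisible p b.
Proof.
move=> p0 ip b0 hb.
have prime_I a c : ~ infinitely_divisible p a -> ~ infinitely_divisible p c ->
    ~ infinitely_divisible p (a * c).
  move=> /existsNP[n na] /existsNP[m mc] /(_ (n + m)%N) h.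
  have a0 : a != 0 by apply: contra_notN na => /eqP ->; rewrite mul0r.
  have c0 : c != 0 by apply: contra_notN mc => /eqP ->; rewrite mul0r.
  have : idl (p ^+ n / a * (p ^+ m / c)).
    apply: idlM; first by right; rewrite invf_div.
    by apply: idlV; right; rewrite invf_div.
  case=> [/eqP|]; first by rewrite !mulf_eq0 !invr_eq0 !expf_eq0 (negPf p0) (negPf a0) (negPf c0) !andbF.
  apply; have -> : (p ^+ n / a * (p ^+ m / c))^-1 = a * c / p ^+ (n + m) => //.
  by rewrite exprD; field; rewrite !expf_neq0 // a0 c0.
have nI1 a : ~ idl a -> ~ infinitely_divisible p a.
  move=> na /(_ 1%N); rewrite expr1 => h; apply: na.
  by rewrite -(divfK p0 a) mulrC; exact: idlM.
have nIx : ~ infinitely_divisible p x.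
  move=> hx; apply: (@chain_bound (fun i => p ^+ i)) => [i _|i i' /andP[h _]].
    split; [by rewrite expf_neq0|by apply: VX; exact: idlV|].
    have -> : x / p ^+ i = p * (x / p ^+ i.+1).
      by rewrite exprS; field; rewrite expf_neq0 // p0.
    exact: idlM.
  have -> : p ^+ i' / p ^+ i = p * p ^+ (i' - i.+1).
    by rewrite -exprS -subSn // subSS expfB_cond // (negPf p0) add0n ltnW.
  by apply: idlM => //; apply: VX; exact: idlV.
have nIpev (c : {poly F}) : c != 0 -> ~ infinitely_divisible p (pev j x c).
  have [n] := ubnP (size c); elim: n c => // n IH c; rewrite ltnS => sc c0.
  have [c00|/pev_unit/nI1//] := eqVneq c.[0] 0.
  have cX : c = 'X * drop_poly 1 c.
    rewrite -{1}[c](poly_take_drop 1) expr1 [RHS]mulrC -[RHS]add0r; congr (_ + _).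
    apply/polyP => -[|k]; rewrite coef_take_poly coef0 //=.
    by rewrite -horner_coef0.
  rewrite cX rmorphM /= pevX; apply: prime_I => //; apply: IH.
    rewrite size_drop_poly subn1; apply: leq_trans sc.
    by rewrite prednK // size_poly_gt0.
  by apply: contraNneq c0 => h; rewrite cX h mulr0.
have [c [[i1 i1d c1] cw]] := dep (fun i => b ^+ i).
have ex : exists i, (i < d)%N && (c i != 0) by exists i1; rewrite i1d.
case: (ex_minnP ex) => i0 /andP[i0d c0] min_i0.
apply: (nIpev _ c0).
have -> : pev j x (c i0) =
    b * - \sum_(i < d | i != Ordinal i0d) pev j x (c i) * b ^+ (i - i0.+1).
  apply: (mulIf (expf_neq0 i0 b0)); rewrite mulrN mulNr mulr_sumr mulr_suml.
  apply/eqP; rewrite -addr_eq0.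
  apply/eqP; rewrite -[RHS]cw [RHS](bigD1 (Ordinal i0d)) //=; congr (_ + _).
  apply: eq_bigr => i ne; have [lt_i|gt_i|e] := ltngtP i i0.
  - suff -> : c i = 0 by rewrite rmorph0 !mul0r mulr0 mul0r.
    by apply: contraTeq lt_i => ci; rewrite -leqNgt min_i0 // ltn_ord.
  - have -> : b ^+ i = b ^+ (i - i0.+1) * b * b ^+ i0.
      by rewrite -exprSr -exprD; congr (_ ^+ _); lia.
    ring.
  - by case/eqP: ne; apply: val_inj.
have Vb : V b by have := hb 0%N; rewrite expr0 divr1.
move=> n; rewrite mulrAC; apply: VM => //; apply: VN; apply: Vsum => i _.
by apply: VM => //; exact: VX.
Qed.

(** A nonzero b in V is a unit times p^n, with n the last exponent such that b / p^n is in V. This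
    exponent, extended to K by inversion, is the order. *)
Lemma valuation_ring_place : exists P : place j, 0 < P x.
Proof.
have [p [p0 ip hp]] := uniformizer.
have np : ~ V p^-1 by case: ip p0 => [->|]; rewrite ?eqxx.
have natord b : V b -> b != 0 -> exists n : nat, V (b / p ^+ n) /\ V (p ^+ n / b).
  move=> Vb b0; have /existsNP/cid[n0 hn0] := not_infinitely_divisible p0 ip b0.
  have ex : exists n, `[< ~ V (b / p ^+ n) >] by exists n0; apply/asboolP.
  case: (ex_minnP ex) => -[|n] /asboolP hn min_n.
    by rewrite expr0 divr1 in hn.
  have Vn : V (b / p ^+ n).
    by apply: contrapT => h; have := min_n n; rewrite ltnn => /(_ (asboolT h)).
  exists n; split=> //; apply: contrapT => h; apply: hn.
  have -> : b / p ^+ n.+1 = b / p ^+ n / p.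
    by rewrite exprS; field; rewrite p0 expf_neq0.
  by apply: hp; right; rewrite invf_div.
have /choice[o ho] : forall b, exists n : int, b != 0 -> V (b / p ^ n) /\ V (p ^ n / b).
  move=> b; have [b0|b0] := eqVneq b 0; first by exists 0.
  have [Vb|Vb] := dichotomy b0.
    by have [n hn] := natord b Vb b0; exists n.
  have bi0 : b^-1 != 0 by rewrite invr_eq0.
  have [n [h1 h2]] := natord _ Vb bi0; exists (- n%:Z) => _.
  rewrite -exprz_inv exprz_inv -invr_expz -exprnP.
  split; first by move: h2; rewrite invrK mulrC invrK mulrC.
  by move: h1; rewrite mulrC.
have Vpz (n : int) : V (p ^ n) <-> 0 <= n.
  split=> [|]; last by case: n => // n _; rewrite -exprnP; apply: VX; exact: idlV.
  case: n => // n; rewrite NegzE -exprnN => h; exfalso; apply: np.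
  have -> : p^-1 = p ^+ n * p ^- n.+1.
    by rewrite exprS invfM mulrCA mulfV ?expf_neq0 // mulr1.
  by apply: VM => //; apply: VX; exact: idlV.
have VoP b n : b != 0 -> V (b / p ^ n) <-> n <= o b.
  move=> b0; have [h1 h2] := ho b b0; rewrite -subr_ge0 -Vpz expfzDr // -invr_expz.
  split=> h; rewrite ?[p ^ o b / _]mulrC.
    have -> : (p ^ n)^-1 * p ^ o b = (p ^ o b / b) * (b / p ^ n) by field; rewrite b0 expfz_neq0.
    exact: VM.
  have -> : b / p ^ n = b / p ^ o b * (p ^ o b / p ^ n) by field; rewrite !expfz_neq0.
  exact: VM.
have o_uniq b n : b != 0 -> V (b / p ^ n) -> V (p ^ n / b) -> o b = n.
  move=> b0 h1 h2; apply/eqP; rewrite eq_le; apply/andP; split; last by apply/VoP.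
  have [h3 h4] := ho b b0; rewrite -subr_ge0 -Vpz expfzDr // -invr_expz.
  have -> : p ^ n / p ^ o b = (p ^ n / b) * (b / p ^ o b) by field; rewrite b0 expfz_neq0.
  exact: VM.
have oM a b : a != 0 -> b != 0 -> o (a * b) = o a + o b.
  move=> a0 b0; have [h1 h2] := ho a a0; have [h3 h4] := ho b b0.
  apply: o_uniq; rewrite ?mulf_neq0 // expfzDr //.
    have -> : a * b / (p ^ o a * p ^ o b) = a / p ^ o a * (b / p ^ o b).
      by field; rewrite !expfz_neq0.
    exact: VM.
  have -> : p ^ o a * p ^ o b / (a * b) = p ^ o a / a * (p ^ o b / b).
    by field; rewrite a0 b0.
  exact: VM.
have oD a b : a != 0 -> b != 0 -> a + b != 0 -> Num.min (o a) (o b) <= o (a + b).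
  move=> a0 b0 ab0; apply/VoP => //; rewrite mulrDl.
  by apply: VD; apply/VoP => //; rewrite ge_min lexx ?orbT.
have oC (a : F) : a != 0 -> o (j a) = 0.
  move=> a0; apply: o_uniq; rewrite ?fmorph_eq0 // expr0z ?divr1 //.
  by rewrite div1r -fmorphV.
have oS : exists2 y, y != 0 & o y = 1.
  by exists p => //; apply: o_uniq; rewrite // expr1z mulfV.
exists (Place oM oD oC oS) => /=.
by rewrite -[0 < _]/(1 <= o x); apply/VoP => //; rewrite expr1z; apply: hp.
Qed.
End ValuationRing.

Lemma exists_place_pos d : dependent_over j x d -> exists P : place j, 0 < P x.
Proof.
have [V [gV mV]] := maximal_subring_without_inverse.
exact: valuation_ring_place gV mV d.
Qed.
End PlaceExistence.

(** * Weak approximation and finiteness of zeros *)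

Section Approximation.
Variables (F K : fieldType) (j : {rmorphism F -> K}).
Implicit Types (P : place j) (x y : K).

Lemma ordXz P x (n : int) : x != 0 -> P (x ^ n) = n * P x.
Proof.
move=> x0; case: n => n; first by rewrite -exprnP ordX // mulrC -mulr_natr natz.
by rewrite NegzE -exprnN ordV ?expf_neq0 // ordX // mulNr mulrC -mulr_natr natz.
Qed.

Lemma same_place_sym P P' : same_place P P' -> same_place P' P.
Proof. by move=> h x x0; rewrite h. Qed.

(* Only the subgroup of pairs (ord x, ord' x) of Z^2 matters: it surjects on   *)
(* both factors and is not the diagonal, so it meets the second quadrant.      *)
Lemma independent_places P P' : ~ same_place P P' ->
  exists y, [/\ y != 0, P y < 0 & 0 < P' y].
Proof.
move=> nsame; have [u u0 Pu] := ord_surj P; have [w w0 Pw] := ord_surj P'.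
have key z : z != 0 -> P z = 0 -> P' z != 0 ->
    exists y, [/\ y != 0, P y < 0 & 0 < P' y].
  (* z^n / u has order -1 at P, and n is such that z^n has order at least |P' u| + 1 at P'. *)
  move=> z0 Pz P'z; pose n : int := P' z * (`|P' u| + 1).
  exists (z ^ n / u); rewrite mulf_neq0 ?invr_eq0 ?expfz_neq0 //.
  by split; rewrite // ordM ?invr_eq0 ?expfz_neq0 // ordV // ordXz // /n ?Pz ?Pu; nia.
have [x [x0 Px]] : exists x, x != 0 /\ P x <> P' x.
  apply: contrapT => h; apply: nsame => x x0; apply: contrapT => Px.
  by apply: h; exists x.
have [e1|ne1] := eqVneq (P' x) (P x * P' u); last first.
  apply: (key (x / u ^ P x)); rewrite ?mulf_neq0 ?invr_eq0 ?expfz_neq0 //;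
  rewrite ordM ?invr_eq0 ?expfz_neq0 // ordV ?expfz_neq0 // ordXz //; first by rewrite Pu; lia.
  by apply: contraNneq ne1; lia.
have [e2|ne2] := eqVneq 1 (P w * P' u); last first.
  apply: (key (w / u ^ P w)); rewrite ?mulf_neq0 ?invr_eq0 ?expfz_neq0 //;
  rewrite ordM ?invr_eq0 ?expfz_neq0 // ordV ?expfz_neq0 // ordXz //; first by rewrite Pu; lia.
  by rewrite Pw; apply: contraNneq ne2; lia.
(* Here P' u divides 1, and it is not 1 because P x and P' x differ; so it is -1. *)
exists u^-1; rewrite invr_eq0 !ordV // Pu; split=> //.
have : P' u != 1 by apply: contra_notN Px => /eqP e; rewrite e1 e mulr1.
by move=> /eqP; case: (ltrP 0 (P w)) => ?; case: (ltrP 1 (P' u)) => ?; nia.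
Qed.

Lemma large_power (I : eqType) (Ps : I -> place j) (s : seq I) x y :
  (forall i, i \in s -> 0 < Ps i x) ->
  exists m : nat, forall i, i \in s -> 0 < Ps i x *+ m.+1 + Ps i y.
Proof.
move=> hx; suff [m hm] : exists m : nat, forall n i, (m <= n)%N -> i \in s ->
    0 < Ps i x *+ n + Ps i y by exists m => i; apply: hm; lia.
elim: s hx => [|a s IH] hx; first by exists 0%N.
have [i si|m hm] := IH; first by apply: hx; rewrite inE si orbT.
exists (maxn m `|Ps a y|.+1) => n i; rewrite geq_max => /andP[mn an].
rewrite inE => /orP[/eqP ->|]; last exact: hm.
have := hx a (mem_head _ _); rewrite -mulr_natr natz; nia.
Qed.

(** Induction on s: take y for the tail and z separating P from the new place a. If y has positive
    order at a, keep y; if it has order 0, take y^m z with m large; if it has a pole, take z y^m /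
    (1 + y^m), where the fraction has order 0 at P and a and large order on the tail. *)
Lemma approximation (I : eqType) (Ps : I -> place j) (s : seq I) P :
  (forall i, i \in s -> ~ same_place P (Ps i)) ->
  exists y, [/\ y != 0, P y < 0 & forall i, i \in s -> 0 < Ps i y].
Proof.
elim: s => [|a s IH] hs.
  by have [u u0 Pu] := ord_surj P; exists u^-1; rewrite invr_eq0 ordV // Pu.
have [i si|y [y0 Py hy]] := IH; first by apply: hs; rewrite inE si orbT.
have [z [z0 Pz P'z]] := independent_places (hs a (mem_head _ _)).
have [m hm] := large_power z hy.
have ym0 : y ^+ m.+1 != 0 by rewrite expf_neq0.
have [neg|pos|zer] := ltgtP (Ps a y) 0.
- have unit_neg P' : P' y < 0 -> 1 + y ^+ m.+1 != 0 /\
      P' (1 + y ^+ m.+1) = P' (y ^+ m.+1).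
    move=> P'y; rewrite addrC; apply: ord_dominant => //; right.
    by rewrite ord1 ordX // mulrS; have := mulrn_wle0 m (ltW P'y); lia.
  have [ne eP] := unit_neg P Py; have [_ ea] := unit_neg _ neg.
  exists (y ^+ m.+1 * z / (1 + y ^+ m.+1)).
  have e P' : P' (y ^+ m.+1 * z / (1 + y ^+ m.+1)) =
      P' (y ^+ m.+1) + P' z - P' (1 + y ^+ m.+1).
    by rewrite !ordM ?ordV ?mulf_neq0 ?invr_eq0.
  split; [by rewrite !mulf_neq0 ?invr_eq0|by rewrite e eP; lia|].
  move=> i; rewrite inE => /orP[/eqP ->|si]; first by rewrite e ea; lia.
  rewrite e; have [_ ->] : 1 + y ^+ m.+1 != 0 /\ Ps i (1 + y ^+ m.+1) = Ps i 1.
    apply: ord_dominant; rewrite ?oner_neq0 //; right.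
    by rewrite ord1 ordX // mulrS; have yi := hy i si; have := mulrn_wge0 m (ltW yi); lia.
  by rewrite ord1 ordX //; have := hm i si; lia.
- by exists y; split=> // i; rewrite inE => /orP[/eqP ->|/hy].
- exists (y ^+ m.+1 * z); rewrite mulf_neq0 //; split=> //.
    by rewrite ordM // ordX // mulrS; have := mulrn_wle0 m (ltW Py); lia.
  move=> i; rewrite inE ordM // ordX // => /orP[/eqP ->|/hm//].
  by rewrite zer mul0rn add0r.
Qed.

(** With d distinct zeros, choose functions th_i having a pole at the i-th zero and vanishing at the
    others. In a normalised relation over F[u], a coefficient with c_i(0) nonzero is a unit at the
    i-th zero, where its term has a pole and all other terms are regular. *)
Lemma finitely_many_zeros P0 u d : u != 0 -> dependent_over j u d ->
  exists n (Ps : nat -> place j), forall P, 0 < P u ->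
    exists2 i, (i < n)%N & same_place P (Ps i).
Proof.
move=> u0 dep; apply: contrapT => none.
have fam n : exists Ps : nat -> place j, (forall i, (i < n)%N -> 0 < Ps i u) /\
    forall i i', (i < i' < n)%N -> ~ same_place (Ps i') (Ps i).
  elim: n => [|n [Ps [h1 h2]]]; first by exists (fun=> P0); split=> // i i' /andP[].
  have [P [Pu hP]] : exists P, 0 < P u /\ forall i, (i < n)%N -> ~ same_place P (Ps i).
    apply: contrapT => h; apply: none; exists n, Ps => P Pu.
    by apply: contrapT => h'; apply: h; exists P; split=> // i lt_in s; apply: h'; exists i.
  exists (fun i => if (i < n)%N then Ps i else P); split=> i.
    by move=> _; case: ifP => // lt_in; exact: h1.
  move=> i' /andP[lt_ii]; rewrite ltnS leq_eqVlt => /orP[/eqP e|lt_i'n].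
    by rewrite e ltnn -e lt_ii; apply: hP; rewrite -e.
  by rewrite lt_i'n (ltn_trans lt_ii) //; apply: h2; rewrite lt_ii.
have [Ps [h1 h2]] := fam d.
have h3 i i' : (i < d)%N -> (i' < d)%N -> i' != i -> ~ same_place (Ps i) (Ps i').
  move=> id i'd; rewrite neq_ltn => /orP[lt|lt]; first by apply: h2; rewrite lt.
  by move=> /same_place_sym; apply: h2; rewrite lt.
have /choice[th hth] : forall i : nat, exists y, (i < d)%N -> [/\ y != 0, Ps i y < 0 &
    forall i', i' \in [seq i' <- iota 0 d | i' != i] -> 0 < Ps i' y].
  move=> i; have [id|] := boolP (i < d)%N; last by exists 0.
  have [|y hy] := @approximation _ Ps [seq i' <- iota 0 d | i' != i] (Ps i).
    move=> i'; rewrite mem_filter mem_iota => /andP[ne /andP[_ i'd]].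
    exact: h3.
  by exists y.
have [c [[i0 i0d c0] cw]] := dependent_normalized u0 dep th.
have [t0 t1 _] := hth i0 i0d.
have uu : vge (Ps i0) 1 u by right; exact: (h1 _ i0d).
have upos : vge (Ps i0) 0 u by exact: vgeW uu.
have [ne0 e0] : j (c i0).[0] != 0 /\ Ps i0 (j (c i0).[0]) = 0.
  by rewrite fmorph_eq0 ord_const.
have split_c : pev j u (c i0) = j (c i0).[0] + u * pev j u (drop_poly 1 (c i0)).
  rewrite -{1}[c i0](poly_take_drop 1) rmorphD rmorphM rmorphXn /= pevX expr1.
  rewrite [u * _]mulrC; congr (_ + _); rewrite -(pevC j u); congr (pev _ _ _).
  apply/polyP => -[|k]; rewrite coef_take_poly coefC //=.
  by rewrite horner_coef0.
have [c1 c2] : pev j u (c i0) != 0 /\ Ps i0 (pev j u (c i0)) = 0.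
  rewrite split_c -e0; apply: ord_dominant => //; rewrite e0 add0r -[1]addr0.
  by apply: vgeM => //; exact: vge_pev.
have bad : vge (Ps i0) 0 (pev j u (c i0) * th i0).
  have -> : pev j u (c i0) * th i0 =
      - \sum_(i < d | i != Ordinal i0d) pev j u (c i) * th i.
    apply/eqP; rewrite -addr_eq0; apply/eqP.
    by rewrite -[RHS]cw [RHS](bigD1 (Ordinal i0d)).
  apply/vgeN/vge_sum => i ne; apply: vge0M; first exact: vge_pev.
  have [ti _ pos] := hth i (ltn_ord i); right; apply/ltW/pos.
  rewrite mem_filter mem_iota i0d !andbT eq_sym.
  by apply: contraNneq ne => e; apply/eqP/val_inj.
have := vge_neq0 bad; rewrite mulf_neq0 // ordM // c2 add0r => /(_ isT).
by rewrite leNgt t1.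
Qed.
End Approximation.

(** * Constants, integral relations and functions with a single pole *)

Section FunctionField.
Variables (F K : fieldType) (j : {rmorphism F -> K}).
Hypothesis curve : is_function_field j.
Implicit Types (P : place j) (x y : K).

Lemma function_field_dependent x : exists d, dependent_over j x d.
Proof. by have [_ [t [t_tr [s hs]]]] := curve; exact: finite_rank t_tr hs x. Qed.

Lemma nonconstant_transcendental x : (forall a, x <> j a) -> ~ algebraicOver j x.
Proof. by have [cl _] := curve => nx /cl[a xa]; exact: (nx a). Qed.

Lemma ord_transcendental P x : x != 0 -> P x != 0 -> ~ algebraicOver j x.
Proof.
move=> x0 Px; apply: nonconstant_transcendental => a xa.
by move: Px; rewrite xa ord_const ?eqxx // -(fmorph_eq0 j) -xa.
Qed.

(** A nonconstant x is transcendental, and so is 1/x; a zero of 1/x is a pole of x. *)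
Lemma no_pole_constant x : (forall P, vge P 0 x) -> exists a, x = j a.
Proof.
move=> hx; apply: contrapT => nx.
have x_tr : ~ algebraicOver j x.
  by apply: nonconstant_transcendental => a xa; apply: nx; exists a.
have xi_tr : ~ algebraicOver j x^-1.
  by move=> /algebraic_inv; rewrite invrK.
have x0 : x != 0 by apply/eqP => e; apply: nx; exists 0; rewrite rmorph0.
have [d dep] := function_field_dependent x^-1.
have [P] := exists_place_pos xi_tr dep.
by rewrite ordV // oppr_gt0 ltNge (vge_neq0 (hx P) x0).
Qed.

Section Relation.
Variable a : K.
Hypothesis a_tr : ~ algebraicOver j a.

Lemma polynomial_relation w : exists n (c : nat -> {poly F}), c n.+1 != 0 /\
  pev j a (c n.+1) * w ^+ n.+1 = \sum_(i < n.+1) pev j a (c i) * w ^+ i.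
Proof.
have [d dep] := function_field_dependent a.
have [c [[i1 i1d c1] cw]] := dep (fun i => w ^+ i).
have ex : exists i, (i < d)%N && (c i != 0) by exists i1; rewrite i1d.
have [|m /andP[md cm] max_m] := @ex_maxnP _ d ex.
  by move=> i /andP[/ltnW].
have e : \sum_(i < m.+1) pev j a (c i) * w ^+ i = 0.
  rewrite -[RHS]cw -!(big_mkord xpredT (fun i => pev j a (c i) * w ^+ i)).
  rewrite [RHS](big_cat_nat (n := m.+1)) //= [X in _ = _ + X]big1_seq ?addr0 // => i.
  rewrite mem_index_iota => /andP[_ /andP[mi id]].
  have [->|ci] := eqVneq (c i) 0; first by rewrite rmorph0 mul0r.
  by have := max_m i; rewrite id ci => /(_ isT); rewrite leqNgt mi.
case: m md cm max_m e => [|m] md cm max_m e.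
  move/eqP: e; rewrite big_ord1 expr0 mulr1 => e; exfalso.
  by move/negP: (pev_transcendental a_tr cm); apply.
exists m, (fun i => if (i == m.+1) then - c i else c i).
rewrite eqxx oppr_eq0; split=> //; apply/eqP.
rewrite rmorphN mulNr eq_sym -addr_eq0; apply/eqP; rewrite -[RHS]e.
rewrite [RHS]big_ord_recr /=; congr (_ + _).
by apply: eq_bigr => i _; rewrite ltn_eqF ?ltn_ord.
Qed.

(** Multiplied by the n-th power of its leading coefficient e, the relation becomes a monic equation
    for e w over F[a]. *)
Lemma relation_integral P w n (c : nat -> {poly F}) : vge P 0 a ->
  pev j a (c n.+1) * w ^+ n.+1 = \sum_(i < n.+1) pev j a (c i) * w ^+ i ->
  vge P 0 (pev j a (c n.+1) * w).
Proof.
move=> Pa rel; set e := pev j a (c n.+1) in rel *.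
pose q := \poly_(i < n.+1) (pev j a (c i) * e ^+ (n - i)).
have sq : (size (- q)%R < size ('X^(n.+1) : {poly K})%R)%N.
  by rewrite size_polyN size_polyXn ltnS size_poly.
apply: (@place_integral _ _ j P ('X^(n.+1) - q)).
- by rewrite lead_coefDl // lead_coefXn ord1.
- by rewrite -lead_coef_eq0 lead_coefDl // lead_coefXn oner_neq0.
- move=> i; rewrite coefB coefXn coef_poly; apply: vgeB.
    by case: eqP => _; [exact: vge01|exact: vge0].
  case: ifP => _; last exact: vge0.
  by apply: vge0M; [|apply: vge0X]; exact: vge_pev.
- apply/rootP; rewrite hornerD hornerN hornerXn horner_poly; apply/eqP.
  rewrite subr_eq0 exprMn exprS -mulrA mulrCA rel mulr_sumr; apply/eqP.
  apply: eq_bigr => i _; rewrite exprMn.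
  have -> : e ^+ n = e ^+ (n - i) * e ^+ i by rewrite -exprD subnK // -ltnS.
  by ring.
Qed.

Lemma clear_denominator P w : regular_outside P a ->
  exists2 c : {poly F}, c != 0 & regular_outside P (pev j a c * w).
Proof.
move=> Aa; have [n [c [c0 rel]]] := polynomial_relation w.
exists (c n.+1) => // P' nP; apply: relation_integral => //; exact: Aa.
Qed.
End Relation.

Lemma ord_pev_pole P y (p : {poly F}) : y != 0 -> P y < 0 -> p != 0 ->
  pev j y p != 0 /\ P (pev j y p) = P y *+ (size p).-1.
Proof.
move=> y0 Py p0; rewrite pevE horner_coef size_map_poly.
have sp : size p = (size p).-1.+1 by rewrite prednK // size_poly_gt0.
rewrite sp big_ord_recr /= coef_map -/(lead_coef p) addrC; set n := (size p).-1.
have l0 : lead_coef p != 0 by rewrite lead_coef_eq0.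
have yn0 : y ^+ n != 0 by rewrite expf_neq0.
have t0 : j (lead_coef p) != 0 by rewrite fmorph_eq0.
have e : P (j (lead_coef p) * y ^+ n) = P y *+ n.
  by rewrite ordM // ord_const // add0r ordX.
rewrite -e; apply: ord_dominant; first by rewrite mulf_neq0.
apply: vge_sum => i _; rewrite coef_map; apply: (@vgeW _ _ _ _ (0 + P y *+ i)).
  rewrite add0r e.
  have -> : P y *+ n = P y *+ i + P y *+ (n - i.+1).+1.
    by rewrite -mulrnDr; congr (_ *+ _); have := ltn_ord i; lia.
  by rewrite mulrSr; have := mulrn_wle0 (n - i.+1) (ltW Py); lia.
by apply: vgeM; [exact: vge_const|right; rewrite ordX].
Qed.

Lemma vge_proper_fraction P y (p q : {poly F}) : y != 0 -> P y < 0 ->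
  (size p < size q)%N -> vge P 0 (pev j y p / pev j y q).
Proof.
move=> y0 Py pq; have q0 : q != 0 by rewrite -size_poly_gt0; lia.
have [->|p0] := eqVneq p 0; first by rewrite rmorph0 mul0r; left.
have [p1 e1] := ord_pev_pole y0 Py p0; have [q1 e2] := ord_pev_pole y0 Py q0.
right; rewrite ordM ?invr_eq0 // ordV // e1 e2.
have sp : (0 < size p)%N by rewrite size_poly_gt0.
have -> : P y *+ (size q).-1 = P y *+ (size p).-1 + P y *+ (size q - size p).
  by rewrite -mulrnDr; congr (_ *+ _); lia.
by have := mulrn_wle0 (size q - size p) (ltW Py); lia.
Qed.

(* With y and theta whose only common pole is P, one looks for                *)
(*   f = sum_l a_l theta^(n+l) - sum_(i<n) g_i theta^i, g_i proper in F(y),    *)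
(* that is also an F[y]-combination of the c^n theta^i, where c is the leading *)
(* coefficient of the relation for theta: the first form controls the poles    *)
(* of y, the second one the other places, and P f < 0 since theta is not      *)
(* integral at P.  Reducing modulo c^n, the second form imposes only finitely  *)
(* many F-linear conditions on (a_l), independently of the number of l.       *)
Lemma pole_only_at P : exists f, [/\ f != 0, P f < 0 & regular_outside P f].
Proof.
have [u u0 Pu] := ord_surj P; pose y := u^-1.
have y0 : y != 0 by rewrite invr_eq0.
have Py : P y < 0 by rewrite ordV // Pu.
have [d dep] := function_field_dependent u.
have [r [Ps hPs]] := finitely_many_zeros P u0 dep.
(* theta gets a pole at P and zeros at the other poles of y, which are zeros of u and so finite in
   number. *)
have [|th [th0 Pth hth]] :=
    @approximation _ _ j _ Ps [seq i <- iota 0 r | `[< ~ same_place P (Ps i) >]] P.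
  by move=> i; rewrite mem_filter => /andP[/asboolP].
have {}hth P' : ~ same_place P' P -> P' y < 0 -> vge P' 0 th.
  move=> nP; rewrite ordV // oppr_lt0 => /hPs[i ir sP].
  right; rewrite sP //; apply/ltW/hth; rewrite mem_filter mem_iota ir andbT.
  by rewrite andbT; apply/asboolP => h; apply: nP => x x0; rewrite h // sP.
have y_tr : ~ algebraicOver j y by apply: (@ord_transcendental P); rewrite // lt_eqF.
have [D [cs [c0 rel]]] := polynomial_relation y_tr th.
set c := cs D.+1 in c0 rel; pose n := D.+1.
have ev0 (p : {poly F}) : p != 0 -> pev j y p != 0 by exact: pev_transcendental.
have /choice[q hq] : forall i : nat, exists q : nat -> {poly F},
    pev j y (c ^+ i) * th ^+ i = \sum_(l < n) pev j y (q l) * th ^+ l.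
  elim=> [|i [q hq]].
    exists (fun l => (l == 0)%:R); rewrite big_ord_recl big1 => [|l _].
      by rewrite !expr0 !rmorph1 addr0.
    by rewrite rmorph0 mul0r.
  exists (fun l => (if l is l'.+1 then c * q l' else 0) + q D * cs l).
  under eq_bigr do rewrite rmorphD mulrDl.
  rewrite big_split /= big_ord_recl /= rmorph0 mul0r add0r.
  have -> : \sum_(i < n) pev j y (q D * cs i) * th ^+ i =
      pev j y (q D) * (pev j y c * th ^+ n).
    by rewrite rel mulr_sumr; apply: eq_bigr => l _; rewrite rmorphM mulrA.
  have -> : pev j y (c ^+ i.+1) * th ^+ i.+1 =
      pev j y c * th * (pev j y (c ^+ i) * th ^+ i).
    by rewrite !exprS rmorphM /=; ring.
  rewrite hq big_ord_recr mulrDr mulr_sumr /= exprS; congr (_ + _); last by ring.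
  apply: eq_bigr => l _; rewrite /bump add1n exprS rmorphM /=; ring.
pose C i := c ^+ i; have C0 i : C i != 0 by rewrite expf_neq0.
(* The coefficient of theta^i in theta^(n+l) is q / c^(n+l); it is split into a multiple of c^n, a
   remainder modulo c^n and a proper fraction. *)
pose quo l i := q (n + l)%N i %/ C (n + l)%N %/ C n.
pose rem l i := (q (n + l)%N i %/ C (n + l)%N) %% C n.
pose fr l i := pev j y (q (n + l)%N i %% C (n + l)%N) / pev j y (C (n + l)%N).
have decomp l : th ^+ (n + l) =
    \sum_(i < n) (pev j y (quo l i * C n) + pev j y (rem l i) + fr l i) * th ^+ i.
  apply: (mulfI (ev0 _ (C0 (n + l)%N))); rewrite hq mulr_sumr.
  apply: eq_bigr => i _; rewrite mulrA -rmorphD /quo /rem -divp_eq mulrDr.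
  congr (_ * _); rewrite /fr [_ / _]mulrC mulVKf ?ev0 // -rmorphM -rmorphD.
  by rewrite mulrC -divp_eq.
pose S := size (C n); pose N := (n * S)%N.
(* The N + 1 scalars a_l are chosen to cancel the n S coefficients of the remainders. *)
have [|a0 [[L aL] ha]] := @linear_dependence F 'I_N.+1 ('I_n * 'I_S)%type
    (fun l ik => (rem l ik.1)`_ik.2).
  by rewrite card_prod !card_ord.
pose a (l : nat) := if insub l is Some l' then a0 l' else 0.
have aE (l : 'I_N.+1) : a l = a0 l by rewrite /a valK.
have {}ha i : (i < n)%N -> \sum_(l < N.+1) a l *: rem l i = 0.
  move=> lt_in; apply/polyP => k; rewrite coef_sum coef0.
  have [lt_k|ge_k] := ltnP k S.
    rewrite -[RHS](ha (Ordinal lt_in, Ordinal lt_k)).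
    by apply: eq_bigr => l _; rewrite coefZ aE.
  rewrite big1 // => l _; rewrite coefZ nth_default ?mulr0 //.
  by apply: leq_trans ge_k; rewrite ltnW // ltn_modpN0.
pose g i := \sum_(l < N.+1) j (a l) * fr l i.
pose f := \sum_(l < N.+1) j (a l) * th ^+ (n + l) - \sum_(i < n) g i * th ^+ i.
have fE : f = \sum_(i < n)
    pev j y (\sum_(l < N.+1) a l *: quo l i) * pev j y (C n) * th ^+ i.
  rewrite /f; apply/eqP; rewrite subr_eq -big_split /=; apply/eqP.
  under eq_bigr => l _ do rewrite decomp mulr_sumr.
  rewrite exchange_big; apply: eq_bigr => i _; rewrite -mulrDl.
  under eq_bigr => l _ do rewrite mulrA; rewrite -mulr_suml; congr (_ * _).
  have : pev j y (\sum_(l < N.+1) a l *: rem l i) = 0.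
    by rewrite ha ?ltn_ord // rmorph0.
  rewrite !rmorph_sum /= /g => h.
  rewrite mulr_suml -[LHS]subr0 -[X in _ - X = _]h -sumrB -big_split /=; apply: eq_bigr => l _.
  by rewrite -!mul_polyC !rmorphM /= pevC; ring.
have vfr P' : P' y < 0 -> forall l i, vge P' 0 (fr l i).
  by move=> P'y l i; apply: vge_proper_fraction => //; rewrite ltn_modpN0.
have vg P' i : P' y < 0 -> vge P' 0 (g i).
  by move=> P'y; apply: vge_sum => l _; apply: vge0M; [exact: vge_const|exact: vfr].
(* Were f regular at P, theta would be a root of A X^n - B, whose coefficients are regular at P and
   whose leading coefficient is a nonzero constant; theta would then be regular at P. *)
have nPf : ~ vge P 0 f.
  move=> vf; suff : vge P 0 th by move=> /vge_neq0/(_ th0); rewrite leNgt Pth.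
  pose A := \poly_(l < N.+1) j (a l).
  have A0 : A != 0.
    apply/eqP => /(congr1 (fun p : {poly K} => p`_L)).
    by rewrite coef_poly ltn_ord coef0 aE => /eqP; rewrite fmorph_eq0 (negPf aL).
  pose B := \poly_(i < n) g i + f%:P.
  have sB : (size (- B)%R < size (A * 'X^n)%R)%N.
    rewrite size_polyN size_mulXn // (leq_ltn_trans (size_polyD _ _)) //.
    rewrite gtn_max; apply/andP; split.
      by rewrite (leq_ltn_trans (size_poly _ _)) // -[X in (X < _)%N]addn0 ltn_add2l size_poly_gt0.
    by rewrite (leq_ltn_trans (size_polyC_leq1 _)) // /n addSn ltnS addn_gt0 size_poly_gt0 A0 orbT.
  have lead : lead_coef (A * 'X^n - B) = lead_coef A.
    by rewrite lead_coefDl // lead_coefM lead_coefXn mulr1.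
  apply: (@place_integral _ _ j P (A * 'X^n - B)).
  - rewrite lead; have : lead_coef A != 0 by rewrite lead_coef_eq0.
    rewrite lead_coefE coef_poly; case: ifP; rewrite ?eqxx // => _.
    by rewrite fmorph_eq0; exact: ord_const.
  - by rewrite -lead_coef_eq0 lead lead_coef_eq0.
  - move=> i; rewrite coefB coefMXn coefD coefC !coef_poly; apply: vgeB.
      case: ifP => _; first exact: vge0.
      by case: ifP => _; [exact: vge_const|exact: vge0].
    apply: vgeD; first by case: ifP => _; [exact: vg|exact: vge0].
    by case: ifP => _ //; exact: vge0.
  - apply/rootP; rewrite hornerD hornerN hornerM hornerXn /A /B hornerD hornerC !horner_poly /f.
    rewrite mulr_suml; apply/eqP; rewrite subr_eq0 addrC subrK; apply/eqP.
    by apply: eq_bigr => l _; rewrite exprD mulrAC mulrA.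
have f0 : f != 0 by apply/eqP => f0; apply: nPf; left.
exists f; split=> //; first by rewrite ltNge; apply/negP => h; apply: nPf; right.
move=> P' nP'; have [y_pole|y_reg] := ltP (P' y) 0.
  have vth := hth P' nP' y_pole; apply: vgeB; apply: vge_sum => i _.
    by apply: vge0M; [exact: vge_const|exact: vge0X].
  by apply: vge0M; [exact: vg|exact: vge0X].
have vy : vge P' 0 y by right.
have vcth : vge P' 0 (pev j y c * th) by exact: relation_integral rel.
rewrite fE; apply: vge_sum => i _; rewrite -mulrA.
apply: vge0M; first exact: vge_pev.
have -> : pev j y (C n) * th ^+ i = pev j y (c ^+ (n - i)) * (pev j y c * th) ^+ i.
  rewrite exprMn mulrA -rmorphXn -rmorphM /C -exprD subnK //.
  exact: ltnW.
by apply: vge0M; [exact: vge_pev|exact: vge0X].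
Qed.
End FunctionField.

(** * Integral closure in a quadratic extension *)

Section IntegralClosure.
Variables (k : fieldType) (S : subringClosed k) (L : fieldExtType k).

(** The subring as a ring of its own, so that [integral_closure] becomes integrality over the ring
    morphism into L. *)
Record subring_elt := SubringElt {
  subring_val :> k;
  _ : subring_val \in S }.
HB.instance Definition _ := [isSub for subring_val].
HB.instance Definition _ := [Choice of subring_elt by <:].
HB.instance Definition _ := [SubChoice_isSubComNzRing of subring_elt by <:].

Let iota : {rmorphism subring_elt -> L} := in_alg L \o (val : subring_elt -> k).

Lemma integral_closureE (x : L) :
  integral_closure [set a | a \in S] x <-> integralOver iota x.
Proof.
split=> [[p [mp hp rp]]|[p mp rp]].
  exists (\poly_(i < size p) (SubringElt (hp i))).
    rewrite monicE lead_coefE; apply/eqP/val_inj => /=.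
    have sp : size (\poly_(i < size p) SubringElt (hp i)) = size p.
      apply: size_poly_eq; apply/eqP => /(congr1 val) /= h.
      by move: (oner_neq0 k); rewrite -(monicP mp) /lead_coef h eqxx.
    rewrite sp coef_poly prednK ?leqnn /=; first exact/monicP.
    by rewrite size_poly_gt0 monic_neq0.
  suff <- : map_poly (in_alg L) p =
            map_poly iota (\poly_(i < size p) SubringElt (hp i)) by [].
  apply/polyP => i; rewrite !coef_map coef_poly /=.
  by case: ltnP => // /(nth_default 0) ->; rewrite !scale0r.
exists (map_poly val p); split; rewrite ?monic_map -?map_poly_comp //.
by move=> i; rewrite coef_map; exact: valP.
Qed.

Lemma integral_closureD (x y : L) : integral_closure [set a | a \in S] x ->
  integral_closure [set a | a \in S] y ->
  integral_closure [set a | a \in S] (x + y).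
Proof. by rewrite !integral_closureE; exact: integral_add. Qed.

Lemma integral_closureM (x y : L) : integral_closure [set a | a \in S] x ->
  integral_closure [set a | a \in S] y ->
  integral_closure [set a | a \in S] (x * y).
Proof. by rewrite !integral_closureE; exact: integral_mul. Qed.

Lemma integral_closure_in (a : k) : a \in S ->
  integral_closure [set a | a \in S] (a%:A : L).
Proof.
by move=> Sa; apply/integral_closureE; exact: (integral_id iota (SubringElt Sa)).
Qed.

Lemma integral_closure_root (p : {poly L}) (x : L) : p \is monic -> root p x ->
  (forall i, integral_closure [set a | a \in S] p`_i) ->
  integral_closure [set a | a \in S] x.
Proof.
move=> mp px hp; apply/integral_closureE; apply: integral_root_monic mp px _.
by apply/integral_poly => i; apply/integral_closureE.
Qed.

Lemma integral_closure0 : integral_closure [set a | a \in S] (0 : L).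
Proof. by rewrite integral_closureE; exact: integral0. Qed.

Lemma integral_closure1 : integral_closure [set a | a \in S] (1 : L).
Proof. by rewrite integral_closureE; exact: integral1. Qed.

Lemma integral_closureN (x : L) : integral_closure [set a | a \in S] x ->
  integral_closure [set a | a \in S] (- x).
Proof. by rewrite !integral_closureE; exact: integral_opp. Qed.

Lemma integral_closure_sum (I : Type) (r : seq I) (q : pred I) (f : I -> L) :
  (forall i, q i -> integral_closure [set a | a \in S] (f i)) ->
  integral_closure [set a | a \in S] (\sum_(i <- r | q i) f i).
Proof.
move=> h; elim/big_ind: _ => //; last by move=> x y; exact: integral_closureD.
exact: integral_closure0.
Qed.

(** The characteristic polynomial is monic with integral coefficients, and integrality is
    transitive. *)
Lemma integral_closure_eigenvalue n (g : 'M[L]_n) (a : L) :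
  (forall i l, integral_closure [set a | a \in S] (g i l)) -> eigenvalue g a ->
  integral_closure [set a | a \in S] a.
Proof.
move=> hg; rewrite eigenvalue_root_char => ra.
apply: integral_closure_root (char_poly_monic g) ra _ => i.
have ICp (p q : {poly L}) : (forall i, integral_closure [set a | a \in S] p`_i) ->
    (forall i, integral_closure [set a | a \in S] q`_i) ->
    forall i, integral_closure [set a | a \in S] (p * q)`_i.
  move=> hp hq l; rewrite coefM; apply: integral_closure_sum => m _.
  exact: integral_closureM.
rewrite /char_poly /determinant coef_sum; apply: integral_closure_sum => s _.
have cst (b : bool) : integral_closure [set a | a \in S] (b%:R : L).
  by case: b; [exact: integral_closure1|exact: integral_closure0].
apply: (ICp).
  case: (perm.odd_perm s) => l; rewrite ?expr1 ?expr0 ?coefN coef1; last exact: cst.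
  exact/integral_closureN/cst.
elim/big_ind: _ => [l|p q hp hq l|m _ l]; [by rewrite coef1; exact: cst|exact: ICp|].
rewrite /char_poly_mx !mxE coefB coefMn coefX coefC; apply: integral_closureD.
  by case: (m == _); rewrite ?mulr1n ?mulr0n; [exact: cst|exact: integral_closure0].
by apply: integral_closureN; case: ifP => _; [exact: hg|exact: integral_closure0].
Qed.
End IntegralClosure.

Section RegularFunctions.
Variables (F k : fieldType) (j : {rmorphism F -> k}) (P : place j).

Definition regular_pred : {pred k} := fun x => `[< regular_outside P x >].

Fact regular_subring : subring_closed regular_pred.
Proof.
split; first by apply/asboolP => P' _; exact: vge01.
  by move=> x y /asboolP hx /asboolP hy; apply/asboolP => P' nP; apply: vgeB; [exact: hx|exact: hy].
by move=> x y /asboolP hx /asboolP hy; apply/asboolP => P' nP; apply: vge0M; [exact: hx|exact: hy].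
Qed.
HB.instance Definition _ := GRing.isSubringClosed.Build k regular_pred regular_subring.

Lemma regular_outsideE : regular_outside P = [set a | a \in regular_pred].
Proof. by apply/seteqP; split => x /=; [move/asboolP|move/asboolP]. Qed.

Lemma regular_pev a (c : {poly F}) :
  regular_outside P a -> regular_outside P (pev j a c).
Proof. by move=> Aa P' nP; apply: vge_pev; exact: Aa. Qed.

Lemma regularM a b :
  regular_outside P a -> regular_outside P b -> regular_outside P (a * b).
Proof. by move=> Aa Ab P' nP; apply: vge0M; [exact: Aa|exact: Ab]. Qed.

(** A is an intersection of valuation rings, hence integrally closed. *)
Lemma regular_integral (L : fieldExtType k) (a : k) :
  integral_closure (regular_outside P) (a%:A : L) -> regular_outside P a.
Proof.
move=> [p [mp hp rp]] P' nP.
apply: (@place_integral _ _ j P' p); rewrite ?monic_neq0 //.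
- by rewrite (monicP mp) ord1.
- by move=> i; exact: hp.
- by rewrite -(fmorph_root (in_alg L)).
Qed.
End RegularFunctions.

(** * Conjugation, trace and norm *)

Section Quadratic.
Variables (k : fieldType) (L : fieldExtType k) (conj : {lrmorphism L -> L}).
Hypothesis quadratic_L : \dim {:L} = 2%N.
Hypothesis conj_nontrivial : exists x, conj x != x.

Lemma conj_alg (a : k) : conj a%:A = a%:A.
Proof. by rewrite linearZ rmorph1. Qed.

Lemma quadratic_generator : exists x : L,
  conj x != x /\ forall y, exists a b : k, y = a%:A + b *: x.
Proof.
have [x cx] := conj_nontrivial; exists x; split=> // y.
have fr : free [:: x; 1].
  rewrite free_cons seq1_free oner_neq0 andbT span_seq1.
  by apply: contraNN cx => /vlineP[a ->]; rewrite conj_alg.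
have : y \in (<<[:: x; 1%R]>>)%VS.
  suff /andP[/eqP -> _] : basis_of fullv [:: x; 1] by exact: memvf.
  by rewrite basisEfree fr subvf quadratic_L.
rewrite span_cons span_seq1 => /memv_addP[_ /vlineP[b ->] [_ /vlineP[a ->] ->]].
by exists a, b; rewrite addrC.
Qed.

(** If x generates L and x^2 = c + b x, then conj x is a root of the same polynomial different from
    x, so it is b - x. *)
Lemma conjK : involutive conj.
Proof.
have [x [cx gen]] := quadratic_generator.
have [c [b xx]] := gen (x * x).
have cxE : conj x = b%:A - x.
  have e : conj x * conj x = c%:A + b *: conj x.
    by rewrite -rmorphM xx rmorphD /= conj_alg linearZ.
  have : (conj x - x) * (conj x + x - b%:A) = 0.
    have -> : (conj x - x) * (conj x + x - b%:A) =
       conj x * conj x - x * x - b%:A * (conj x - x) by ring.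
    rewrite e xx -(mulr_algl b x) -(mulr_algl b (conj x)); move: (b%:A) (c%:A) (conj x) => B C X.
    by ring.
  move/eqP; rewrite mulf_eq0 subr_eq0 (negPf cx) /= subr_eq0 => /eqP <-.
  by rewrite addrK.
have cxx : conj (conj x) = x by rewrite cxE rmorphB /= conj_alg cxE subKr.
by move=> y; have [a [d ->]] := gen y; rewrite !rmorphD /= !conj_alg !linearZ /= cxx.
Qed.

Lemma conj_fixed y : conj y = y -> exists a : k, y = a%:A.
Proof.
have [x [cx gen]] := quadratic_generator.
have [a [b ->]] := gen y; rewrite rmorphD /= conj_alg linearZ /= => /addrI/eqP.
rewrite -subr_eq0 -scalerBr scaler_eq0 subr_eq0 (negPf cx) orbF => /eqP ->.
by exists a; rewrite scale0r addr0.
Qed.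

Lemma trc_in y : exists a : k, trc conj y = a%:A.
Proof. by apply: conj_fixed; rewrite /trc rmorphD /= conjK addrC. Qed.

Lemma nrm_in y : exists a : k, nrm conj y = a%:A.
Proof. by apply: conj_fixed; rewrite /nrm rmorphM /= conjK mulrC. Qed.

Lemma integral_closure_conj (A : set k) y :
  integral_closure A y -> integral_closure A (conj y).
Proof.
move=> [p [mp hp rp]]; exists p; split=> //.
have -> : map_poly (in_alg L) p = map_poly conj (map_poly (in_alg L) p).
  by rewrite -map_poly_comp; apply: eq_map_poly => a /=; rewrite conj_alg.
by rewrite fmorph_root.
Qed.

Lemma integral_closure_quadratic (S : subringClosed k) y a b :
  trc conj y = a%:A -> nrm conj y = b%:A -> a \in S -> b \in S ->
  integral_closure [set x | x \in S] y.
Proof.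
move=> ty ny aS bS.
apply: (@integral_closure_root _ S L (('X - y%:P) * ('X - (conj y)%:P))).
- by rewrite monicMl ?monicXsubC.
- by rewrite rootM root_XsubC eqxx.
have -> : ('X - y%:P) * ('X - (conj y)%:P) =
    'X^2 + (- a)%:A%:P * 'X + b%:A%:P.
  rewrite -ny scaleNr -ty /trc /nrm !(rmorphN, rmorphD, rmorphM) /=.
  by move: (y%:P) ((conj y)%:P) => Y Z; ring.
move=> i; rewrite !coefD coefXn coefMX coefC coefC.
apply: integral_closureD; [apply: integral_closureD|].
- by case: eqP => _; [exact: integral_closure1|exact: integral_closure0].
- case: i => [|[|i]] /=; try exact: integral_closure0.
  by apply: integral_closure_in; rewrite rpredN.
- by case: i => [|i] /=; [exact: integral_closure_in|exact: integral_closure0].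
Qed.
End Quadratic.

(** * Denominators, trace zero elements and units of B *)

Section Arithmetic.
Variables (F k : fieldType) (iota : {rmorphism F -> k}).
Hypothesis curve_C : is_function_field iota.
Variables (L : fieldExtType k) (conj : {lrmorphism L -> L}).
Hypothesis quadratic_L : \dim {:L} = 2%N.
Hypothesis conj_nontrivial : exists x, conj x != x.
Variable P : place iota.
Let iotaL : {rmorphism F -> L} := in_alg L \o iota.
Let B : set L := integral_closure (regular_outside P).

Let conjKL := conjK quadratic_L conj_nontrivial.

Lemma integers_scale (a : k) (x : L) : regular_outside P a -> B x -> B (a *: x).
Proof.
rewrite /B regular_outsideE => Aa Bx; rewrite -mulr_algl.
by apply: integral_closureM => //; exact: integral_closure_in.
Qed.

Lemma integers_conj x : B x -> B (conj x).
Proof. exact: integral_closure_conj. Qed.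

Lemma integers_denominators (a : k) (I : finType) (w : I -> L) :
  ~ algebraicOver iota a -> regular_outside P a ->
  exists2 c : {poly F}, c != 0 & forall i, B (pev iota a c *: w i).
Proof.
move=> a_tr Aa.
have one y : exists c : {poly F}, c != 0 /\ B (pev iota a c *: y).
  have [t ty] := trc_in quadratic_L conj_nontrivial y.
  have [n ny] := nrm_in quadratic_L conj_nontrivial y.
  have [c1 c10 h1] := clear_denominator curve_C a_tr t Aa.
  have [c2 c20 h2] := clear_denominator curve_C a_tr n Aa.
  exists (c1 * c2); split; first by rewrite mulf_neq0.
  rewrite /B regular_outsideE; apply: (@integral_closure_quadratic _ _ conj (regular_pred P) _
     (pev iota a c2 * (pev iota a c1 * t))
     (pev iota a (c1 * c1 * c2) * (pev iota a c2 * n))).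
  - by rewrite /trc linearZ -scalerDr -/(trc conj y) ty scalerA rmorphM /=; congr (_ *: _); ring.
  - rewrite /nrm linearZ -scalerAl -scalerAr -/(nrm conj y) ny !scalerA !rmorphM /=.
    by congr (_ *: _); ring.
  - by apply/asboolP; apply: regularM => //; exact: regular_pev.
  - by apply/asboolP; apply: regularM => //; exact: regular_pev.
have /choice[c hc] := fun i => one (w i).
exists (\prod_i c i); first by apply/prodf_neq0 => i _; have [] := hc i.
move=> i; rewrite (bigD1 i) //= mulrC rmorphM -scalerA.
by apply: integers_scale; [exact: regular_pev|have [] := hc i].
Qed.

(* v n = a^n c (x - conj x), where the only pole of a is P and c in F[a] is a  *)
(* common denominator of the w i (x - conj x).                                 *)
Lemma infinitely_many_trace_zero (I : finType) (w : I -> L) :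
  exists v : nat -> L, [/\ injective v, forall n, trc conj (v n) = 0 &
    forall n i, B (v n * w i)].
Proof.
have [a [a0 Pa Aa]] := pole_only_at curve_C P.
have a_tr : ~ algebraicOver iota a by apply: (ord_transcendental curve_C a0 (P := P)); rewrite lt_eqF.
have [x cx] := conj_nontrivial; pose dl := x - conj x.
have dl0 : dl != 0 by rewrite subr_eq0 eq_sym.
have cdl : conj dl = - dl by rewrite /dl rmorphB /= conjKL opprB.
have [c c0 hc] := integers_denominators (fun i => dl * w i) a_tr Aa.
exists (fun n => (a ^+ n * pev iota a c) *: dl); split.
- move=> n m /eqP; rewrite -subr_eq0 -scalerBl scaler_eq0 (negPf dl0) orbF.
  rewrite -mulrBl mulf_eq0 (negPf (pev_transcendental a_tr c0)) orbF subr_eq0 => /eqP.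
  move=> /(congr1 P); rewrite !ordX // => /mulrIn; apply.
  by rewrite lt_eqF.
- by move=> n; rewrite /trc linearZ /= cdl scalerN subrr.
- move=> n i; rewrite -scalerAl -scalerA; apply: integers_scale => //.
  by rewrite -(pevX iota a) -rmorphXn; exact: regular_pev.
Qed.

Hypothesis closed_L : algebraically_closed_in iotaL.
Variables (Q : place iotaL) (e : nat).
Hypothesis Q_over_P : lies_over Q P e.
Hypothesis Q_unique : forall (Q' : place iotaL) (e' : nat),
  lies_over Q' P e' -> same_place Q' Q.

(** Q composed with the conjugation is again a place above P, so uniqueness identifies it with Q. *)
Lemma ord_conj x : x != 0 -> Q (conj x) = Q x.
Proof.
have conj0 y : (conj y == 0) = (y == 0) by exact: fmorph_eq0.
have oM x1 y : x1 != 0 -> y != 0 -> Q (conj (x1 * y)) = Q (conj x1) + Q (conj y).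
  by move=> x0 y0; rewrite rmorphM ordM ?conj0.
have oD x1 y : x1 != 0 -> y != 0 -> x1 + y != 0 ->
    Num.min (Q (conj x1)) (Q (conj y)) <= Q (conj (x1 + y)).
  by move=> x0 y0 xy0; rewrite rmorphD ordD ?conj0 // -rmorphD conj0.
have oC (a : F) : a != 0 -> Q (conj (iotaL a)) = 0.
  by move=> a0; rewrite /= conj_alg; exact: (ord_const Q a0).
have oS : exists2 y, y != 0 & Q (conj y) = 1.
  by have [y y0 Qy] := ord_surj Q; exists (conj y); rewrite ?conj0 // conjKL.
have [e0 he] := Q_over_P.
have := @Q_unique (Place oM oD oC oS) e; apply.
by split=> // a a0; rewrite /= conj_alg he.
Qed.

(* The norm of a unit of B is a unit of A, hence a constant since its divisor *)
(* is supported at P; its trace is then regular at P as well, hence constant. *)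
Lemma integer_units_constant x : x != 0 -> B x -> B x^-1 ->
  exists a : F, x = iotaL a.
Proof.
move=> x0 Bx Bxi.
have BM y z : B y -> B z -> B (y * z).
  by rewrite /B regular_outsideE; exact: integral_closureM.
have BD y z : B y -> B z -> B (y + z).
  by rewrite /B regular_outsideE; exact: integral_closureD.
have norm_reg y : B y -> exists2 n, regular_outside P n & nrm conj y = n%:A.
  move=> By; have [n ny] := nrm_in quadratic_L conj_nontrivial y.
  exists n => //; apply: (@regular_integral _ _ _ _ L); rewrite -ny.
  by apply: BM => //; exact: integers_conj.
have everywhere a : regular_outside P a -> vge P 0 a -> exists b, a = iota b.
  move=> Aa Pa; apply: (no_pole_constant curve_C) => P'.
  have [s|ns] := pselect (same_place P' P); last exact: Aa.
  have [->|a0] := eqVneq a 0; first by left.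
  by right; rewrite s //; exact: vge_neq0 Pa a0.
have [n An nx] := norm_reg _ Bx; have [m Am mx] := norm_reg _ Bxi.
have nm : n * m = 1.
  apply: (fmorph_inj (in_alg L)); rewrite rmorph1 rmorphM /= -nx -mx.
  rewrite /nrm fmorphV /=; have : conj x != 0 by rewrite fmorph_eq0.
  by move: (conj x) => y y0; field; rewrite x0 y0.
have n0 : n != 0 by apply/eqP => e0; move/eqP: nm; rewrite e0 mul0r eq_sym oner_eq0.
have m0 : m != 0 by apply/eqP => e0; move/eqP: nm; rewrite e0 mulr0 eq_sym oner_eq0.
(* One of n and m = 1/n has nonnegative order at P, hence has no pole at all. *)
have [c nc] : exists c, n = iota c.
  have [le0|lt0] := leP 0 (P n); first by apply: everywhere => //; right.
  have [b mb] : exists b, m = iota b.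
    apply: everywhere => //; right.
    by have := congr1 P nm; rewrite ordM // ord1; lia.
  by exists b^-1; rewrite fmorphV -mb -[LHS](mulfK m0) nm mul1r.
have [e0 he] := Q_over_P.
(* x and conj x have the same order, and their product is a constant. *)
have Qx : Q x = 0.
  have c0 : c != 0 by rewrite -(fmorph_eq0 iota) -nc.
  have := congr1 Q nx; rewrite /nrm ordM ?fmorph_eq0 // ord_conj //.
  by rewrite he // nc ord_const // mulr0; lia.
have [a tx] := trc_in quadratic_L conj_nontrivial x.
have Aa : regular_outside P a.
  by apply: (@regular_integral _ _ _ _ L); rewrite -tx; apply: BD => //; exact: integers_conj.
have [b ab] : exists b, a = iota b.
  apply: everywhere => //; have [->|a0] := eqVneq a 0; first by left.
  right; have : vge Q 0 (trc conj x).
    by apply: vgeD; right; rewrite ?ord_conj // Qx.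
  rewrite tx => /vge_neq0; rewrite he // scaler_eq0 oner_eq0 orbF a0 => /(_ isT).
  by rewrite pmulr_rge0 // ltz_nat.
apply: closed_L; exists ('X^2 - b%:P * 'X + c%:P).
  apply/eqP => /(congr1 (fun p : {poly F} => p`_2)).
  rewrite coefD coefB coefXn coefCM coefX coefC coef0 /= mulr0 subr0 addr0.
  by move/eqP; rewrite oner_eq0.
rewrite rmorphD rmorphB /= map_polyXn rmorphM /= map_polyX !map_polyC /=.
apply/rootP; rewrite !(hornerD, hornerN, hornerM, hornerXn, hornerX, hornerC).
rewrite -ab -nc -tx -nx /trc /nrm; move: (conj x) => y; ring.
Qed.
End Arithmetic.

(** * The special unitary group *)

Notation o0 := (Ordinal (isT : 0 < 3)%N).
Notation o1 := (Ordinal (isT : 1 < 3)%N).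
Notation o2 := (Ordinal (isT : 2 < 3)%N).

Notation M3 a b c d e f g h i :=
  (mx3 [:: [:: a; b; c]; [:: d; e; f]; [:: g; h; i]]).

Lemma ord3P (P : 'I_3 -> Prop) : P o0 -> P o1 -> P o2 -> forall i, P i.
Proof. by move=> p0 p1 p2 [[|[|[|//]]] h]; rewrite (bool_irrelevance h isT). Qed.

Lemma sum_ord3 (V : nmodType) (f : 'I_3 -> V) : \sum_i f i = f o0 + f o1 + f o2.
Proof.
rewrite !big_ord_recl big_ord0 addr0 addrA.
by congr (f _ + f _ + f _); apply: val_inj.
Qed.

Lemma rev_ord3 : (rev_ord o0 = o2) * (rev_ord o1 = o1) * (rev_ord o2 = o0).
Proof. by do !split; apply: val_inj. Qed.

Section Matrices3.
Variable L : fieldType.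
Implicit Types g h : 'M[L]_3.

Lemma mx3_eta g : g = M3 (g o0 o0) (g o0 o1) (g o0 o2) (g o1 o0) (g o1 o1)
  (g o1 o2) (g o2 o0) (g o2 o1) (g o2 o2).
Proof. by apply/matrixP; apply: ord3P; apply: ord3P; rewrite mxE. Qed.

Lemma mx3_mul (a b c d e f g h i a' b' c' d' e' f' g' h' i' : L) :
  M3 a b c d e f g h i * M3 a' b' c' d' e' f' g' h' i' =
  M3 (a * a' + b * d' + c * g') (a * b' + b * e' + c * h') (a * c' + b * f' + c * i')
     (d * a' + e * d' + f * g') (d * b' + e * e' + f * h') (d * c' + e * f' + f * i')
     (g * a' + h * d' + i * g') (g * b' + h * e' + i * h') (g * c' + h * f' + i * i').
Proof.
by apply/matrixP; apply: ord3P; apply: ord3P; rewrite mxE sum_ord3 !mxE.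
Qed.

Lemma mx3_1 : 1 = M3 1 0 0 0 1 0 0 0 1 :> 'M[L]_3.
Proof. by apply/matrixP; apply: ord3P; apply: ord3P; rewrite !mxE. Qed.

Lemma mx3_tr (a b c d e f g h i : L) : \tr (M3 a b c d e f g h i) = a + e + i.
Proof. by rewrite /mxtrace sum_ord3 !mxE. Qed.

Lemma mx3_det (a b c d e f g h i : L) : \det (M3 a b c d e f g h i) =
  a * (e * i - f * h) - b * (d * i - f * g) + c * (d * h - e * g).
Proof.
have det2 (A : 'M[L]_2) : \det A = A ord0 ord0 * A ord_max ord_max -
    A ord0 ord_max * A ord_max ord0.
  rewrite (expand_det_row _ ord0) !big_ord_recl big_ord0 /cofactor !det_mx11 !mxE.
  rewrite addr0 /= !addn0 expr0 expr1 mul1r mulN1r mulrN.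
  by congr (A _ _ * A _ _ - A _ _ * A _ _); apply: val_inj.
rewrite (expand_det_row _ o0) sum_ord3 /cofactor !det2 !mxE /=.
by rewrite /bump /= expr0 expr1; ring.
Qed.
End Matrices3.

Section Unitary.
Variables (L : fieldType) (conj : {rmorphism L -> L}).
Hypothesis conjK : involutive conj.
Implicit Types (g h b w : 'M[L]_3) (z : L * L) (t u v : L).

(** The adjoint for the hermitian form: the conjugate transpose, conjugated by the antidiagonal
    permutation matrix. *)
Definition star g : 'M[L]_3 := \matrix_(i, l) conj (g (rev_ord l) (rev_ord i)).

Lemma star_mx3 (a b c d e f g h i : L) : star (M3 a b c d e f g h i) =
  M3 (conj i) (conj f) (conj c) (conj h) (conj e) (conj b) (conj g) (conj d) (conj a).
Proof. by apply/matrixP; apply: ord3P; apply: ord3P; rewrite !mxE. Qed.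

Lemma starM g h : star (g * h) = star h * star g.
Proof.
apply/matrixP => i l; rewrite !mxE rmorph_sum (reindex_inj rev_ord_inj).
by apply: eq_bigr => m _; rewrite !mxE rmorphM mulrC.
Qed.

Lemma starK : involutive star.
Proof. by move=> g; apply/matrixP => i l; rewrite !mxE conjK !rev_ordK. Qed.

Let bra (y : 'cV[L]_3) : 'rV[L]_3 := \row_i conj (y (rev_ord i) 0).

Let hermE (x y : 'cV[L]_3) : herm conj x y = (bra y *m x) 0 0.
Proof. by rewrite mxE; apply: eq_bigr => i _; rewrite mxE mulrC. Qed.

Let braM g (y : 'cV[L]_3) : bra (g *m y) = bra y *m star g.
Proof.
apply/rowP => i; rewrite !mxE rmorph_sum (reindex_inj rev_ord_inj).
by apply: eq_bigr => m _; rewrite !mxE rmorphM mulrC.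
Qed.

Lemma SUP g : SU conj g <-> \det g = 1 /\ star g * g = 1.
Proof.
split=> -[dg hg]; split=> //; last first.
  by move=> x y; rewrite !hermE braM -mulmxA [star g *m _]mulmxA mulmxE hg mul1mx.
apply/matrixP => i l.
have := hg (delta_mx l 0) (delta_mx (rev_ord i) 0); rewrite !hermE braM.
have -> : bra (delta_mx (rev_ord i) 0) = delta_mx 0 i.
  apply/rowP => m; rewrite !mxE eqxx andbT (inj_eq rev_ord_inj) eq_sym.
  by case: eqP; rewrite ?rmorph1 ?rmorph0.
rewrite mulmxA -[X in X *m _]mulmxA mulmxE; move: (star g * g) => M.
by rewrite -colE -!rowE !mxE !eqxx /= andbT.
Qed.

Lemma SU_star g : SU conj g -> star g * g = 1.
Proof. by case/SUP. Qed.

Lemma SU_unit g : SU conj g -> g \is a GRing.unit.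
Proof. by case=> dg _; rewrite unitmxE dg unitr1. Qed.

Lemma SU_inv g : SU conj g -> g^-1 = star g.
Proof.
by move=> sg; apply: (mulIr (SU_unit sg)); rewrite mulVr ?SU_star // SU_unit.
Qed.

Lemma SU_subgroup : is_subgroup (SU conj).
Proof.
split.
- by apply/SUP; rewrite det1 mx3_1 star_mx3 !rmorph0 !rmorph1 -mx3_1 mulr1.
- exact: SU_unit.
- move=> g h /SUP[dg sg] /SUP[dh sh]; apply/SUP; rewrite det_mulmx dg dh mulr1.
  by rewrite starM mulrA -(mulrA (star h)) sg mulr1 sh.
- move=> g sg; have ug := SU_unit sg; have [dg _] := sg; apply/SUP; split.
    by rewrite det_inv dg invr1.
  by rewrite (SU_inv sg) starK -(SU_inv sg) mulrV.
Qed.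

Lemma SU1 : SU conj 1. Proof. by have [] := SU_subgroup. Qed.
Lemma SUM g h : SU conj g -> SU conj h -> SU conj (g * h).
Proof. by have [_ _ m _] := SU_subgroup; exact: m. Qed.
Lemma SUV g : SU conj g -> SU conj g^-1.
Proof. by have [_ _ _ m] := SU_subgroup; exact: m. Qed.

Let conj0 t : (conj t == 0) = (t == 0). Proof. exact: fmorph_eq0. Qed.

Let simp := (rmorph0 conj, rmorph1 conj, rmorphN conj, conjK, fmorphV conj,
             rmorphM conj, rmorphD conj).

Lemma SU_s : SU conj (s_mx L).
Proof.
apply/SUP; rewrite /s_mx star_mx3 mx3_det mx3_mul mx3_1 !simp.
by split; [ring|congr mx3; repeat congr cons; ring].
Qed.

Lemma s_mx_sq : s_mx L * s_mx L = 1.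
Proof. by rewrite /s_mx mx3_mul mx3_1; congr mx3; repeat congr cons; ring. Qed.

Lemma s_mxV : (s_mx L)^-1 = s_mx L.
Proof.
by apply: (mulIr (SU_unit SU_s)); rewrite s_mx_sq mulVr // (SU_unit SU_s).
Qed.

Lemma SU_u z : Hset conj z -> SU conj (u_a conj z).
Proof.
rewrite /Hset /= /nrm /trc => hz; apply/SUP.
rewrite /u_a star_mx3 mx3_det mx3_mul mx3_1 !simp; split; first by ring.
move/eqP: hz; rewrite addrC addr_eq0 addrC => /eqP hz.
by congr mx3; repeat congr cons; try ring; rewrite -[RHS](subrr (z.1 * conj z.1)) -hz; ring.
Qed.

Lemma SU_a t : t != 0 -> SU conj (a_tilde conj t).
Proof.
move=> t0; have ct0 : conj t != 0 by rewrite conj0.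
apply/SUP; rewrite /a_tilde star_mx3 mx3_det mx3_mul mx3_1 !simp.
by split; [|congr mx3; repeat congr cons]; field; rewrite ?t0 ?ct0.
Qed.

Lemma Hset0 : Hset conj (0, 0).
Proof. by rewrite /Hset /= /nrm /trc mul0r rmorph0 !addr0. Qed.

Lemma u_a0 : u_a conj (0, 0) = 1.
Proof. by rewrite /u_a /= rmorph0 oppr0 -mx3_1. Qed.

Lemma u_aM z z' : u_a conj z * u_a conj z' =
  u_a conj (z.1 + z'.1, z.2 + z'.2 - conj z.1 * z'.1).
Proof. by rewrite /u_a mx3_mul /= rmorphD; congr mx3; repeat congr cons; ring. Qed.

Lemma HsetM z z' : Hset conj z -> Hset conj z' ->
  Hset conj (z.1 + z'.1, z.2 + z'.2 - conj z.1 * z'.1).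
Proof.
rewrite /Hset /= /nrm /trc !simp => h h'.
by rewrite -[RHS](addr0 0) -{1}h -h'; ring.
Qed.

Lemma HsetV z : Hset conj z -> Hset conj (- z.1, conj z.2).
Proof. by rewrite /Hset /= /nrm /trc !simp => <-; ring. Qed.

Lemma u_aV z : Hset conj z -> (u_a conj z)^-1 = u_a conj (- z.1, conj z.2).
Proof.
move=> hz; apply: (mulIr (SU_unit (SU_u hz))); rewrite mulVr; last exact/SU_unit/SU_u.
rewrite u_aM -u_a0 /= addNr; congr (u_a _ (_, _)).
by rewrite -hz /nrm /trc rmorphN; ring.
Qed.

Lemma U_a_subgroup : is_subgroup (U_a conj).
Proof.
split.
- by exists (0, 0); [exact: Hset0|exact: u_a0].
- by move=> _ [z hz <-]; exact/SU_unit/SU_u.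
- by move=> _ _ [z hz <-] [z' hz' <-]; rewrite u_aM; apply: imageP; exact: HsetM.
- by move=> _ [z hz <-]; rewrite u_aV //; apply: imageP; exact: HsetV.
Qed.

Lemma SU_mx3 g (a b c d e f p h i : L) : SU conj g -> g = M3 a b c d e f p h i ->
  [/\ conj p * a + conj d * d + conj a * p = 0,
      conj h * a + conj e * d + conj b * p = 0,
      conj i * a + conj f * d + conj c * p = 1,
      conj h * b + conj e * e + conj b * h = 1 &
      conj i * b + conj f * e + conj c * h = 0 ] /\
      conj i * c + conj f * f + conj c * i = 0.
Proof.
move=> /SU_star + ge; rewrite ge star_mx3 mx3_mul mx3_1 => /matrixP E.
have := (E o0 o0, E o0 o1, E o0 o2, E o1 o0, E o1 o1, E o2 o0).
by rewrite !mxE /= => -[[[[[]]]]] *; do !split.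
Qed.

(** The first column is isotropic, so its middle entry vanishes with the last one. Orthogonality of
    the first two columns then kills [g o2 o1]. *)
Lemma SU_lower_left0 g : SU conj g -> g o2 o0 = 0 -> borel conj g.
Proof.
move=> sg g20; have [[e1 e2 e3 _ _] _] := SU_mx3 sg (mx3_eta g).
move: e1 e2 e3; rewrite g20 rmorph0 mul0r mulr0 add0r addr0 => /eqP.
rewrite mulf_eq0 conj0 orbb => /eqP g10.
rewrite g10 !mulr0 !addr0 => /eqP; rewrite mulf_eq0 conj0 => /orP[/eqP g21 _|/eqP -> ].
  split=> //; apply: ord3P; apply: ord3P => //.
by rewrite mulr0 => /eqP; rewrite eq_sym oner_eq0.
Qed.

Lemma borel_decomposition b : borel conj b -> exists t z,
  [/\ t != 0, Hset conj z, b = u_a conj z * a_tilde conj t,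
      b o0 o0 = t & b o2 o2 = (conj t)^-1].
Proof.
move=> [sb lb].
have b10 : b o1 o0 = 0 by exact: lb.
have b20 : b o2 o0 = 0 by exact: lb.
have b21 : b o2 o1 = 0 by exact: lb.
have := mx3_eta b; rewrite b10 b20 b21.
set t := b o0 o0; set x := b o0 o1; set y := b o0 o2; set d := b o1 o1.
set f := b o1 o2; set i := b o2 o2 => eb.
have := sb.1; rewrite eb mx3_det => det1.
have [[_ _ e3 e4 e5] e6] := SU_mx3 sb eb.
have {}e3 : conj i * t = 1 by rewrite -e3; ring.
have t0 : t != 0 by apply/eqP => h; move/eqP: e3; rewrite h mulr0 eq_sym oner_eq0.
have ct0 : conj t != 0 by rewrite conj0.
have iE : i = (conj t)^-1.
  apply: (mulIf ct0); rewrite mulVf // -(rmorph1 conj) -e3 rmorphM conjK //.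
have dE : d = conj t / t.
  have h : t * d * i = 1 by rewrite -det1; ring.
  have td : t * d = conj t by rewrite -[LHS]mulr1 -(mulVf ct0) -iE mulrA h mul1r.
  by rewrite -td mulrAC divff ?mul1r.
have xE : x = - (t * conj f * d).
  have h : conj i * x + conj f * d = 0 by rewrite -e5; ring.
  by move/eqP: h; rewrite addr_eq0 => /eqP h; rewrite -[LHS]mul1r -e3 -mulrA [t * x]mulrC mulrA h; ring.
exists t, (f * conj t, y * conj t); split=> //.
  have h : conj t * t * (conj i * y + conj f * f + conj y * i) = 0 by rewrite e6 mulr0.
  rewrite /Hset /= /nrm /trc !simp -h.
  have -> : conj t * t * (conj i * y + conj f * f + conj y * i) =
     (conj i * t) * (y * conj t) + conj t * t * (conj f * f) + conj y * t * (i * conj t) by ring.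
  by rewrite e3 iE mulVf //; ring.
rewrite /u_a /a_tilde mx3_mul /= xE dE iE !simp.
by congr mx3; repeat congr cons; field; rewrite ?t0 ?ct0.
Qed.

Lemma borelP b : borel conj b <-> SU conj b /\ b o2 o0 = 0.
Proof.
by split=> [[sb lb]|[]]; [split=> //; exact: lb|exact: SU_lower_left0].
Qed.

Lemma borel_entries b b' : borel conj b -> borel conj b' ->
  (b * b') o0 o0 = b o0 o0 * b' o0 o0 /\ (b * b') o2 o2 = b o2 o2 * b' o2 o2.
Proof.
move=> [_ lb] [_ lb']; rewrite !mxE !sum_ord3.
rewrite (lb' o1 o0) // (lb' o2 o0) // (lb o2 o0) // (lb o2 o1) //.
by split; ring.
Qed.

Lemma borel_subgroup : is_subgroup (borel conj).
Proof.
split.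
- by apply/borelP; split; [exact: SU1|rewrite mxE].
- by move=> b [/SU_unit].
- move=> b b' hb hb'; apply/borelP; split; first by apply: SUM; [case: hb|case: hb'].
  have [_ l] := hb; have [_ l'] := hb'.
  by rewrite mxE sum_ord3 (l o2 o0) // (l o2 o1) // (l' o2 o0) //; ring.
- move=> b hb; have [sb lb] := hb; apply/borelP; split; first exact: SUV.
  rewrite SU_inv // mxE.
  by rewrite !rev_ord3 lb ?rmorph0.
Qed.

Lemma U_aP b : U_a conj b <-> borel conj b /\ b o0 o0 = 1.
Proof.
split=> [[z hz <-]|[bb b00]].
  by rewrite mxE; split=> //; apply/borelP; rewrite mxE; split=> //; exact: SU_u.
have [t [z [t0 hz eb bt _]]] := borel_decomposition bb.
exists z => //; rewrite eb -bt b00.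
have -> : a_tilde conj 1 = 1 by rewrite /a_tilde rmorph1 invr1 mulr1 -mx3_1.
by rewrite mulr1.
Qed.

Lemma U_aP2 b : U_a conj b <-> borel conj b /\ b o2 o2 = 1.
Proof.
rewrite U_aP; split=> -[bb e]; split=> //; have [t [z [t0 hz _ b0 b2]]] := borel_decomposition bb.
  by rewrite b2 -b0 e rmorph1 invr1.
by rewrite b0 -[t]conjK -[conj t]invrK -b2 e invr1 rmorph1.
Qed.

Lemma U_a_conj b (u : 'M[L]_3) : borel conj b -> U_a conj u -> U_a conj (b * u * b^-1).
Proof.
move=> bb /U_aP[bu u0]; have [_ ub bM bV] := borel_subgroup.
apply/U_aP; split; first exact: (bM _ _ (bM _ _ bb bu) (bV _ bb)).
have [-> _] := borel_entries (bM _ _ bb bu) (bV _ bb).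
have [-> _] := borel_entries bb bu; rewrite u0 mulr1.
have [<- _] := borel_entries bb (bV _ bb); rewrite mulrV ?mxE //.
exact: ub.
Qed.

Lemma U_a_unipotent (u : 'M[L]_3) : U_a conj u -> unipotent u.
Proof.
move=> [z hz <-]; exists 3%N; rewrite !exprS expr0 mulr1.
have -> : u_a conj z - 1 = M3 0 (- conj z.1) z.2 0 0 z.1 0 0 0.
  by rewrite mx3_1; apply/matrixP; apply: ord3P; apply: ord3P; rewrite !mxE /=; ring.
rewrite !mx3_mul; apply/matrixP; apply: ord3P; apply: ord3P; rewrite !mxE /=; ring.
Qed.

(** Nilpotency of b - 1 makes the first diagonal entry 1, and this entry determines the torus
    part. *)
Lemma borel_unipotent b : borel conj b -> unipotent b -> U_a conj b.
Proof.
move=> bb [n hn]; apply/U_aP; split=> //.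
have e m : ((b - 1) ^+ m) o0 o0 = (b o0 o0 - 1) ^+ m /\
    ((b - 1) ^+ m) o1 o0 = 0 /\ ((b - 1) ^+ m) o2 o0 = 0.
  have [_ l] := bb; elim: m => [|m [h1 [h2 h3]]]; first by rewrite !expr0 !mxE.
  rewrite !exprS !mxE !sum_ord3 !mxE /= h1 h2 h3 (l o1 o0) // (l o2 o0) //.
  by do !split; ring.
have [+ _] := e n; rewrite hn mxE => /esym/eqP.
by rewrite expf_eq0 subr_eq0 => /andP[_ /eqP].
Qed.

End Unitary.

(** * Cusps of unipotent elements *)

Section UnipotentElements.
Variables (L : fieldType) (conj : {rmorphism L -> L}).
Hypothesis conjK : involutive conj.
Implicit Types (g h b w : 'M[L]_3).

Let conj0 (t : L) : (conj t == 0) = (t == 0). Proof. exact: fmorph_eq0. Qed.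

Lemma SU_g_of z : Hinf conj z -> SU conj (g_of conj z).
Proof.
case: z => [z|] /= hz; last exact: SU1.
by apply: (SUM conjK); [exact: SU_s|exact: SU_u].
Qed.

(** The cusp is infinity if the last coordinate of x vanishes. Otherwise (u, v) is solved from the
    vanishing of the last two coordinates of g_(u,v) x, and isotropy of x says that (u, v) is in
    H. *)
Lemma isotropic_in_cusp (x : 'cV[L]_3) : herm conj x x = 0 ->
  exists z, [/\ Hinf conj z, (g_of conj z *m x) o1 0 = 0 &
                (g_of conj z *m x) o2 0 = 0].
Proof.
rewrite /herm sum_ord3 !rev_ord3.
move=> hx; have [x2|x2] := eqVneq (x o2 0) 0.
  move: hx; rewrite x2 rmorph0 mulr0 mul0r add0r addr0 => /eqP.
  rewrite mulf_eq0 conj0 orbb => /eqP x1.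
  by exists None; rewrite /= mul1mx.
have cx2 : conj (x o2 0) != 0 by rewrite conj0.
have [u [uE cuE]] : exists u, u = - x o1 0 / x o2 0 /\
    conj u = - conj (x o1 0) / conj (x o2 0).
  by eexists; split; [reflexivity|rewrite rmorphM fmorphV rmorphN].
pose v := (- x o0 0 + conj u * x o1 0) / x o2 0.
have cvE : conj v = (- conj (x o0 0) + u * conj (x o1 0)) / conj (x o2 0).
  by rewrite /v rmorphM fmorphV rmorphD rmorphN rmorphM conjK.
exists (Some (u, v)); split.
- have nz : x o2 0 * conj (x o2 0) != 0 by rewrite mulf_neq0.
  apply: (mulfI nz); rewrite mulr0 /nrm /trc -[RHS]oppr0 -hx /= cvE /v cuE uE.
  by field; rewrite x2 cx2.
- rewrite /= /s_mx /u_a mx3_mul mxE sum_ord3 !mxE /= !mul0r uE.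
  by field.
- rewrite /= /s_mx /u_a mx3_mul mxE sum_ord3 !mxE /= /v.
  by field.
Qed.

(* If N = g - 1 and x is a nonzero value of the last nonvanishing power of N,  *)
(* then N x = 0 and x is in the image of N, so x is isotropic.                 *)
Lemma unipotent_in_cusp g : SU conj g -> unipotent g -> g <> 1 ->
  exists2 z, Hinf conj z & U_a conj (g_of conj z * g * (g_of conj z)^-1).
Proof.
move=> sg [n0 hn0] g1; pose N := g - 1.
have ex : exists n, N ^+ n == 0 by exists n0; apply/eqP.
case: (ex_minnP ex) => -[|[|m]] /eqP Nm min_m.
- by move/eqP: Nm; rewrite expr0 oner_eq0.
- by exfalso; apply: g1; apply/eqP; rewrite -subr_eq0 -/N -[N]expr1 Nm.
have Nm0 : N ^+ m.+1 != 0 by apply/eqP => /eqP/min_m; rewrite ltnn.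
have [l xl] : exists l, col l (N ^+ m.+1) != 0.
  apply: contrapT => h; move/eqP: Nm0; apply; apply/matrixP => i l.
  have [e|e] := eqVneq (col l (N ^+ m.+1)) 0; last by exfalso; apply: h; exists l.
  by have := congr1 (fun c : 'cV[L]_3 => c i 0) e; rewrite !mxE.
set x := col l _ in xl; pose y := col l (N ^+ m).
have xy : x = N *m y by rewrite /x /y !colE exprS -mulmxE mulmxA.
have gx : g *m x = x.
  have : N *m x = 0 by rewrite /x colE mulmxA mulmxE -exprS Nm mul0mx.
  by rewrite /N mulmxBl mul1mx => /eqP; rewrite subr_eq0 => /eqP.
(* With x = g y - y and g x = x, one gets h(x, x) = h(g y, g x) - h(y, x) = 0. *)
have iso : herm conj x x = 0.
  have hB (a c d : 'cV[L]_3) : herm conj (a - c) d = herm conj a d - herm conj c d.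
    by rewrite /herm -sumrB; apply: eq_bigr => i _; rewrite !mxE mulrBl.
  rewrite {1}xy /N mulmxBl mul1mx hB -{1}gx; case: sg => _ ->.
  exact: subrr.
have [z [hz z1 z2]] := isotropic_in_cusp iso.
exists z => //; set c := g_of conj z in z1 z2 *; have sc := SU_g_of hz.
have uc := SU_unit sc; rewrite -/c in sc uc.
have [b bD] : exists b, b = c * g * c^-1 by eexists.
have [w wE] : exists w : 'cV[L]_3, w = c *m x by eexists.
rewrite -wE in z1 z2.
have bw : b *m w = w.
  by rewrite bD wE mulmxA mulmxE mulrVK // -mulmxE -mulmxA gx.
have w0 : w o0 0 != 0.
  apply/eqP => w00; move/eqP: xl; apply.
  have -> : x = c^-1 *m w by rewrite wE mulmxA mulmxE mulVr // mul1mx.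
  have -> : w = 0 by apply/colP; apply: ord3P; rewrite ?w00 ?z1 ?z2 mxE.
  by rewrite mulmx0.
have bE i : b i o0 * w o0 0 = w i 0.
  by rewrite -[in RHS]bw mxE sum_ord3 z1 z2 !mulr0 !addr0.
have b20 : b o2 o0 = 0 by apply: (mulIf w0); rewrite bE z2 mul0r.
have b00 : b o0 o0 = 1 by apply: (mulIf w0); rewrite bE mul1r.
rewrite -bD; apply/(U_aP conjK); split=> //; apply/borelP => //; split=> //.
by rewrite bD; apply: (SUM conjK); [apply: (SUM conjK)|apply: (SUV conjK)].
Qed.

Lemma conj_trace c g : c \is a GRing.unit -> \tr (c * g * c^-1) = \tr g :> L.
Proof. by move=> uc; rewrite -mulmxE mxtrace_mulC mulmxE mulrA mulVr // mul1r. Qed.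

Lemma U_a_trace (u : 'M[L]_3) : U_a conj u -> \tr u = 3%:R.
Proof. by move=> [z _ <-]; rewrite mx3_tr; ring. Qed.

Lemma unipotent_trace g : SU conj g -> unipotent g -> \tr g = 3%:R.
Proof.
move=> sg ug; have [->|g1] := pselect (g = 1).
  by rewrite mx3_1 mx3_tr; ring.
have [z hz /U_a_trace] := unipotent_in_cusp sg ug g1.
by rewrite conj_trace //; exact/SU_unit/SU_g_of.
Qed.

(** The last row (p, q, r) of w is isotropic. The last row of s u_a(u, v) is (-1, conj u, -v), and z
    makes it proportional to (p, q, r). *)
Lemma bruhat w : SU conj w -> w o2 o0 != 0 ->
  exists b z, [/\ borel conj b, Hset conj z & w = b * s_mx L * u_a conj z].
Proof.
move=> sw p0.
have row : w o2 o0 * conj (w o2 o2) + w o2 o1 * conj (w o2 o1) +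
    w o2 o2 * conj (w o2 o0) = 0.
  have : w * star conj w = 1 by rewrite -SU_inv // mulrV //; exact: SU_unit sw.
  by move/matrixP/(_ o2 o0); rewrite !mxE sum_ord3 !mxE !rev_ord3.
set p := w o2 o0 in p0 row; set q := w o2 o1 in row; set r := w o2 o2 in row.
have cp0 : conj p != 0 by rewrite conj0.
pose z := (- conj (q / p), r / p).
have hz : Hset conj z.
  have nz : p * conj p != 0 by rewrite mulf_neq0.
  apply: (mulfI nz); rewrite mulr0 /nrm /trc -[RHS]row /= rmorphN conjK !(rmorphM, fmorphV) /=.
  by field; rewrite p0 cp0.
exists (w * (s_mx L * u_a conj z)^-1), z; split=> //; last first.
  by rewrite -mulrA mulrVK //; exact: (SU_unit (SUM conjK (SU_s conj) (SU_u conjK hz))).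
apply/borelP => //; split.
  by apply: (SUM conjK) => //; apply: (SUV conjK); apply: (SUM conjK); [exact: SU_s|exact: SU_u].
have us := SU_unit (SU_s conj); have uu := SU_unit (SU_u conjK hz).
rewrite invrM // (u_aV conjK hz) (s_mxV conj) /u_a /s_mx mx3_mul mxE sum_ord3 !mxE /=.
rewrite -/p -/q -/r -[RHS]oppr0 -[in RHS](mul0r (conj p)^-1) -[in RHS]row.
rewrite !mulr0 !add0r opprK !(rmorphM, fmorphV) /=.
by field; rewrite ?p0 ?cp0.
Qed.

Lemma u_a_trivial (z : L * L) : Hset conj z -> z.2 = 0 -> u_a conj z = 1.
Proof.
case: z => u v /= hz v0; move: hz; rewrite /Hset /= v0 /nrm /trc rmorph0 !addr0 => /eqP.
by rewrite mulf_eq0 conj0 orbb => /eqP ->; rewrite u_a0.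
Qed.

Lemma opposite_trace (z z' : L * L) : \tr (u_a conj z * u_ma conj z') =
  3%:R + (z.2 * z'.2 - conj z.1 * z'.1 - z.1 * conj z'.1).
Proof. by rewrite /u_ma /s_mx /u_a !mx3_mul mx3_tr; ring. Qed.

(** Otherwise the Bruhat decomposition moves g to u_a(u1, v1) and h to u_ma(u2, v2). By
    [opposite_trace] the two trace conditions add up to v1 T(v2) = 0. As g is nontrivial, v1 is
    nonzero; so T(v2) = 0, then N(u2) = 0, u2 = 0, and either condition gives v2 = 0, so h = 1. *)
Lemma same_cusp c c' g h : SU conj c -> SU conj c' ->
  U_a conj (c * g * c^-1) -> U_a conj (c' * h * c'^-1) -> g <> 1 -> h <> 1 ->
  \tr (g * h) = 3%:R -> \tr (g * h^-1) = 3%:R -> borel conj (c' * c^-1).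
Proof.
move=> sc sc' Ug Uh g1 h1 tr1 tr2.
have sw : SU conj (c' * c^-1) by apply: (SUM conjK) => //; exact: SUV.
have [w0|w0] := eqVneq ((c' * c^-1) o2 o0) 0; first exact: SU_lower_left0.
exfalso; have [b [z [bb hz wE]]] := bruhat sw w0.
have [_ _ UM UV] := U_a_subgroup conjK.
have uc := SU_unit sc; have uc' := SU_unit sc'.
have [_ /(_ _ bb) ub _ bV] := borel_subgroup conjK.
set u := u_a conj z in wE; have Uu : U_a conj u by exists z.
have uu : u \is a GRing.unit by exact: (SU_unit (SU_u conjK hz)).
have us := SU_unit (SU_s conj).
have [d dE] : exists d, d = u * c by eexists.
have ud : d \is a GRing.unit by rewrite dE unitrMl.
have c'E : c' = b * s_mx L * d by rewrite dE mulrA -wE mulrVK.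
have [z1 hz1 e1] : U_a conj (d * g * d^-1).
  have -> : d * g * d^-1 = u * (c * g * c^-1) * u^-1 by rewrite dE invrM // !mulrA.
  exact: UM _ _ (UM _ _ Uu Ug) (UV _ Uu).
have [z2 hz2 e2] : U_a conj (b^-1 * (c' * h * c'^-1) * b).
  by rewrite -{2}[b]invrK; apply: U_a_conj => //; exact: bV.
have hE : d * h * d^-1 = u_ma conj z2.
  have c'V : c'^-1 = d^-1 * (s_mx L * b^-1).
    by rewrite c'E !invrM ?unitrMl // (s_mxV conj).
  rewrite /u_ma e2 c'V c'E !mulrA !(mulrVK ub) (s_mx_sq L) mul1r.
  by rewrite -[RHS]mulrA (s_mx_sq L) mulr1.
have hVE : d * h^-1 * d^-1 = u_ma conj (- z2.1, conj z2.2).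
  have uh : h \is a GRing.unit.
    have [_ hu _ _] := U_a_subgroup conjK.
    by have := hu _ Uh; rewrite unitrMl ?unitrV // unitrMr.
  have -> : d * h^-1 * d^-1 = (d * h * d^-1)^-1.
    have udh : d * h \is a GRing.unit by rewrite unitrMl.
    have udV : d^-1 \is a GRing.unit by rewrite unitrV.
    by rewrite (invrM udh udV) (invrM ud uh) invrK mulrA.
  have u2 := SU_unit (SU_u conjK hz2).
  have su2 : s_mx L * u_a conj z2 \is a GRing.unit by rewrite unitrMl.
  by rewrite hE /u_ma -(u_aV conjK hz2) (invrM su2 us) (invrM us u2) (s_mxV conj) mulrA.
have trE (x y : 'M[L]_3) : \tr (d * x * d^-1 * (d * y * d^-1)) = \tr (x * y).
  rewrite -[RHS](conj_trace (x * y) ud); congr (\tr _).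
  by rewrite !mulrA (mulrVK ud).
move: tr1 tr2; rewrite -(trE g h) -(trE g h^-1) -e1 hE hVE !opposite_trace /= rmorphN.
rewrite -[X in _ + _ = X]addr0 => /addrI t1; rewrite -[X in _ + _ = X]addr0 => /addrI t2.
have v1 : z1.2 != 0.
  apply/eqP => v1; apply: g1; have := u_a_trivial hz1 v1; rewrite e1 => e.
  by rewrite -[g](mulKr ud) -[d * g](mulrVK ud) e mul1r mulVr.
have /eqP : z1.2 * trc conj z2.2 = 0.
  rewrite /trc -[RHS](addr0 0) -{1}t1 -t2; ring.
rewrite mulf_eq0 (negPf v1) /= => /eqP t0.
have /eqP : nrm conj z2.1 = 0 by rewrite -[RHS]hz2 t0 addr0.
rewrite mulf_eq0 conj0 orbb => /eqP u2.
move/eqP: t1; rewrite u2 rmorph0 !mulr0 !subr0 mulf_eq0 (negPf v1) /= => /eqP v2.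
apply: h1; have := u_a_trivial hz2 v2; rewrite e2 => e.
have {}e : c' * h * c'^-1 = 1.
  by rewrite -[LHS](mulVKr ub) -[b^-1 * _](mulrK ub) e mul1r mulrV.
by rewrite -[h](mulKr uc') -[c' * h](mulrVK uc') e mul1r mulVr.
Qed.
End UnipotentElements.

(** * The stabiliser of the end at infinity *)

Section BruhatTitsTree.
Variables (R : realType) (L : fieldType) (conj : {rmorphism L -> L}) (nu : L -> R).
Hypothesis conjK : involutive conj.
Hypothesis nuM : forall x y, x != 0 -> y != 0 -> nu (x * y) = nu x + nu y.
Hypothesis nuD : forall x y, x != 0 -> y != 0 -> x + y != 0 ->
  Num.min (nu x) (nu y) <= nu (x + y).
Hypothesis nu_conj : forall x, x != 0 -> nu (conj x) = nu x.
(** The generator of the value group of nu on L: nu is normalised on k, so this is the inverse of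
    the ramification index. *)
Variable eps : R.
Hypothesis eps_gt0 : 0 < eps.
Hypothesis nu_range : forall x, x != 0 -> exists m : int, nu x = m%:~R * eps.
Hypothesis nu_surj : forall m : int, exists2 x, x != 0 & nu x = m%:~R * eps.
Implicit Types (g h b n : 'M[L]_3) (x y r : R) (t : L).

(** The distance between consecutive vertices, since a(x) = 2 x runs through half the value
    group. *)
Let q : R := eps / 4.
Let q_gt0 : 0 < q. Proof. by rewrite divr_gt0. Qed.

Let conj0 t : (conj t == 0) = (t == 0). Proof. exact: fmorph_eq0. Qed.

Let nu1 : nu 1 = 0.
Proof.
have := nuM (oner_neq0 L) (oner_neq0 L); rewrite mulr1 => /eqP.
by rewrite eq_sym addrC -subr_eq0 addrK => /eqP.
Qed.

Let nuV t : t != 0 -> nu t^-1 = - nu t.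
Proof.
move=> t0; apply/eqP; rewrite -addr_eq0 -nuM ?invr_eq0 //.
by rewrite mulVf // nu1.
Qed.

Lemma apt_vertexP x : apt_vertex nu x <-> exists m : int, x = m%:~R * q.
Proof.
rewrite /apt_vertex /a_form /q; split=> [[t t0 e]|[m ->]].
  by have [m em] := nu_range t0; exists m; move: e; rewrite em; lra.
have [t t0 e] := nu_surj m; exists t => //; rewrite e; lra.
Qed.

Lemma consecutiveP x y : consecutive nu x y <->
  exists m : int, x = m%:~R * q /\ y = (m + 1)%:~R * q.
Proof.
split=> [[/apt_vertexP[m ->] /apt_vertexP[p ->]]|[m [-> ->]]].
  rewrite ltr_pM2r // ltr_int => mp nobetween; exists m; split=> //.
  congr (_%:~R * _); apply/eqP; rewrite eq_le -ltzD1 addrC.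
  have /nobetween : apt_vertex nu ((m + 1)%:~R * q) by apply/apt_vertexP; exists (m + 1).
  by rewrite !ltr_pM2r // !ltr_int => /negP; rewrite negb_and; lia.
split; [by apply/apt_vertexP; exists m|by apply/apt_vertexP; exists (m + 1)| |].
  by rewrite ltr_pM2r // ltr_int ltzD1.
move=> _ /apt_vertexP[p ->]; rewrite !ltr_pM2r // !ltr_int; lia.
Qed.

Lemma vertex_enumeration (s : nat -> R) : s 0%N = 0 ->
  (forall i, consecutive nu (s i) (s i.+1)) -> s = fun i => i%:R * q.
Proof.
move=> s0 hs; apply/funext; elim=> [|i IH]; first by rewrite s0 mul0r.
have /consecutiveP[m [e ->]] := hs i; rewrite IH in e.
have /eqP : i%:R = m%:~R :> R by apply: (mulIf (lt0r_neq0 q_gt0)).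
by rewrite -[i%:R]/(i%:Z%:~R) eqr_int => /eqP <-; rewrite -[i.+1%:R]/(i.+1%:Z%:~R) -addn1 PoszD.
Qed.

Lemma consecutive_nat i : consecutive nu (i%:R * q) (i.+1%:R * q).
Proof. by apply/consecutiveP; exists i%:Z; rewrite intrD natr1. Qed.

Lemma a_tilde1 : a_tilde conj 1 = 1.
Proof. by rewrite /a_tilde rmorph1 invr1 mulr1 -mx3_1. Qed.

Lemma a_tildeM t t' : t != 0 -> t' != 0 ->
  a_tilde conj t * a_tilde conj t' = a_tilde conj (t * t').
Proof.
move=> t0 t'0; have ct0 : conj t != 0 by rewrite conj0.
have ct'0 : conj t' != 0 by rewrite conj0.
rewrite /a_tilde mx3_mul rmorphM.
by congr mx3; repeat congr cons; field; rewrite ?t0 ?t'0 ?ct0 ?ct'0.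
Qed.

Lemma a_tildeV t : t != 0 -> (a_tilde conj t)^-1 = a_tilde conj t^-1.
Proof.
move=> t0; have u := SU_unit (SU_a conjK t0); apply: (mulIr u).
by rewrite mulVr // a_tildeM ?invr_eq0 // mulVf // a_tilde1.
Qed.

Lemma a_tilde_s t : t != 0 ->
  a_tilde conj t * s_mx L = s_mx L * a_tilde conj (conj t)^-1.
Proof.
move=> t0; have ct0 : conj t != 0 by rewrite conj0.
rewrite /a_tilde /s_mx !mx3_mul fmorphV conjK.
by congr mx3; repeat congr cons; field; rewrite ?t0 ?ct0 ?oner_eq0.
Qed.

Lemma a_tilde_u t (z : L * L) : t != 0 ->
  a_tilde conj t * u_a conj z * (a_tilde conj t)^-1 =
  u_a conj (conj t ^+ 2 / t * z.1, t * conj t * z.2).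
Proof.
move=> t0; have ct0 : conj t != 0 by rewrite conj0.
rewrite a_tildeV // /a_tilde /u_a !mx3_mul /= !(rmorphM, fmorphV, rmorphXn) conjK.
by congr mx3; repeat congr cons; field; rewrite ?t0 ?ct0 ?oner_eq0.
Qed.

Lemma N_actsP n x y : N_acts conj nu n x y -> exists2 t, t != 0 &
  (n = a_tilde conj t /\ y = x - nu t / 2) \/
  (n = s_mx L * a_tilde conj t /\ y = - (x - nu t / 2)).
Proof.
elim=> {n x y} [x|t x t0|n m x y z _ [t t0 ht] _ [t' t'0 ht']].
- by exists 1; rewrite ?oner_neq0 //; right; rewrite a_tilde1 mulr1 nu1; split=> //; lra.
- by exists t => //; left.
have ct'0 : conj t' != 0 by rewrite conj0.
have ss v : s_mx L * (s_mx L * v) = v by rewrite mulrA s_mx_sq mul1r.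
case: ht' => -[-> ->]; case: ht => -[-> ->].
- exists (t' * t); rewrite ?mulf_neq0 //; left; rewrite a_tildeM // nuM //; split=> //; lra.
- exists ((conj t')^-1 * t); rewrite ?mulf_neq0 ?invr_eq0 //; right.
  rewrite mulrA a_tilde_s // -mulrA a_tildeM ?invr_eq0 // nuM ?invr_eq0 // nuV // nu_conj //.
  by split=> //; lra.
- exists (t' * t); rewrite ?mulf_neq0 //; right; rewrite -mulrA a_tildeM // nuM //.
  by split=> //; lra.
- exists ((conj t')^-1 * t); rewrite ?mulf_neq0 ?invr_eq0 //; left.
  rewrite -mulrA [_ * (s_mx L * _)]mulrA a_tilde_s // -mulrA ss a_tildeM ?invr_eq0 //.
  by rewrite nuM ?invr_eq0 // nuV // nu_conj //; split=> //; lra.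
Qed.

Lemma N_acts_SU n x y : N_acts conj nu n x y -> SU conj n.
Proof.
move=> /N_actsP[t t0 [[-> _]|[-> _]]]; first exact: SU_a.
by apply: (SUM conjK); [exact: SU_s|exact: SU_a].
Qed.

Lemma N_acts1 x : N_acts conj nu 1 x x.
Proof.
rewrite -{1}a_tilde1 -{2}[x]subr0 -[0](mul0r 2^-1) -nu1.
exact/N_acts_a/oner_neq0.
Qed.

Lemma N_actsV n x y : N_acts conj nu n x y -> N_acts conj nu n^-1 y x.
Proof.
elim=> {n x y} [x|t x t0|n m x y z hn IHn hm IHm].
- by rewrite (s_mxV conj) -{2}[x]opprK; exact: N_acts_s.
- have e : x = x - nu t / 2 - nu t^-1 / 2 by rewrite nuV //; lra.
  by rewrite a_tildeV // {2}e; apply: N_acts_a; rewrite invr_eq0.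
- rewrite invrM; [exact: N_acts_mul IHm IHn| |].
    exact: SU_unit (N_acts_SU hm).
  exact: SU_unit (N_acts_SU hn).
Qed.

Lemma generated_subgroup (S : set 'M[L]_3) :
  (forall g, S g -> g \is a GRing.unit) -> is_subgroup (generated S).
Proof.
move=> uS; split.
- by move=> H [].
- move=> g hg; apply: (hg [set h | h \is a GRing.unit]); last exact: uS.
  split; [exact: unitr1|by []|move=> x y ux uy|by move=> x ux /=; rewrite unitrV].
  by rewrite /= unitrMl.
- by move=> g h hg hh H sH SH; have [_ _ hM _] := sH; apply: hM; [exact: hg|exact: hh].
- by move=> g hg H sH SH; have [_ _ _ hV] := sH; apply: hV; exact: hg.
Qed.

Lemma sub_generated (S : set 'M[L]_3) : S `<=` generated S.
Proof. by move=> g Sg H _; apply. Qed.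

Lemma generated_conj n (S S' : set 'M[L]_3) : n \is a GRing.unit ->
  (forall g, S g -> S' (n * g * n^-1)) ->
  forall g, generated S g -> generated S' (n * g * n^-1).
Proof.
move=> un hS g hg H [H1 Hu HM HV] SH.
have gu (a : 'M[L]_3) : H (n * a * n^-1) -> a \is a GRing.unit.
  by move=> /Hu; rewrite unitrMl ?unitrV // unitrMr.
apply: (hg [set a | H (n * a * n^-1)]); last by move=> a /hS /SH.
split=> /=; [by rewrite mulr1 mulrV|exact: gu| |].
  move=> a c ha hc; have -> : n * (a * c) * n^-1 = n * a * n^-1 * (n * c * n^-1).
    by rewrite !mulrA mulrVK.
  exact: HM.
move=> a ha; have -> : n * a^-1 * n^-1 = (n * a * n^-1)^-1.
  have una : n * a \is a GRing.unit by rewrite unitrMl // gu.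
  have unV : n^-1 \is a GRing.unit by rewrite unitrV.
  by rewrite (invrM una unV) (invrM un (gu _ ha)) invrK mulrA.
exact: HV.
Qed.

Lemma SU_u_ma (z : L * L) : Hset conj z -> SU conj (u_ma conj z).
Proof.
by move=> hz; exact: (SUM conjK (SUM conjK (SU_s conj) (SU_u conjK hz)) (SU_s conj)).
Qed.

Let S_at x := U_a_at conj nu x `|` U_ma_at conj nu x.

Let S_at_unit x g : S_at x g -> g \is a GRing.unit.
Proof.
case=> -[z [hz _] <-]; first exact/SU_unit/SU_u.
exact/SU_unit/SU_u_ma.
Qed.

Lemma U_at_subgroup x : is_subgroup (U_at conj nu x).
Proof. exact: generated_subgroup (@S_at_unit x). Qed.

Let S_at_a t x g : t != 0 -> S_at x g ->
  S_at (x - nu t / 2) (a_tilde conj t * g * (a_tilde conj t)^-1).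
Proof.
have key t0 (z : L * L) : t0 != 0 -> Hset conj z ->
    Hset conj (conj t0 ^+ 2 / t0 * z.1, t0 * conj t0 * z.2) /\
    (z.2 = 0 \/ nu (t0 * conj t0 * z.2) = nu t0 + nu t0 + nu z.2).
  move=> t00 hz; have ct0 : conj t0 != 0 by rewrite conj0.
  split.
    have h : t0 * conj t0 * (nrm conj z.1 + trc conj z.2) = 0 by rewrite hz mulr0.
    rewrite /Hset /= -[RHS]h /nrm /trc !(rmorphM, fmorphV, rmorphXn) conjK /=.
    by field; rewrite ?t00 ?ct0.
  have [z2|z2] := eqVneq z.2 0; first by left.
  by right; rewrite !nuM ?mulf_neq0 // nu_conj.
move=> t0; have ct0 : conj t != 0 by rewrite conj0.
case=> -[z [hz vz] <-].
  left; rewrite a_tilde_u //; have [h1 h2] := key t z t0 hz.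
  apply: imageP; split=> //=; case: vz => [->|vz]; first by left; rewrite mulr0.
  case: h2 => [->|->]; [by left; rewrite mulr0|right].
  by move: vz; rewrite /a_form; lra.
right; set t' := (conj t)^-1; have t'0 : t' != 0 by rewrite invr_eq0.
have uV := SU_unit (SU_a conjK t0); have uV' := SU_unit (SU_a conjK t'0).
have -> : a_tilde conj t * u_ma conj z * (a_tilde conj t)^-1 =
    s_mx L * (a_tilde conj t' * u_a conj z * (a_tilde conj t')^-1) * s_mx L.
  have e := a_tilde_s t0; rewrite /u_ma !mulrA e -/t'.
  rewrite -!mulrA; congr (_ * (_ * (_ * _))).
  apply: (mulIr uV); rewrite mulrVK // -[RHS]mulrA.
  have -> : s_mx L * a_tilde conj t = a_tilde conj t' * s_mx L.
    by rewrite /t' a_tilde_s ?invr_eq0 // fmorphV conjK invrK.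
  by rewrite mulKr.
rewrite a_tilde_u //; have [h1 h2] := key t' z t'0 hz.
apply: imageP; split=> //=; case: vz => [->|vz]; first by left; rewrite mulr0.
case: h2 => [->|->]; [by left; rewrite mulr0|right].
by move: vz; rewrite /a_form /t' nuV // nu_conj //; lra.
Qed.

Let S_at_s x g : S_at x g -> S_at (- x) (s_mx L * g * (s_mx L)^-1).
Proof.
rewrite (s_mxV conj); case=> -[z [hz vz] <-].
  right; apply: imageP; split=> //; case: vz => [|vz]; [by left|right].
  by move: vz; rewrite /a_form; lra.
left; have -> : s_mx L * u_ma conj z * s_mx L = u_a conj z.
  rewrite /u_ma !mulrA (s_mx_sq L) mul1r -mulrA (s_mx_sq L) mulr1 //.
apply: imageP; split=> //; case: vz => [|vz]; [by left|right].
by move: vz; rewrite /a_form; lra.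
Qed.

(** This equivariance is what makes [tree_equiv] symmetric and transitive. *)
Lemma U_at_N n x y g : N_acts conj nu n x y -> U_at conj nu x g ->
  U_at conj nu y (n * g * n^-1).
Proof.
move=> hn; elim: hn g => {n x y} [x|t x t0|n m x y z hn IHn hm IHm] g hg.
- by apply: generated_conj hg; [exact: SU_unit (SU_s conj)|exact: S_at_s].
- apply: generated_conj hg; first exact: SU_unit (SU_a conjK t0).
  by move=> h; exact: S_at_a.
- have un := SU_unit (N_acts_SU hn); have um := SU_unit (N_acts_SU hm).
  by rewrite (invrM um un) !mulrA -(mulrA m n g) -(mulrA m) ; exact: IHm (IHn _ hg).
Qed.

Lemma tree_equiv_refl g x : SU conj g -> tree_equiv conj nu (g, x) (g, x).
Proof.
move=> sg; exists 1; first exact: N_acts1.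
rewrite /= mulr1 mulVr; last exact: SU_unit sg.
by have [] := U_at_subgroup x.
Qed.

Lemma tree_equiv_sym g h x y : SU conj g -> SU conj h ->
  tree_equiv conj nu (g, x) (h, y) -> tree_equiv conj nu (h, y) (g, x).
Proof.
move=> sg sh [n /= hn hU]; exists n^-1; first exact: N_actsV.
have [_ _ _ uV] := U_at_subgroup x; have un := SU_unit (N_acts_SU hn).
have := U_at_N hn (uV _ hU); congr U_at => /=.
have ug := SU_unit sg; have uh := SU_unit sh.
have ugV : g^-1 \is a GRing.unit by rewrite unitrV.
have ugh : g^-1 * h \is a GRing.unit by rewrite unitrMl.
by rewrite (invrM ugh un) (invrM ugV uh) invrK !mulrA mulrV // mul1r.
Qed.

Lemma tree_equiv_trans g h k x y z : SU conj g -> SU conj h ->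
  tree_equiv conj nu (g, x) (h, y) -> tree_equiv conj nu (h, y) (k, z) ->
  tree_equiv conj nu (g, x) (k, z).
Proof.
move=> sg sh [n /= hn hU] [m /= hm hU']; exists (m * n); first exact: N_acts_mul hm.
have [_ _ uM _] := U_at_subgroup x; have un := SU_unit (N_acts_SU hn).
have := uM _ _ hU (U_at_N (N_actsV hn) hU'); congr U_at => /=.
have uh := SU_unit sh.
by rewrite invrK !mulrA (mulrK un) (mulrK uh).
Qed.

Lemma tree_equiv_pt g h x y : SU conj g -> SU conj h ->
  tree_equiv conj nu (g, x) (h, y) -> pt conj nu g x = pt conj nu h y.
Proof.
move=> sg sh e; apply/seteqP; split=> -[k z] [/= sk ek]; split=> //=.
  exact: tree_equiv_trans (tree_equiv_sym sg sh e) ek.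
exact: tree_equiv_trans e ek.
Qed.

Lemma pt_tree_equiv g h x y : SU conj h ->
  pt conj nu g x = pt conj nu h y -> tree_equiv conj nu (g, x) (h, y).
Proof.
move=> sh e; have : pt conj nu h y (h, y) by split=> //; exact: tree_equiv_refl.
by rewrite -e => -[].
Qed.

Let vgr t r := t = 0 \/ r <= nu t.

Let vgrW t r r' : r <= r' -> vgr t r' -> vgr t r.
Proof. by move=> h [->|h']; [left|right; exact: le_trans h h']. Qed.

Let vgrD t t' r : vgr t r -> vgr t' r -> vgr (t + t') r.
Proof.
move=> [->|ht]; first by rewrite add0r.
move=> [->|ht']; first by rewrite addr0; right.
have [->|t0] := eqVneq t 0; first by rewrite add0r; right.
have [->|t'0] := eqVneq t' 0; first by rewrite addr0; right.
have [tt0|tt0] := eqVneq (t + t') 0; first by left.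
by right; apply: le_trans (nuD t0 t'0 tt0); rewrite le_min ht.
Qed.

Let vgrM t t' r r' : vgr t r -> vgr t' r' -> vgr (t * t') (r + r').
Proof.
move=> [->|ht]; first by left; rewrite mul0r.
move=> [->|ht']; first by left; rewrite mulr0.
have [->|t0] := eqVneq t 0; first by left; rewrite mul0r.
have [->|t'0] := eqVneq t' 0; first by left; rewrite mulr0.
by right; rewrite nuM // lerD.
Qed.

Let vgr_conj t r : vgr t r -> vgr (conj t) r.
Proof.
move=> [->|h]; first by left; rewrite rmorph0.
have [->|t0] := eqVneq t 0; first by left; rewrite rmorph0.
by right; rewrite nu_conj.
Qed.

Let vgr1 r : r <= 0 -> vgr 1 r.
Proof. by right; rewrite nu1. Qed.

Let vgrN t r : vgr t r -> vgr (- t) r.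
Proof.
move=> h; rewrite -mulN1r -[r]add0r; apply: vgrM => //; right.
have N1 : (-1 : L) != 0 by rewrite oppr_eq0 oner_neq0.
have := nuM N1 N1; rewrite mulrNN mulr1 nu1; lra.
Qed.

Let wt x (i : 'I_3) : R := 2 * x * (1 - i%:R).

(* The stabiliser of the norm min (nu v_i + wt x i), where x determines the    *)
(* weights (2x, 0, -2x) of the coordinates.                                    *)
Let parahoric x : set 'M[L]_3 :=
  [set g | SU conj g /\ forall i l, vgr (g i l) (wt x l - wt x i)].

Let parahoric_subgroup x : is_subgroup (parahoric x).
Proof.
split.
- split; first exact: SU1.
  move=> i l; rewrite mxE; case: eqP => [->|_]; last by left.
  by apply: vgr1; rewrite subrr.
- by move=> g [/SU_unit].
- move=> g h [sg hg] [sh hh]; split; first exact: SUM.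
  move=> i l; rewrite mxE sum_ord3; apply: (vgrD (vgrD _ _)).
  + have -> : wt x l - wt x i = (wt x o0 - wt x i) + (wt x l - wt x o0) by ring.
    exact: vgrM.
  + have -> : wt x l - wt x i = (wt x o1 - wt x i) + (wt x l - wt x o1) by ring.
    exact: vgrM.
  + have -> : wt x l - wt x i = (wt x o2 - wt x i) + (wt x l - wt x o2) by ring.
    exact: vgrM.
- move=> g [sg hg]; split; first exact: SUV.
  move=> i l; rewrite (SU_inv sg) mxE; apply: vgr_conj.
  have wr m : wt x (rev_ord m) = - wt x m.
    by move: m; apply: ord3P; rewrite rev_ord3 /wt /=; lra.
  by have := hg (rev_ord l) (rev_ord i); rewrite !wr opprK addrC.
Qed.

(** Since N(u) = - T(v), a lower bound r for nu(v) gives r / 2 for nu(u); these are the bounds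
    required of the entries of the generators. *)
Let U_at_parahoric x g : U_at conj nu x g -> parahoric x g.
Proof.
apply; first exact: parahoric_subgroup.
have key (z : L * L) r : Hset conj z -> vgr z.2 r -> vgr z.1 (r / 2).
  move=> hz vz; have [->|z1] := eqVneq z.1 0; first by left.
  right; have : vgr (nrm conj z.1) r.
    have -> : nrm conj z.1 = - trc conj z.2 by apply/eqP; rewrite -addr_eq0 hz.
    by apply/vgrN/vgrD => //; exact: vgr_conj.
  case=> [/eqP|]; first by rewrite mulf_eq0 conj0 orbb (negPf z1).
  by rewrite /nrm nuM ?conj0 // nu_conj //; lra.
move=> _ [[z [hz vz] <-]|[z [hz vz] <-]].
  split; first exact: SU_u.
  have v1 := key _ _ hz vz.
  apply: ord3P; apply: ord3P; rewrite mxE /wt /=; try (by left); try (by apply: vgr1; lra).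
  - by apply/vgrN/vgr_conj; apply: vgrW v1; rewrite /a_form; lra.
  - by apply: vgrW vz; rewrite /a_form; lra.
  - by apply: vgrW v1; rewrite /a_form; lra.
split.
  exact: SU_u_ma.
have v1 := key _ _ hz vz.
have -> : u_ma conj z = M3 1 0 0 z.1 1 0 z.2 (- conj z.1) 1.
  by rewrite /u_ma /s_mx /u_a !mx3_mul; congr mx3; repeat congr cons; ring.
apply: ord3P; apply: ord3P; rewrite mxE /wt /=; try (by left); try (by apply: vgr1; lra).
- by apply: vgrW v1; rewrite /a_form; lra.
- by apply: vgrW vz; rewrite /a_form; lra.
- by apply/vgrN/vgr_conj; apply: vgrW v1; rewrite /a_form; lra.
Qed.

(** Some g n lies in the parahoric of x. Its entry (2, 0), or (2, 2) when n involves s, is [g o2 o0]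
    up to sign times t or 1 / conj t, and nu t is determined by x and y. *)
Lemma pt_lower_left g x y : SU conj g -> pt conj nu 1 x = pt conj nu g y ->
  g o2 o0 = 0 \/ 2 * (x + y) <= nu (g o2 o0).
Proof.
move=> sg /(pt_tree_equiv sg) [n /= hn /U_at_parahoric[_]].
rewrite invr1 mul1r => hP; have [g0|g0] := eqVneq (g o2 o0) 0; first by left.
right; have [t t0 [[nE yE]|[nE yE]]] := N_actsP hn; have ct0 : conj t != 0 by rewrite conj0.
  have := hP o2 o0; rewrite nE mxE sum_ord3 !mxE /= !mulr0 !addr0.
  case=> [/eqP|]; first by rewrite mulf_eq0 (negPf g0) (negPf t0).
  by rewrite nuM // /wt /= yE; lra.
have := hP o2 o2; rewrite nE /s_mx /a_tilde mx3_mul mxE sum_ord3 !mxE /=.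
rewrite !(mulr0, mul0r, addr0, add0r) => -[/eqP|].
  by rewrite mulf_eq0 (negPf g0) /= mulN1r oppr_eq0 invr_eq0 (negPf ct0).
rewrite mulN1r mulrN subrr => h.
have : vgr (- (g o2 o0 * (conj t)^-1)) 0 by right.
move=> /vgrN; rewrite opprK => -[/eqP|].
  by rewrite mulf_eq0 (negPf g0) invr_eq0 (negPf ct0).
by rewrite nuM ?invr_eq0 // nuV // nu_conj // yE; lra.
Qed.

Lemma pt1_inj x y : pt conj nu 1 x = pt conj nu 1 y -> x = y.
Proof.
move=> /(pt_tree_equiv (SU1 conjK)) [n /= hn /U_at_parahoric[_]].
rewrite invr1 !mul1r => hP.
have [t t0 [[nE ->]|[nE ->]]] := N_actsP hn; have ct0 : conj t != 0 by rewrite conj0.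
  have h1 : 0 <= nu t.
    have := hP o0 o0; rewrite nE mxE /= subrr => -[/eqP|//].
    by rewrite (negPf t0).
  have h2 : 0 <= - nu t.
    have := hP o2 o2; rewrite nE mxE /= subrr => -[/eqP|].
      by rewrite invr_eq0 (negPf ct0).
    by rewrite nuV // nu_conj.
  lra.
have h1 : 4 * x <= nu t.
  have := hP o2 o0; rewrite nE /s_mx /a_tilde mx3_mul mxE /=.
  rewrite !(mulr0, mul0r, addr0, add0r) mulN1r => /vgrN; rewrite opprK /wt => -[/eqP|].
    by rewrite (negPf t0).
  by rewrite /=; lra.
have h2 : - 4 * x <= - nu t.
  have := hP o0 o2; rewrite nE /s_mx /a_tilde mx3_mul mxE /=.
  rewrite !(mulr0, mul0r, addr0, add0r) mulN1r => /vgrN; rewrite opprK /wt => -[/eqP|].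
    by rewrite invr_eq0 (negPf ct0).
  by rewrite nuV // nu_conj //=; lra.
lra.
Qed.

Lemma act_ptE g h x : SU conj g -> SU conj h ->
  act_pt g (pt conj nu h x) = pt conj nu (g * h) x.
Proof.
move=> sg sh; have ug := SU_unit sg; have uh := SU_unit sh.
apply/seteqP; split=> [_ [[k y] [/= sk [n hn hU]] <-]|[k y] [/= sk [n hn hU]]].
  split=> /=; first exact: SUM.
  exists n => //=; have -> : (g * h)^-1 * (g * k) = h^-1 * k => //.
  by rewrite (invrM ug uh) -mulrA mulKr.
exists (g^-1 * k, y); last by rewrite /= mulVKr.
split=> /=; first by apply: SUM => //; exact: SUV.
by exists n => //=; move: hU; rewrite /= (invrM ug uh) !mulrA.
Qed.

Lemma act_ptM g h (X : Defs.point R L) : act_pt (g * h) X = act_pt g (act_pt h X).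
Proof.
apply/seteqP; split=> [_ [k Xk <-]|_ [_ [k Xk <-] <-]].
  by exists (h * k.1, k.2); [exists k|rewrite /= mulrA].
by exists k => //=; rewrite mulrA.
Qed.

Lemma act_pt1 (X : Defs.point R L) : act_pt 1 X = X.
Proof.
apply/seteqP; split=> [_ [[k y] Xk <-]|[k y] Xk]; first by rewrite /= mul1r.
by exists (k, y); rewrite //= mul1r.
Qed.

Lemma act_endM g h (xi : tree_end R L) : act_end (g * h) xi = act_end g (act_end h xi).
Proof.
apply/seteqP; split=> [_ [r xr <-]|_ [_ [r xr <-] <-]].
  by exists (fun i => act_pt h (r i)); [exists r|apply/funext => i; rewrite act_ptM].
by exists r => //; apply/funext => i; rewrite act_ptM.
Qed.

Lemma act_end1 (xi : tree_end R L) : act_end 1 xi = xi.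
Proof.
have e (r : nat -> Defs.point R L) : (fun i => act_pt 1 (r i)) = r.
  by apply/funext => i; exact: act_pt1.
apply/seteqP; split=> [_ [r xr <-]|r xr]; first by rewrite e.
by exists r; rewrite ?e.
Qed.

Lemma ray_act g rho : SU conj g -> ray conj nu rho ->
  ray conj nu (fun i => act_pt g (rho i)).
Proof.
move=> sg [hv ha hi]; split.
- move=> i; have [h [x [sh vx ->]]] := hv i; exists (g * h), x.
  by rewrite act_ptE //; split=> //; exact: SUM.
- move=> i; have [h [x [y [sh cxy e]]]] := ha i; exists (g * h), x, y; split=> //.
    exact: SUM.
  by case: e => -[-> ->]; rewrite !act_ptE //; [left|right].
- move=> i l /(congr1 (act_pt g^-1)); rewrite -!act_ptM mulVr ?act_pt1; first exact: hi.
  exact: SU_unit sg.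
Qed.

Lemma same_limit_sym (r r' : nat -> Defs.point R L) : same_limit r r' -> same_limit r' r.
Proof. by move=> [m [p h]]; exists p, m => i; rewrite h. Qed.

Lemma same_limit_trans (r r' r'' : nat -> Defs.point R L) :
  same_limit r r' -> same_limit r' r'' -> same_limit r r''.
Proof.
move=> [m [p h]] [m' [p' h']]; exists (m + m')%N, (p' + p)%N => i.
by rewrite -!addnA h addnCA h' addnA addnAC -addnA (addnC i).
Qed.

Lemma visual_limit_eq (r r' : nat -> Defs.point R L) : same_limit r r' ->
  visual_limit conj nu r = visual_limit conj nu r'.
Proof.
move=> h; apply/seteqP; split=> s [rs hs]; split=> //.
  exact: same_limit_trans (same_limit_sym h) hs.
exact: same_limit_trans h hs.
Qed.

Lemma act_end_visual_limit g rho : SU conj g ->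
  act_end g (visual_limit conj nu rho) =
  visual_limit conj nu (fun i => act_pt g (rho i)).
Proof.
move=> sg; have ug := SU_unit sg; apply/seteqP; split.
  move=> _ [s [rs [m [p h]]] <-]; split; first exact: ray_act.
  by exists m, p => i; rewrite h.
move=> s [rs [m [p h]]]; exists (fun i => act_pt g^-1 (s i)).
  split; first by apply: ray_act => //; exact: SUV.
  by exists m, p => i; rewrite -h -act_ptM mulVr // act_pt1.
by apply/funext => i; rewrite -act_ptM mulrV // act_pt1.
Qed.

Let rho0 i := pt conj nu 1 (i%:R * q).

Lemma standard_ray : ray conj nu rho0.
Proof.
split.
- move=> i; exists 1, (i%:R * q); split=> //; first exact: SU1.
  by apply/apt_vertexP; exists i%:Z.
- move=> i; exists 1, (i%:R * q), (i.+1%:R * q); split; last by left.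
    exact: SU1.
  exact: consecutive_nat.
- move=> i l /pt1_inj /(mulIf (lt0r_neq0 q_gt0)) /eqP.
  by rewrite eqr_nat => /eqP.
Qed.

Lemma xi_inftyE : xi_infty conj nu = visual_limit conj nu rho0.
Proof.
apply/seteqP; split=> [r [s [s0 hs]]|r h]; first by rewrite (vertex_enumeration s0 hs).
exists (fun i => i%:R * q); split=> //; first by rewrite mul0r.
exact: consecutive_nat.
Qed.

Lemma boundary_act g : SU conj g -> boundary conj nu (act_end g (xi_infty conj nu)).
Proof.
move=> sg; rewrite xi_inftyE act_end_visual_limit //.
exists (fun i => act_pt g (rho0 i)) => //; split; first exact: ray_act standard_ray.
exists g => // i; exists (i%:R * q); rewrite /rho0 act_ptE ?mulr1 //; exact: SU1.
Qed.

(** If g fixes the end, [pt_lower_left] applied far along the ray exceeds any bound for nu of the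
    lower left entry, which is therefore 0. Conversely, in u_a(z) a_tilde(t) the torus part
    translates the ray and u_a(z) fixes its points far enough out. *)
Lemma xi_infty_stabilizer g : SU conj g ->
  act_end g (xi_infty conj nu) = xi_infty conj nu <-> borel conj g.
Proof.
move=> sg; have s1 := SU1 conjK; rewrite xi_inftyE act_end_visual_limit //; split=> [e|bg].
  have : visual_limit conj nu rho0 (fun i => act_pt g (rho0 i)).
    rewrite -e; split; first exact: ray_act standard_ray.
    by exists 0%N, 0%N.
  move=> [_ [m [p h]]]; apply: SU_lower_left0 => //.
  apply/eqP/negPn/negP => g0; pose r := nu (g o2 o0) / (4 * q).
  have := h (Num.bound `|r|); rewrite /rho0 act_ptE // mulr1 => /(pt_lower_left sg).
  case=> [/eqP|]; first by rewrite (negPf g0).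
  have : r < (Num.bound `|r|)%:R by apply: le_lt_trans (ler_norm r) (archi_boundP (normr_ge0 r)).
  have -> : nu (g o2 o0) = r * (4 * q) by rewrite /r divfK // mulf_neq0 ?lt0r_neq0.
  rewrite !natrD; have m0 : 0 <= m%:R :> R by [].
  have p0 : 0 <= p%:R :> R by [].
  by move: (Num.bound `|r|)%:R => b hb; have := q_gt0; nra.
apply: visual_limit_eq.
have [t [z [t0 hz gE _ _]]] := borel_decomposition conjK bg.
have [k kE] := nu_range t0; pose r := - nu z.2 / (4 * q).
(* The translation is by 2 k vertices, so the second term of p makes m = p + 2 k nonnegative; the
   first one puts u_a(z) in U_x for all x >= p q. *)
pose p := (Num.bound `|r| + 2 * `|k|)%N.
have [m mE] : exists m : nat, m%:Z = p%:Z + 2 * k.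
  by exists (absz (p%:Z + 2 * k)); rewrite /p; lia.
exists m, p => i; rewrite /rho0 act_ptE // mulr1; apply/esym/tree_equiv_pt => //.
have ut := SU_unit (SU_a conjK t0).
exists (a_tilde conj t)^-1 => /=.
  rewrite a_tildeV //.
  have -> : (m + i)%:R * q = (p + i)%:R * q - nu t^-1 / 2.
    have : m%:R = p%:R + 2 * k%:~R :> R.
      by rewrite -[m%:R]/(m%:Z%:~R) mE intrD intrM.
    by rewrite nuV // kE !natrD => ->; rewrite /q; lra.
  by apply: N_acts_a; rewrite invr_eq0.
rewrite invr1 mul1r gE mulrK //; apply: sub_generated; left; apply: imageP.
split=> //; right; rewrite /a_form.
have : r < (Num.bound `|r|)%:R by apply: le_lt_trans (ler_norm r) (archi_boundP (normr_ge0 r)).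
have -> : nu z.2 = - r * (4 * q) by rewrite mulNr /r divfK ?opprK // mulf_neq0 ?lt0r_neq0.
rewrite /p !natrD; have k0 : 0 <= (2 * `|k|)%N%:R :> R by [].
have i0 : 0 <= i%:R :> R by [].
by move: (Num.bound `|r|)%:R => b hb; have := q_gt0; nra.
Qed.

Lemma xi_of_transport z z' g : Hinf conj z -> Hinf conj z' -> SU conj g ->
  act_end g (xi_of conj nu z) = xi_of conj nu z' <->
  borel conj (g_of conj z' * g * (g_of conj z)^-1).
Proof.
move=> hz hz' sg; have sc := SU_g_of conjK hz; have sc' := SU_g_of conjK hz'.
have uc' := SU_unit sc'.
rewrite -xi_infty_stabilizer; last exact: (SUM conjK (SUM conjK sc' sg) (SUV conjK sc)).
rewrite /xi_of; split=> [e|e].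
  by rewrite -mulrA !act_endM e -act_endM mulrV // act_end1.
rewrite -[in RHS]e -!act_endM; congr act_end.
by rewrite -mulrA mulKr.
Qed.
End BruhatTitsTree.

(** * Unipotent subgroups of finite index subgroups *)

Section GroupLemmas.
Variable M : unitRingType.
Implicit Types (G H S : set M) (g h c : M).

Lemma conj_setVE c S g : c \is a GRing.unit ->
  conj_set c^-1 S g <-> S (c * g * c^-1).
Proof.
move=> uc; split=> [[x Sx <-]|Sg].
  by rewrite invrK !mulrA mulrV // mul1r mulrK.
by exists (c * g * c^-1); rewrite // invrK !mulrA mulVr // mul1r mulrVK.
Qed.

Lemma unipotent_conj c g : c \is a GRing.unit ->
  unipotent g -> unipotent (c * g * c^-1).
Proof.
move=> uc [n hn]; exists n.
have -> : c * g * c^-1 - 1 = c * (g - 1) * c^-1.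
  by rewrite mulrBr mulrBl mulr1 mulrV.
suff -> : (c * (g - 1) * c^-1) ^+ n = c * (g - 1) ^+ n * c^-1.
  by rewrite hn mulr0 mul0r.
elim: n {hn} => [|n IH]; first by rewrite !expr0 mulr1 mulrV.
by rewrite !exprS IH !mulrA mulrVK.
Qed.

(** Frobenius gives (g - 1)^(p^n) = g^(p^n) - 1, and p^n >= n. *)
Lemma unipotent_pchar p g : p \in [pchar M] -> unipotent g ->
  exists m, g ^+ (p ^ m) = 1.
Proof.
move=> pM [n hn]; exists n.
have e m : (g - 1) ^+ (p ^ m) = g ^+ (p ^ m) - 1.
  elim: m => [|m IH]; first by rewrite !expr1.
  rewrite expnSr !exprM IH -!(pFrobenius_autE pM) pFrobenius_autB_comm.
    by rewrite pFrobenius_aut1.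
  exact: commr1.
apply/eqP; rewrite -subr_eq0 -e.
have h : (n <= p ^ n)%N.
  by apply/ltnW/ltn_expl/prime_gt1; case/andP: pM.
by rewrite -(subnKC h) exprD hn mul0r.
Qed.

Lemma quotient_embeds_character (N : unitRingType) G (chi : M -> N) :
  is_subgroup G -> (forall g, G g -> chi g \is a GRing.unit) ->
  (forall g h, G g -> G h -> chi (g * h) = chi g * chi h) ->
  quotient_embeds N G (G `&` [set g | chi g = 1]).
Proof.
move=> [G1 Gu GM GV] chiu chiM.
have chi1 : chi 1 = 1.
  by apply: (mulrI (chiu _ G1)); rewrite -chiM // !mulr1.
have chiV g : G g -> chi g^-1 = (chi g)^-1.
  move=> Gg; apply: (mulrI (chiu _ Gg)); rewrite -chiM //; last exact: GV.
  by rewrite (mulrV (Gu _ Gg)) chi1 (mulrV (chiu _ Gg)).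
set H := G `&` _.
have sH : is_subgroup H.
  split; [by split|by move=> g [/Gu]| |].
    by move=> g h [Gg /= cg] [Gh /= ch]; split; [exact: GM|rewrite /= chiM // cg ch mulr1].
  by move=> g [Gg /= cg]; split; [exact: GV|rewrite /= chiV // cg invr1].
split.
  split=> //; first by move=> g [].
  move=> g h Gg [Gh /= ch]; split; first exact: GM _ _ (GM _ _ Gg Gh) (GV _ Gg).
  by rewrite /= chiM ?chiM ?ch ?mulr1 ?chiV ?mulrV; auto.
have image_coset g : G g -> chi @` lcoset g H = [set chi g].
  move=> Gg; apply/seteqP; split=> [_ [_ [h [Gh /= ch] <-] <-]|_ ->].
    by rewrite /= chiM // ch mulr1.
  by exists (g * 1); rewrite ?mulr1 //; exists 1; rewrite ?mulr1.
(* chi is constant on each coset, so the chosen element of its image is the common value. *)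
pose phi (C : set M) := xget 1 (chi @` C).
have phiE C a : chi @` C = [set a] -> phi C = a.
  by move=> e; rewrite /phi e; apply: xget_subset1 => // x y -> ->.
exists (chi @` G), phi; split.
- split.
  + by exists 1.
  + by move=> _ [g Gg <-]; exact: chiu.
  + by move=> _ _ [g Gg <-] [h Gh <-]; exists (g * h); [exact: GM|exact: chiM].
  + by move=> _ [g Gg <-]; exists g^-1; [exact: GV|exact: chiV].
- split.
  + by move=> _ [g Gg <-]; rewrite (phiE _ _ (image_coset _ Gg)); exists g.
  + move=> C D /set_mem [g Gg <-] /set_mem [h Gh <-].
    rewrite (phiE _ _ (image_coset _ Gg)) (phiE _ _ (image_coset _ Gh)) => e.
    have sub g1 g2 : G g1 -> G g2 -> chi g1 = chi g2 -> lcoset g1 H `<=` lcoset g2 H.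
      move=> h1 h2 e12 _ [k [Gk /= ck] <-]; exists (g2^-1 * (g1 * k)).
        split; first exact: GM _ _ (GV _ h2) (GM _ _ h1 Gk).
        by rewrite /= chiM ?chiM ?chiV ?ck ?mulr1 ?e12 ?mulVr; auto.
      by rewrite mulVKr //; exact: Gu.
    by apply/seteqP; split; apply: sub.
  + move=> _ [g Gg <-]; exists (lcoset g H); first by exists g.
    exact: phiE (image_coset _ Gg).
- move=> _ _ [g Gg <-] [h Gh <-].
  rewrite (phiE _ _ (image_coset _ Gg)) (phiE _ _ (image_coset _ Gh)).
  apply: phiE; apply/seteqP; split=> [_ [_ [x [y [[a [Ga /= ca] <-] [b [Gb /= cb] <-] ->]]] <-]|_ ->].
    by rewrite /= chiM ?chiM ?ca ?cb ?mulr1; auto.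
  exists (g * h); last exact: chiM.
  by exists g, h; split=> //; exists 1; rewrite ?mulr1.
Qed.

Lemma is_subgroupI G H : is_subgroup G -> is_subgroup H -> is_subgroup (G `&` H).
Proof.
move=> [G1 Gu GM GV] [H1 _ HM HV]; split=> [//|g [/Gu]//|g h [? ?] [? ?]|g [? ?]].
  by split; [exact: GM|exact: HM].
by split; [exact: GV|exact: HV].
Qed.

Lemma is_subgroup_conj c S : c \is a GRing.unit -> is_subgroup S ->
  is_subgroup (conj_set c^-1 S).
Proof.
move=> uc [S1 Su SM SV]; split.
- by apply/(conj_setVE _ _ uc); rewrite mulr1 mulrV.
- by move=> g /(conj_setVE _ _ uc)/Su; rewrite unitrMl ?unitrV // unitrMr.
- move=> g h /(conj_setVE _ _ uc) Sg /(conj_setVE _ _ uc) Sh.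
  apply/(conj_setVE _ _ uc); have -> : c * (g * h) * c^-1 = c * g * c^-1 * (c * h * c^-1).
    by rewrite !mulrA mulrVK.
  exact: SM.
- move=> g /(conj_setVE _ _ uc) Sg; apply/(conj_setVE _ _ uc).
  have ug : g \is a GRing.unit by have := Su _ Sg; rewrite unitrMl ?unitrV // unitrMr.
  have -> : c * g^-1 * c^-1 = (c * g * c^-1)^-1.
    have ucg : c * g \is a GRing.unit by rewrite unitrMl.
    have ucV : c^-1 \is a GRing.unit by rewrite unitrV.
    by rewrite (invrM ucg ucV) (invrM uc ug) invrK mulrA.
  exact: SV.
Qed.

Lemma finite_index_collision G H (f : nat -> M) : finite_index G H ->
  (forall n, G (f n)) -> (forall n, f n \is a GRing.unit) -> exists n m, n <> m /\ H ((f n)^-1 * f m).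
Proof.
move=> [[H1 Hu HM HV] HG fin] Gf uf.
have [n [m [nm e]]] : exists n m, n <> m /\ lcoset (f n) H = lcoset (f m) H.
  apply: contrapT => h; apply: infinite_nat.
  have inj : {in setT &, injective (fun n => lcoset (f n) H)}.
    move=> n m _ _ e; apply: contrapT => nm; apply: h; by exists n, m.
  rewrite -(eq_finite_set (inj_card_eq inj)); apply: sub_finite_set fin.
  by move=> _ [n _ <-]; exists (f n).
exists n, m; split=> //.
have : lcoset (f m) H (f m) by exists 1; rewrite ?mulr1.
rewrite -e => -[h Hh <-].
by rewrite (mulKr (uf n)).
Qed.
End GroupLemmas.

(** * Finite fields *)

Section FiniteFields.
Variables (F : fieldType) (q : nat).
Hypothesis card_F : [set: F] #= `I_q.

Let enumeration : exists s : seq F, [/\ uniq s, forall x, x \in s & size s = q].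
Proof.
have /card_set_bijP[f [ff fi fs]] := card_F.
have /choice[h hE] : forall i : nat, exists x, (i < q)%N -> f x = i.
  move=> i; have [iq|] := boolP (i < q)%N; last by exists 0.
  by have [x _ fx] := fs i iq; exists x.
exists [seq h i | i <- iota 0 q]; split; last by rewrite size_map size_iota.
  rewrite map_inj_in_uniq ?iota_uniq // => i l; rewrite !mem_iota /= => iq lq.
  by move=> /(congr1 f); rewrite !hE.
move=> x; have fxq : (f x < q)%N by exact: (ff x I).
have <- : h (f x) = x by apply: fi; rewrite ?inE // hE.
by apply/map_f; rewrite mem_iota.
Qed.

(** Translation by 1 permutes F, and comparing the sums of all elements leaves q times 1. *)
Lemma natr_card_eq0 : q%:R = 0 :> F.
Proof.
have [s [us hs sz]] := enumeration.
have pe : perm_eq s [seq x + 1 | x <- s].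
  apply: uniq_perm => //; first by rewrite map_inj_uniq //; exact: addIr.
  by move=> x; rewrite hs; apply/esym/mapP; exists (x - 1); rewrite ?subrK.
have : \sum_(x <- s) x = \sum_(x <- s) (x + 1).
  by rewrite {1}(perm_big _ pe) big_map.
rewrite big_split /= -{1}[\sum_(x <- s) x]addr0 => /addrI.
by rewrite big_const_seq count_predT sz iter_addr addr0 => <-.
Qed.

(** Multiplication by a permutes the nonzero elements; compare their products. *)
Lemma finite_order (a : F) : a != 0 -> exists2 n, (0 < n)%N & a ^+ n = 1.
Proof.
move=> a0; have [s [us hs sz]] := enumeration.
pose s' := [seq x <- s | x != 0].
have us' : uniq s' by rewrite filter_uniq.
have pe : perm_eq s' [seq a * x | x <- s'].
  apply: uniq_perm => //; first by rewrite map_inj_uniq //; exact: mulfI.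
  move=> x; rewrite mem_filter hs andbT; apply/idP/mapP => [x0|[y]].
    exists (x / a); last by rewrite mulrC divfK.
    by rewrite mem_filter hs andbT mulf_neq0 // invr_eq0.
  by rewrite mem_filter => /andP[y0 _] ->; rewrite mulf_neq0.
exists (size s').
  by rewrite -has_predT; apply/hasP; exists 1; rewrite // mem_filter hs oner_neq0.
have p0 : \prod_(x <- s') x != 0.
  by rewrite prodf_seq_neq0; apply/allP => x; rewrite mem_filter => /andP[].
apply: (mulIf p0); rewrite mul1r {2}(perm_big _ pe) big_map big_split /=.
by rewrite big_const_seq count_predT iter_mulr mulr1.
Qed.
End FiniteFields.

Section UnipotentSubgroups.
Variables (L : fieldType) (conj : {rmorphism L -> L}).
Hypothesis conjK : involutive conj.

Lemma unipotent_group_cusp (V : set 'M[L]_3) c c' g h :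
  is_subgroup V -> V `<=` SU conj -> V `<=` @unipotent 'M[L]_3 ->
  SU conj c -> SU conj c' -> V g -> V h -> g <> 1 -> h <> 1 ->
  U_a conj (c * g * c^-1) -> U_a conj (c' * h * c'^-1) -> borel conj (c' * c^-1).
Proof.
move=> [V1 Vu VM VV] VS VU sc sc' Vg Vh g1 h1 Ug Uh.
have tr x : V x -> \tr x = 3%:R.
  by move=> Vx; apply: (unipotent_trace conjK); [exact: VS|exact: VU].
apply: (same_cusp conjK sc sc' Ug Uh g1 h1); apply: tr; first exact: VM.
exact: VM _ _ Vg (VV _ Vh).
Qed.

(** U_a is normal in the Borel group, so only the line fixed by the conjugated Borel group
    matters. *)
Lemma U_a_change_cusp c c' g : SU conj c -> SU conj c' ->
  borel conj (c' * c^-1) -> U_a conj (c' * g * c'^-1) -> U_a conj (c * g * c^-1).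
Proof.
move=> sc sc' bw Ug; have uc := SU_unit sc; have uc' := SU_unit sc'.
have [_ _ _ bV] := borel_subgroup conjK.
have := U_a_conj conjK (bV _ bw) Ug; congr U_a.
have ucV : c^-1 \is a GRing.unit by rewrite unitrV.
by rewrite invrK (invrM uc' ucV) invrK !mulrA (mulrVK uc') (mulrVK uc').
Qed.

Lemma U_of_unipotent_subgroup (G : set 'M[L]_3) z : is_subgroup G -> Hinf conj z ->
  unipotent_subgroup G (U_of conj G z).
Proof.
move=> sG hz; have sc := SU_g_of conjK hz; have uc := SU_unit sc.
split; [|by move=> g []|].
  by apply: is_subgroupI sG; apply: is_subgroup_conj uc (U_a_subgroup conjK).
move=> g [/(conj_setVE _ _ uc)/U_a_unipotent ug _].
have ucV : (g_of conj z)^-1 \is a GRing.unit by rewrite unitrV.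
have := unipotent_conj ucV ug; congr unipotent.
by rewrite invrK !mulrA mulVr // mul1r mulrVK.
Qed.
End UnipotentSubgroups.

Theorem theorem2p2 (R : realType)
  (F : fieldType) (char_F : 2%N \notin [pchar F]) (perfect_F : perfect_field F)
  (k : fieldType) (iota : {rmorphism F -> k}) (curve_C : is_function_field iota)
  (L : fieldExtType k) (quadratic_L : \dim {:L} = 2%N)
  (closed_L : algebraically_closed_in (in_alg L \o iota : {rmorphism F -> L}))
  (conj : {lrmorphism L -> L}) (conj_nontrivial : exists x, conj x != x)
  (P : place iota) (Q : place (in_alg L \o iota : {rmorphism F -> L}))
  (e : nat) (Q_over_P : lies_over Q P e)
  (Q_unique : forall (Q' : place (in_alg L \o iota : {rmorphism F -> L}))
     (e' : nat), lies_over Q' P e' -> same_place Q' Q)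
  (G : set 'M[L]_3) :
  let nu : L -> R := fun x => (Q x)%:~R / e%:R in
  let A : set k := regular_outside P in
  let B : set L := integral_closure A in
  let Gamma : set 'M[L]_3 := SU_over conj B in
  finite_index Gamma G ->
  forall (Sigma : Type) (xi : Sigma -> tree_end R L)
    (z : Sigma -> option (L * L)),
  orbit_representatives conj nu G xi ->
  (forall sigma, Hinf conj (z sigma) /\ xi_of conj nu (z sigma) = xi sigma) ->
  let G_ sigma := stab_in conj G (xi sigma) in
  let U_ sigma := U_of conj G (z sigma) in
  [/\ forall sigma,
        G_ sigma = conj_set (g_of conj (z sigma))^-1 (borel conj) `&` G,
      forall sigma,
        [/\ is_subgroup (U_ sigma),
            U_ sigma = G_ sigma `&` @unipotent 'M[L]_3 &
            quotient_embeds F (G_ sigma) (U_ sigma)],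
      [/\ forall sigma, maximal_unipotent_subgroup G (U_ sigma),
          forall U, maximal_unipotent_subgroup G U ->
            exists sigma, conjugate_in G (U_ sigma) U &
          forall sigma1 sigma2, sigma1 <> sigma2 ->
            ~ conjugate_in G (U_ sigma1) (U_ sigma2)] &
      forall p r : nat, prime p -> [set: F] #= `I_((p ^ r)%N) ->
        without_p'_torsion p G -> forall sigma, U_ sigma = G_ sigma].
Proof.
move=> nu A B Gamma fiG Sigma xi z reps hz G_ U_.
pose cj : {rmorphism L -> L} := conj.
have cjK : involutive cj := conjK quadratic_L conj_nontrivial.
have [e_gt0 Q_P] := Q_over_P.
have e0 : e%:R != 0 :> R by rewrite pnatr_eq0 -lt0n.
have Qconj x : x != 0 -> Q (conj x) = Q x.
  exact: (ord_conj quadratic_L conj_nontrivial Q_over_P Q_unique).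
have nuM x y : x != 0 -> y != 0 -> nu (x * y) = nu x + nu y.
  by move=> x0 y0; rewrite /nu ordM // intrD mulrDl.
have nuD x y : x != 0 -> y != 0 -> x + y != 0 -> Num.min (nu x) (nu y) <= nu (x + y).
  move=> x0 y0 xy0; have := ordD Q x0 y0 xy0; rewrite /nu !ge_min.
  by rewrite !ler_pM2r ?invr_gt0 ?ltr0n // !ler_int.
have nu_conj x : x != 0 -> nu (cj x) = nu x by move=> x0; rewrite /nu Qconj.
have eps_gt0 : 0 < e%:R^-1 :> R by rewrite invr_gt0 ltr0n.
have nu_range x : x != 0 -> exists m : int, nu x = m%:~R / e%:R by exists (Q x).
have nu_surj (m : int) : exists2 x, x != 0 & nu x = m%:~R / e%:R.
  have [p p0 Qp] := ord_surj Q; exists (p ^ m); first exact: expfz_neq0.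
  by rewrite /nu ordXz // Qp mulr1.
have transport := xi_of_transport cjK nuM nuD nu_conj eps_gt0 nu_range nu_surj.
have bdry := boundary_act cjK nuM nuD nu_conj eps_gt0 nu_range nu_surj.
have [sG GG _] := fiG; have [G1 Gu GM GV] := sG.
have GS : G `<=` SU conj by move=> g /GG[].
have GB g i l : G g -> B (g i l) by move=> /GG[].
have B_add x y : B x -> B y -> B (x + y).
  by rewrite /B /A regular_outsideE; exact: integral_closureD.
have sc y : Hinf conj y -> SU conj (g_of conj y) := @SU_g_of _ cj cjK y.
have uc y : Hinf conj y -> g_of conj y \is a GRing.unit.
  by move=> hy; exact: (SU_unit (sc y hy)).
have hzs s : Hinf conj (z s) by have [] := hz s.
have xiE s : xi s = xi_of conj nu (z s) by have [] := hz s.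
have stabP s g : G_ s g <-> G g /\ borel conj (g_of conj (z s) * g * (g_of conj (z s))^-1).
  rewrite /G_ /stab_in /end_stabilizer /= xiE; split=> [[[sg e1] Gg]|[Gg bg]].
    by split=> //; apply/(transport _ _ _ (hzs s) (hzs s) sg).
  by split=> //; split; [exact: GS|apply/(transport _ _ _ (hzs s) (hzs s) (GS _ Gg))].
have UP y g : Hinf conj y -> U_of conj G y g <->
    G g /\ U_a conj (g_of conj y * g * (g_of conj y)^-1).
  move=> hy; rewrite /U_of; split=> [[/(conj_setVE _ _ (uc _ hy)) h Gg]//|[Gg h]].
  by split=> //; apply/(conj_setVE _ _ (uc _ hy)).
have stab_eq s : G_ s = conj_set (g_of conj (z s))^-1 (borel conj) `&` G.
  apply/seteqP; split=> g.
    by move=> /stabP[Gg bg]; split=> //; apply/(conj_setVE _ _ (uc _ (hzs s))).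
  by move=> [/(conj_setVE _ _ (uc _ (hzs s))) bg Gg]; apply/stabP.
have G_sub s : is_subgroup (G_ s).
  rewrite stab_eq; apply: is_subgroupI sG.
  exact: is_subgroup_conj (uc _ (hzs s)) (borel_subgroup cjK).
have U_unip y : Hinf conj y -> unipotent_subgroup G (U_of conj G y).
  exact: (@U_of_unipotent_subgroup _ cj cjK G y sG).
(* The diagonal entry is a left eigenvalue of g and of its inverse, both with *)
(* entries in B, hence a unit of B.                                            *)
have diagonal_constant s g : G_ s g -> exists a : F,
    (g_of conj (z s) * g * (g_of conj (z s))^-1) o2 o2 = (iota a)%:A.
  move=> Gsg; have := Gsg; have [_ _ _ GsV] := G_sub s; have GsVg := GsV _ Gsg.
  move=> /stabP[Gg bg]; have /stabP[GVg bVg] := GsVg.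
  set c := g_of conj (z s) in bg bVg *; have ucs := uc _ (hzs s); rewrite -/c in ucs.
  have eig h : G h -> borel conj (c * h * c^-1) -> B ((c * h * c^-1) o2 o2).
    move=> Gh [_ lh]; rewrite /B /A regular_outsideE.
    apply: (@integral_closure_eigenvalue _ _ _ _ h).
      by move=> i l; have := GB h i l Gh; rewrite /B /A regular_outsideE.
    apply/eigenvalueP; exists (row o2 c).
      have rb : row o2 (c * h * c^-1) = (c * h * c^-1) o2 o2 *: delta_mx 0 o2.
        move: (c * h * c^-1) lh => b lb.
        apply/rowP; apply: ord3P; rewrite !mxE /= ?mulr0 ?mulr1 //; exact: lb.
      have ch : c *m h = (c * h * c^-1) *m c by rewrite mulmxE mulrVK.
      by rewrite -row_mul ch row_mul rb -scalemxAl -rowE.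
    apply/eqP => r0; have /matrixP/(_ o2 o2) : c * c^-1 = 1 by rewrite mulrV.
    rewrite mxE sum_ord3 [in X in _ = X]mxE eqxx.
    have r0' m : c o2 m = 0 by have /rowP/(_ m) := r0; rewrite !mxE.
    by rewrite !r0' !mul0r !addr0 => /esym/eqP; rewrite oner_eq0.
  have prod1 : (c * g * c^-1) o2 o2 * (c * g^-1 * c^-1) o2 o2 = 1.
    have [_ <-] := borel_entries bg bVg.
    have -> : c * g * c^-1 * (c * g^-1 * c^-1) = 1.
      by rewrite !mulrA (mulrVK ucs) (mulrK (Gu _ Gg)) mulrV.
    by rewrite mxE.
  have d0 : (c * g * c^-1) o2 o2 != 0.
    by apply/eqP => d0; move/eqP: prod1; rewrite d0 mul0r eq_sym oner_eq0.
  apply: (integer_units_constant curve_C quadratic_L conj_nontrivial closed_L Q_over_P Q_unique) => //.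
    exact: eig.
  have -> : ((c * g * c^-1) o2 o2)^-1 = (c * g^-1 * c^-1) o2 o2.
    by apply: (mulfI d0); rewrite mulfV // prod1.
  exact: eig.
(* The last diagonal entry as a function to F; its values outside G_s are arbitrary. *)
have chiP s : exists chi : 'M[L]_3 -> F, forall g, G_ s g ->
    (g_of conj (z s) * g * (g_of conj (z s))^-1) o2 o2 = (iota (chi g))%:A.
  have /choice[chi h] : forall g, exists a : F, G_ s g ->
      (g_of conj (z s) * g * (g_of conj (z s))^-1) o2 o2 = (iota a)%:A.
    move=> g; have [Gg|] := pselect (G_ s g); last by exists 0.
    by have [a ha] := diagonal_constant s g Gg; exists a.
  by exists chi.
have iota_inj : injective (fun a : F => (iota a)%:A : L).
  by move=> a b /(fmorph_inj (in_alg L))/(fmorph_inj iota).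
have chi_kernel s chi g : (forall g, G_ s g ->
    (g_of conj (z s) * g * (g_of conj (z s))^-1) o2 o2 = (iota (chi g))%:A) ->
    U_ s g <-> G_ s g /\ chi g = 1.
  move=> chiE; rewrite /U_ (UP _ _ (hzs s)); split=> [[Gg /(U_aP2 cjK)[bg e2]]|[Gsg chi1]].
    have Gsg : G_ s g by apply/stabP.
    by split=> //; apply: iota_inj; rewrite -chiE // e2 rmorph1 scale1r.
  have /stabP[Gg bg] := Gsg; split=> //; apply/(U_aP2 cjK); split=> //.
  by rewrite chiE // chi1 rmorph1 scale1r.
have chi_mul s chi g h : (forall g, G_ s g ->
    (g_of conj (z s) * g * (g_of conj (z s))^-1) o2 o2 = (iota (chi g))%:A) ->
    G_ s g -> G_ s h -> chi (g * h) = chi g * chi h.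
  move=> chiE Gg Gh; have [_ _ GsM _] := G_sub s; apply: iota_inj.
  rewrite -chiE; last exact: GsM.
  rewrite rmorphM -scalerA -[X in _ *: X]mul1r scalerAl -!chiE //.
  have /stabP[_ bg] := Gg; have /stabP[_ bh] := Gh.
  have [_ <-] := borel_entries bg bh; congr (fun_of_matrix _ _ _).
  by rewrite !mulrA (mulrVK (uc _ (hzs s))).
have chi_unit s chi g : (forall g, G_ s g ->
    (g_of conj (z s) * g * (g_of conj (z s))^-1) o2 o2 = (iota (chi g))%:A) ->
    G_ s g -> chi g != 0.
  move=> chiE Gg; have [Gs1 Gsu _ GsV] := G_sub s.
  apply/eqP => c0; have [] : 1 = 0 :> F; last by move/eqP; rewrite oner_eq0.
  have <- : chi 1 = 1.
    by have /(chi_kernel s chi 1 chiE)[] : U_ s 1 by have [[]] := U_unip _ (hzs s).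
  rewrite -(mulrV (Gsu _ Gg)) (chi_mul s chi g g^-1) ?c0 ?mul0r //; exact: GsV.
(* For T(v) = 0 the elements u_a(0, v) conjugated to the cusp y are 1 + v M, and infinitely many
   such v bring v M into B. Two of the resulting elements of Gamma lie in the same coset of G, and
   their quotient is nontrivial and unipotent. *)
have nontrivial y : Hinf conj y -> exists g, U_of conj G y g /\ g <> 1.
  move=> hy; pose c := g_of conj y; have ucy : c \is a GRing.unit := uc _ hy.
  pose M : 'M[L]_3 := c^-1 * delta_mx o0 o2 * c.
  have [v [v_inj v_tr v_B]] := infinitely_many_trace_zero curve_C quadratic_L
    conj_nontrivial P (fun il : 'I_3 * 'I_3 => M il.1 il.2).
  have Hv n : Hset conj (0, v n) by rewrite /Hset /= v_tr /nrm mul0r addr0.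
  have uE n : u_a conj (0, v n) = 1 + v n *: delta_mx o0 o2.
    by apply/matrixP; apply: ord3P; apply: ord3P; rewrite !mxE /= ?rmorph0; ring.
  pose f n := c^-1 * u_a conj (0, v n) * c.
  have fE n : f n = 1 + v n *: M.
    by rewrite /f uE mulrDr mulr1 mulrDl mulVr // -scalerAr -scalerAl.
  have sf n : SU conj (f n).
    apply: (SUM cjK); last exact: sc.
    by apply: (SUM cjK); [apply: (SUV cjK); exact: sc|exact: (SU_u cjK)].
  have Gf n : Gamma (f n).
    split=> // i l; rewrite fE mxE; apply: B_add; last by rewrite mxE; exact: v_B n (i, l).
    rewrite mxE /B /A regular_outsideE.
    by case: eqP => _; [exact: integral_closure1|exact: integral_closure0].
  have [n [m [nm Gnm]]] := finite_index_collision fiG Gf (fun n => SU_unit (sf n)).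
  exists ((f n)^-1 * f m); split.
    apply/(UP _ _ hy); split=> //; rewrite -/c.
    have [_ _ UM UV] := U_a_subgroup cjK.
    have -> : c * ((f n)^-1 * f m) * c^-1 = (u_a conj (0, v n))^-1 * u_a conj (0, v m).
      have un := SU_unit (SU_u cjK (Hv n)).
      have ucV : c^-1 \is a GRing.unit by rewrite unitrV.
      have ucu : c^-1 * u_a conj (0, v n) \is a GRing.unit by rewrite unitrMl.
      rewrite /f (invrM ucu ucy) (invrM ucV un) invrK !mulrA (mulrK ucy).
      by rewrite mulrV // mul1r (mulrK ucy).
    by apply: UM; [apply: UV|]; apply: imageP.
  move=> e1; apply: nm; apply: v_inj.
  have fnm : f n = f m by rewrite -[f m](mulVKr (SU_unit (sf n))) e1 mulr1.
  have : u_a conj (0, v n) = u_a conj (0, v m).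
    by rewrite -[u_a conj (0, v n)](mulVKr ucy) -[u_a conj (0, v m)](mulVKr ucy)
      -[c^-1 * u_a conj (0, v n)](mulrK ucy) -/(f n) fnm /f (mulrK ucy).
  by move=> /matrixP/(_ o0 o2); rewrite !mxE.
(* h has some cusp y', and because g and h lie in one unipotent group, y' and y define the same
   line. *)
have unip_cusp V y g h : unipotent_subgroup G V -> Hinf conj y -> V g -> g <> 1 ->
    U_of conj G y g -> V h -> U_of conj G y h.
  move=> [sV VG VU] hy Vg g1 /(UP _ _ hy)[Gg Ug] Vh; apply/(UP _ _ hy); split; first exact: VG.
  have [->|h1] := pselect (h = 1).
    by rewrite mulr1 mulrV; [have [] := U_a_subgroup cjK|exact: uc].
  have VS : V `<=` SU conj by move=> x /VG /GS.
  have [y' hy' Uh] := unipotent_in_cusp cjK (VS _ Vh) (VU _ Vh) h1.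
  apply: (@U_a_change_cusp _ cj cjK _ (g_of conj y')) => //; [exact: sc|exact: sc|].
  exact: (@unipotent_group_cusp _ cj cjK V _ _ g h sV VS VU (sc _ hy) (sc _ hy') Vg Vh g1 h1 Ug Uh).
split.
- exact: stab_eq.
- move=> s; have [sU UG Uu] := U_unip _ (hzs s); have [chi chiE] := chiP s.
  split; first exact: sU.
    apply/seteqP; split=> g.
      move=> Ug; split; last exact: Uu.
      by have /(chi_kernel s chi g chiE)[] := Ug.
    move=> [/stabP[Gg bg] ug]; apply/(UP _ _ (hzs s)); split=> //.
    by apply: (borel_unipotent cjK bg); apply: unipotent_conj ug; exact: uc.
  have -> : U_ s = G_ s `&` [set g | chi g = 1].
    by apply/seteqP; split=> g; move/(chi_kernel s chi g chiE).
  apply: quotient_embeds_character => //.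
    by move=> g Gg; rewrite unitfE (chi_unit s chi g chiE Gg).
  by move=> g h Gg Gh; exact: chi_mul chiE Gg Gh.
- split.
  + move=> s; split; first exact: U_unip.
    move=> V uV UV; apply/seteqP; split=> // h Vh.
    have [g [Ug g1]] := nontrivial _ (hzs s).
    exact: unip_cusp uV (hzs s) (UV _ Ug) g1 Ug Vh.
  + move=> U [uU maxU]; have [sU UG Uu] := uU.
    (* A trivial U would be contained in the unipotent group of infinity, which is nontrivial,
       against maximality. *)
    have [g [Ug g1]] : exists g, U g /\ g <> 1.
      apply: contrapT => triv; have h0 : Hinf conj None by [].
      have [g [Ug g1]] := nontrivial _ h0; apply: (triv); exists g; split=> //.
      rewrite -(maxU (U_of conj G None)) //; first exact: U_unip.
      move=> x Ux; have [->|x1] := pselect (x = 1); first by have [[]] := U_unip _ h0.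
      by exfalso; apply: triv; exists x.
    have [y hy Uy] := unipotent_in_cusp cjK (GS _ (UG _ Ug)) (Uu _ Ug) g1.
    have Uyg : U_of conj G y g by apply/(UP _ _ hy); split=> //; exact: UG.
    have UE : U_of conj G y = U.
      by apply: maxU; [exact: U_unip|move=> h Uh; exact: unip_cusp uU hy Ug g1 Uyg Uh].
    have bxi : boundary conj nu (xi_of conj nu y).
      by apply: bdry; apply: (SUV cjK); exact: sc.
    (* x takes the representative xi s to the end of y, so conjugation by x takes U_ s to U. *)
    have [s [[x Gx ex] _]] := reps.2 _ bxi.
    exists s, x => //; rewrite -UE.
    have bx : borel conj (g_of conj y * x * (g_of conj (z s))^-1).
      by apply/(transport _ _ _ (hzs s) hy (GS _ Gx)); rewrite -xiE.
    have ux := Gu _ Gx; have uxV : x^-1 \is a GRing.unit by rewrite unitrV.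
    have scx : SU conj (g_of conj y * x) by apply: (SUM cjK); [exact: sc|exact: GS].
    have bx' : borel conj (g_of conj (z s) * (g_of conj y * x)^-1).
      have [_ _ _ bV] := borel_subgroup cjK; have := bV _ bx; congr borel.
      have uV : (g_of conj (z s))^-1 \is a GRing.unit by rewrite unitrV; exact: uc.
      by rewrite (invrM (SU_unit scx) uV) invrK.
    have conjE h : g_of conj y * x * h * (g_of conj y * x)^-1 =
        g_of conj y * (x * h * x^-1) * (g_of conj y)^-1.
      by rewrite (invrM (uc _ hy) ux) !mulrA.
    apply/seteqP; split=> h.
      move=> /(UP _ _ hy)[Gh Uh]; exists (x^-1 * h * x); last first.
        by rewrite !mulrA mulrV // mul1r mulrK.
      apply/(UP _ _ (hzs s)); split; first exact: GM _ _ (GM _ _ (GV _ Gx) Gh) Gx.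
      apply: (@U_a_change_cusp _ cj cjK _ (g_of conj y * x)); [exact: sc|exact: scx|exact: bx|].
      rewrite conjE; have -> : x * (x^-1 * h * x) * x^-1 = h => //.
      by rewrite !mulrA mulrV // mul1r mulrK.
    move=> [w /(UP _ _ (hzs s))[Gw Uw] <-]; apply/(UP _ _ hy).
    split; first exact: GM _ _ (GM _ _ Gx Gw) (GV _ Gx).
    rewrite -conjE.
    exact: (@U_a_change_cusp _ cj cjK _ (g_of conj (z s)) _ scx (sc _ (hzs s)) bx' Uw).
  + move=> s1 s2 s12 [x Gx eU]; apply: s12.
    have [g [Ug g1]] := nontrivial _ (hzs s1).
    have ux := Gu _ Gx.
    have Vg : U_ s2 (x * g * x^-1) by rewrite eU; exists g.
    have xg1 : x * g * x^-1 <> 1.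
      move=> e1; apply: g1.
      by rewrite -[g](mulKr ux) -[x * g](mulrVK ux) e1 mul1r mulVr.
    have /(UP _ _ (hzs s1))[Gg Ug1] := Ug; have /(UP _ _ (hzs s2))[_ Ug2] := Vg.
    have [sU UG Uu] := U_unip _ (hzs s2).
    (* x g x^-1 is unipotent both at the image under x of the cusp of s1 and at the cusp of s2.
       Hence x carries xi s1 to xi s2, and uniqueness of representatives gives s1 = s2. *)
    have sx : SU conj (g_of conj (z s1) * x^-1).
      by apply: (SUM cjK); [exact: sc|apply: (SUV cjK); exact: GS].
    have Ug1' : U_a conj (g_of conj (z s1) * x^-1 * (x * g * x^-1) *
        (g_of conj (z s1) * x^-1)^-1).
      have uxV : x^-1 \is a GRing.unit by rewrite unitrV.
      by rewrite (invrM (uc _ (hzs s1)) uxV) invrK !mulrA !(mulrVK ux).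
    have VS : U_ s2 `<=` SU conj by move=> h /UG /GS.
    have := @unipotent_group_cusp _ cj cjK _ _ _ _ _ sU VS Uu sx (sc _ (hzs s2)) Vg Vg xg1 xg1 Ug1' Ug2.
    have -> : g_of conj (z s2) * (g_of conj (z s1) * x^-1)^-1 =
        g_of conj (z s2) * x * (g_of conj (z s1))^-1.
      have uxV : x^-1 \is a GRing.unit by rewrite unitrV.
      by rewrite (invrM (uc _ (hzs s1)) uxV) invrK mulrA.
    move=> /(transport _ _ _ (hzs s1) (hzs s2) (GS _ Gx)); rewrite -!xiE => ex.
    have [s0 [_ uniq_s]] := reps.2 _ (reps.1 s2).
    rewrite -(uniq_s s1); last by exists x.
    apply: uniq_s; exists 1 => //.
    by rewrite act_end1.
- move=> p r p_prime card_F tors s; have [chi chiE] := chiP s.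
  apply/seteqP; split=> [g /(chi_kernel s chi g chiE)[]//|g Gsg].
  apply/(chi_kernel s chi g chiE); split=> //.
  have [Gs1 Gsu GsM GsV] := G_sub s.
  have chiX n : G_ s (g ^+ n) /\ chi (g ^+ n) = chi g ^+ n.
    elim: n => [|n [IH1 IH2]].
      by rewrite !expr0; split=> //; have /(chi_kernel s chi 1 chiE)[] : U_ s 1 by have [[]] := U_unip _ (hzs s).
    rewrite !exprS; split; first exact: GsM.
    by rewrite (chi_mul s chi g (g ^+ n) chiE) // IH2.
  have pF : p \in [pchar F].
    apply/andP; split=> //; have := natr_card_eq0 card_F.
    by rewrite natrX => /eqP; rewrite expf_eq0 => /andP[].
  have pM : p \in [pchar 'M[L]_3].
    apply/andP; split=> //; apply/eqP.
    have pL : p%:R = 0 :> L.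
      have := pcharf0 pF; move=> /(congr1 (fun a => (iota a)%:A : L)).
      by rewrite !rmorph_nat rmorph0 scale0r scaler_nat.
    by rewrite -scaler_nat pL scale0r.
  (* chi g has finite order N, so g^N is in U_ s and has p-power order. Thus g is torsion, and the
     hypothesis makes its order a power of p. *)
  have [N N0 chiN] := finite_order card_F (chi_unit s chi g chiE Gsg).
  have [m gm] : exists m, (g ^+ N) ^+ (p ^ m) = 1.
    apply: (unipotent_pchar pM).
    have [_ _ Uu] := U_unip _ (hzs s); apply: Uu.
    by apply/(chi_kernel s chi _ chiE); have [h1 h2] := chiX N; rewrite h2.
  have ex : exists n, (0 < n)%N && (g ^+ n == 1).
    exists (N * p ^ m)%N; rewrite exprM gm eqxx andbT muln_gt0 N0 expn_gt0.
    by rewrite prime_gt0.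
  case: (ex_minnP ex) => n /andP[n0 /eqP gn] min_n.
  have Gg : G g by have /stabP[] := Gsg.
  have [|l nE] := tors g n Gg.
    by split=> // m' m'0 gm'; apply: min_n; rewrite m'0 gm' eqxx.
  have chin : chi g ^+ (p ^ l) = 1.
    have [_ <-] := chiX (p ^ l)%N; rewrite -nE gn.
    by have /(chi_kernel s chi 1 chiE)[] : U_ s 1 by have [[]] := U_unip _ (hzs s).
  have pl : p.-nat (p ^ l)%N by rewrite pnatX pnat_id.
  have pl' : [pchar F].-nat (p ^ l)%N by rewrite (eq_pnat _ (pcharf_eq pF)).
  (* Frobenius turns chi g^(p^l) = 1 into (chi g - 1)^(p^l) = 0. *)
  have e1 : (chi g - 1 + 1) ^+ (p ^ l) = (chi g - 1) ^+ (p ^ l) + 1.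
    by rewrite exprDn_pchar // expr1n.
  move: e1; rewrite subrK chin -{1}[1]add0r => /addIr/esym/eqP.
  by rewrite expf_eq0 subr_eq0 => /andP[_ /eqP].
Qed.
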